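(* Let $m_1=m_2=n>0$ and $m_3=m>0$ with $2n+m=1$, and let $h\le -1$. Then the three-body problem on $\mathbb S^1$ with cotangent potential has a periodic solution $\varphi(t)=(\varphi_1(t),\varphi_2(t),\varphi_3(t))$ with regularized double collisions, energy $h$, $\sum_i m_i\varphi_i(t)=0$ and some period $T>0$, with the following features. (i) For all $t$ the configuration lies in region I (including its double-collision sides). (ii) In the first quarter $0\le t\le T/4$ the masses move from an Eulerian central configuration with $m_3$ at the midpoint of $m_1,m_2$ (at $t=0$) to a double collision between $m_2$ and $m_3$ (at $t=T/4$). At the moment of this double collision the velocity of $m_1$ is zero. (iii) The second quarter of the orbit is the time-reverse of the first: $\varphi_i(T/2-t)=\varphi_i(t)$ for $0\le t\le T/4$, $i=1,2,3$. The second half is the reflection of the first half with the roles of $m_1$ and $m_2$ reversed: $\varphi_1(t+T/2)=-\varphi_2(t)$, $\varphi_2(t+T/2)=-\varphi_1(t)$, $\varphi_3(t+T/2)=-\varphi_3(t)$.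
   Context: The three-body problem on $\mathbb S^1$: masses $m_i>0$ at angles $\varphi_i\in\mathbb R/2\pi\mathbb Z$, distances $d_{ij}=\min\{|\varphi_i-\varphi_j|,2\pi-|\varphi_i-\varphi_j|\}$, potential $U=\sum_{i<j}m_im_j\cot d_{ij}$, kinetic energy $K=\frac12\sum_i m_i\dot\varphi_i^2$, Lagrangian $K+U$, energy $K-U=h$. Units are normalized so that $m_1+m_2+m_3=1$, and coordinates so that $\sum_i m_i\varphi_i=0$. Here $m_1=m_2=n=(1-m)/2$, $m_3=m\in(0,1)$. Using real lifts, put $x_1=\varphi_2-\varphi_1$, $x_2=\varphi_3-\frac12(\varphi_1+\varphi_2)$, so that $\varphi_1=-\frac12x_1-mx_2$, $\varphi_2=\frac12x_1-mx_2$, $\varphi_3=(1-m)x_2$. Region I is the set of configurations with $0<x_1<\pi$ and $|x_2|<\frac12x_1$, i.e. $\varphi_1<\varphi_3<\varphi_2$ with all bodies on an open semicircle; its double-collision sides are $0<x_1<\pi$, $x_2=\frac12x_1$ ($m_2,m_3$ collide) and $x_2=-\frac12x_1$ ($m_1,m_3$ collide). An Eulerian central configuration is one with $x_2=0$, i.e. $\varphi_3$ is the midpoint of $\varphi_1$ and $\varphi_2$. Regularization of double collisions: let $\mu_1=n/2$, $\mu_2=2nm$, $\theta_*=\arctan\sqrt m$, and write $x_1=\mu_1^{-1/2}r\cos\theta$, $x_2=\mu_2^{-1/2}r\sin\theta$, $\theta=\theta_*\sin u$ with $u\in\mathbb R$. Regard $U$ as a function of $(r,\theta)$. With new time $s$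 given by $dt=\theta_*\,r^{3/2}\cos^2u\,ds$, $\nu=r^{1/2}\,dr/dt$, and $w=du/ds$, the equations of motion at energy $h$ become ($'=d/ds$) $$r'=\theta_*\nu r\cos^2u,\quad \nu'=\theta_*\cos^2u\left(-\tfrac12\nu^2+2rh+2rU+r^2U_r\right),\quad u'=w,$$ $$w'=-\tfrac12\theta_*\nu w\cos^2u+\partial_u(rU\cos^2u)+\sin u\cos u\,(\nu^2-2rh),$$ restricted to $\frac12(\nu^2\cos^2u+w^2)-rU\cos^2u=rh\cos^2u$. The right-hand sides extend smoothly across $\cos u=0$ for $0<r<\sqrt{n/2}\,\pi/\cos(\theta_*\sin u)$. A solution with regularized double collisions is the curve $\varphi(t)$ obtained from a solution of this extended system; double collisions occur exactly when $\cos u=0$. Velocity at a double collision means the limit of $\dot\varphi_1(t)$ as $t$ tends to the collision time. *)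

(* Defs.v *)
From Stdlib Require Import Reals.
From Coquelicot Require Import Coquelicot.
Open Scope R_scope.

Definition cot (x : R) : R := cos x / sin x.

(* Distance on the circle R/2piZ, for real lifts a, b with |a - b| <= 2pi. *)
Definition dist_S1 (a b : R) : R := Rmin (Rabs (a - b)) (2 * PI - Rabs (a - b)).

Definition potential (m1 m2 m3 p1 p2 p3 : R) : R :=
  m1 * m2 * cot (dist_S1 p1 p2) + m1 * m3 * cot (dist_S1 p1 p3)
  + m2 * m3 * cot (dist_S1 p2 p3).

Definition x1_of (p1 p2 p3 : R) : R := p2 - p1.
Definition x2_of (p1 p2 p3 : R) : R := p3 - (p1 + p2) / 2.

Definition region_I (p1 p2 p3 : R) : Prop :=
  0 < x1_of p1 p2 p3 < PI /\ Rabs (x2_of p1 p2 p3) < x1_of p1 p2 p3 / 2.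

Definition collision_23 (p1 p2 p3 : R) : Prop :=
  0 < x1_of p1 p2 p3 < PI /\ x2_of p1 p2 p3 = x1_of p1 p2 p3 / 2.

Definition collision_13 (p1 p2 p3 : R) : Prop :=
  0 < x1_of p1 p2 p3 < PI /\ x2_of p1 p2 p3 = - (x1_of p1 p2 p3 / 2).

Definition region_I_with_sides (p1 p2 p3 : R) : Prop :=
  region_I p1 p2 p3 \/ collision_23 p1 p2 p3 \/ collision_13 p1 p2 p3.

Definition eulerian (p1 p2 p3 : R) : Prop := x2_of p1 p2 p3 = 0.

(* From here on the masses are m1 = m2 = n and m3 = m, with 2 n + m = 1, and the
   lifts are recovered from (x1, x2) by n phi1 + n phi2 + m phi3 = 0. *)
Definition phi1_of (m x1 x2 : R) : R := - (x1 / 2) - m * x2.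
Definition phi2_of (m x1 x2 : R) : R := x1 / 2 - m * x2.
Definition phi3_of (m x1 x2 : R) : R := (1 - m) * x2.

Definition mu1 (n : R) : R := n / 2.
Definition mu2 (n m : R) : R := 2 * n * m.
Definition theta_star (m : R) : R := atan (sqrt m).

Definition x1_polar (n r theta : R) : R := r * cos theta / sqrt (mu1 n).
Definition x2_polar (n m r theta : R) : R := r * sin theta / sqrt (mu2 n m).

Definition U (n m r theta : R) : R :=
  let x1 := x1_polar n r theta in
  let x2 := x2_polar n m r theta in
  potential n n m (phi1_of m x1 x2) (phi2_of m x1 x2) (phi3_of m x1 x2).

Definition theta_of (m u : R) : R := theta_star m * sin u.

(* A state is (r, nu, u, w). *)
Definition state : Type := (R * R * R * R)%type.

(* The three expressions below have their intended meaning for cos u <> 0 only;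
   their values at cos u = 0 are never used. *)
Definition rhs_nu (n m h : R) (X : state) : R :=
  let '(r, nu, u, w) := X in
  theta_star m * cos u ^ 2 *
    (- (1 / 2) * nu ^ 2 + 2 * r * h + 2 * r * U n m r (theta_of m u)
     + r ^ 2 * Derive (fun r' => U n m r' (theta_of m u)) r).

Definition rhs_w (n m h : R) (X : state) : R :=
  let '(r, nu, u, w) := X in
  - (1 / 2) * theta_star m * nu * w * cos u ^ 2
  + Derive (fun u' => r * U n m r (theta_of m u') * cos u' ^ 2) u
  + sin u * cos u * (nu ^ 2 - 2 * r * h).

Definition energy_lhs (n m : R) (X : state) : R :=
  let '(r, nu, u, w) := X in
  1 / 2 * (nu ^ 2 * cos u ^ 2 + w ^ 2) - r * U n m r (theta_of m u) * cos u ^ 2.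

(* l is the value at X of the continuous extension of F across cos u = 0: the limit
   of F at X through all states with cos u <> 0.  When F extends smoothly, this
   is the value of the smooth extension; when cos u <> 0 at X and F is
   continuous there, it is F X. *)
Definition extended_value (F : state -> R) (X : state) (l : R) : Prop :=
  filterlim F
    (within (fun Y : state => let '(r, nu, u, w) := Y in cos u <> 0) (locally X))
    (locally l).

Definition regularized_system (n m h : R) (r nu u w : R -> R) : Prop :=
  forall s : R,
    let X : state := (r s, nu s, u s, w s) in
    0 < r s < sqrt (n / 2) * PI / cos (theta_of m (u s)) /\
    is_derive r s (theta_star m * nu s * r s * cos (u s) ^ 2) /\
    (exists l, extended_value (rhs_nu n m h) X l /\ is_derive nu s l) /\
    is_derive u s (w s) /\
    (exists l, extended_value (rhs_w n m h) X l /\ is_derive w s l) /\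
    extended_value (energy_lhs n m) X (r s * h * cos (u s) ^ 2).

(* The curve t |-> (phi1 t, phi2 t, phi3 t), defined for all t, is obtained from a
   solution of the extended system through the time change t = tau s.  No
   equation in t is imposed at double collisions, where tau' = 0. *)
Definition regularized_solution (n m h : R) (phi1 phi2 phi3 : R -> R) : Prop :=
  exists r nu u w tau : R -> R,
    regularized_system n m h r nu u w /\
    (forall s, is_derive tau s
                 (theta_star m * Rpower (r s) (3 / 2) * cos (u s) ^ 2)) /\
    (forall t, exists s, tau s = t) /\
    (forall s,
       let x1 := x1_polar n (r s) (theta_of m (u s)) in
       let x2 := x2_polar n m (r s) (theta_of m (u s)) in
       phi1 (tau s) = phi1_of m x1 x2 /\
       phi2 (tau s) = phi2_of m x1 x2 /\
       phi3 (tau s) = phi3_of m x1 x2).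

(* Derive is a total function, so differentiability near t0 is required. *)
Definition limit_velocity (f : R -> R) (t0 v : R) : Prop :=
  locally' t0 (fun t => ex_derive f t) /\ is_lim (Derive f) t0 v.

(* Main.v *)
Require Import Defs.
From Stdlib Require Import Reals Lra Lia Psatz ClassicalEpsilon.
From Coquelicot Require Import Coquelicot.
Open Scope R_scope.

(** Along the orbit w > 0, so u can serve as independent variable, and the energy relation
    determines w from (r, nu, u); this leaves a planar system for (r, nu).  Shoot from the Euler
    line with (u, nu) = (0, 0) and r = r0, looking for nu = 0 at u = pi / 2; the symmetries
    u -> - u and u -> pi - u, both with nu -> - nu, then continue this quarter periodically.

    Let theta = theta_* sin u.  Since U increases with theta, the angular momentum increases,
    which keeps w away from 0 and makes every shot reach u = pi / 2.  The sign of nu' where nu = 0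
    is that of Gam = 2 h + 2 U + r U_r, which increases along the orbit because its summands are
    decreasing and convex functions of the distances; hence nu, once positive, stays positive, and
    nu may be replaced by min (nu, 0) on the right-hand sides while shooting.  For small r0 one has
    Gam > 0 and the shot ends with nu > 0.  For r0 close to the zero-velocity radius the bodies
    first fall almost homothetically, until nu is close to - sqrt (2 V0), where V0 is the limit of
    r U on the Euler line as r -> 0; during the rest of the passage nu gains at most
    theta_* (pi / 2) sqrt V0 < sqrt (17 V0 / 10), so it ends negative.  The intermediate value
    theorem gives the orbit.  The hypothesis h <= - 1 forces all distances to be at most 4 / 7. *)

(** * Real analysis *)

(** The field is singular at w = 0 and is controlled only for 0 < r <= [rmax], so no global flow is
    available for shooting. Each shot therefore solves a truncated field, bounded and Lipschitz in
    the whole plane, and a bootstrap along [0, pi / 2] shows that the bounds on r, w and - nu are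
    never reached. These bounds are uniform over the interval of initial radii: one field serves all
    shots, and the final nu depends continuously on r0.

    The remaining truncation, min (nu, 0), does act on some shots. It keeps r nonincreasing, so that
    r <= [rmax] and the monotonicity of [Gam] and of the angular momentum hold for every shot,
    including those whose true continuation would move outward. The orbit finally selected has nu <=
    0 on the quarter and hence solves the true equations.

    The number 4 / 7 is the maximum of n^2 + 4 n m under 2 n + m = 1. On the Euler line r U <= V0 =
    (n^2 + 4 n m) / kap, so rest at energy h <= - 1 requires r <= V0, that is, an outer distance kap
    r <= 4 / 7. *)

(** The supremum of the points up to which g is positive belongs to the set by the inductive step,
    and by continuity it cannot lie below b. This is the bootstrap principle behind the a priori
    bounds. *)
Lemma continuous_induction (g : R -> R) (a b : R) :
  a <= b ->
  (forall x, a <= x <= b -> continuous g x) ->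
  0 < g a ->
  (forall x, a < x <= b -> (forall y, a <= y < x -> 0 < g y) -> 0 < g x) ->
  forall x, a <= x <= b -> 0 < g x.
Proof.
intros Hab Hc Ha Hind.
assert (Hloc : forall x, a <= x <= b -> 0 < g x ->
          exists d, 0 < d /\ forall y, Rabs (y - x) < d -> 0 < g y).
{ intros x Hx Hgx.
  destruct (proj1 (filterlim_locally g (g x)) (Hc x Hx) (mkposreal _ Hgx)) as [d Hd].
  exists d; split; [apply cond_pos|].
  intros y Hy. specialize (Hd y Hy).
  change (Rabs (g y - g x) < g x) in Hd.
  apply Rabs_def2 in Hd. lra. }
set (E := fun x => a <= x <= b /\ forall y, a <= y <= x -> 0 < g y).
assert (HEa : E a).
{ split; [lra|]. intros y Hy. replace y with a by lra. exact Ha. }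
destruct (completeness E) as [s [Hub Hlub]].
{ exists b. intros x [Hx _]. lra. }
{ exists a; exact HEa. }
assert (Has : a <= s) by (apply Hub; exact HEa).
assert (Hsb : s <= b) by (apply Hlub; intros x [Hx _]; lra).
assert (Hbelow : forall y, a <= y < s -> 0 < g y).
{ intros y Hy.
  destruct (Classical_Prop.classic (exists x, E x /\ y < x)) as [[x [[_ Hx] Hyx]]|Hn].
  - apply Hx; lra.
  - exfalso. assert (s <= y); [|lra].
    apply Hlub. intros x Hx. destruct (Rle_dec x y); [assumption|].
    exfalso; apply Hn; exists x; split; [assumption|lra]. }
assert (Hgs : 0 < g s).
{ destruct (Req_dec s a) as [->|]; [exact Ha|]. apply Hind; [lra|exact Hbelow]. }
destruct (Hloc s (conj Has Hsb) Hgs) as [d [Hd Hnear]].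
assert (Hsb' : s = b).
{ destruct (Rle_lt_or_eq_dec s b Hsb) as [Hlt|]; [|assumption].
  exfalso. set (x := Rmin b (s + d / 2)).
  assert (Hx : s < x <= b /\ x <= s + d / 2).
  { unfold x; split; [split|]; [apply Rmin_glb_lt; lra|apply Rmin_l|apply Rmin_r]. }
  assert (E x); [|assert (x <= s) by (apply Hub; assumption); lra].
  split; [lra|]. intros y Hy.
  destruct (Rlt_dec y s); [apply Hbelow; lra|].
  apply Hnear. rewrite Rabs_pos_eq; lra. }
intros x Hx. destruct (Rlt_dec x s); [apply Hbelow; lra|].
replace x with s by lra. exact Hgs.
Qed.

Lemma mean_value (f df : R -> R) (a b : R) :
  a < b ->
  (forall x, a < x < b -> is_derive f x (df x)) ->
  (forall x, a <= x <= b -> continuous f x) ->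
  exists c, a < c < b /\ f b - f a = df c * (b - a).
Proof.
intros Hab Hd Hc.
assert (pr : forall c, a < c < b -> derivable_pt f c).
{ intros c Hcc. exists (df c). apply is_derive_Reals, Hd, Hcc. }
destruct (MVT f id a b pr (fun c _ => derivable_pt_id c) Hab) as [c [P HP]].
- intros c Hcc. apply continuity_pt_filterlim, Hc, Hcc.
- intros c Hcc. apply derivable_continuous_pt, derivable_pt_id.
- exists c; split; [exact P|].
  rewrite (derive_pt_eq_0 _ _ (df c)) in HP by (apply is_derive_Reals, Hd, P).
  rewrite derive_pt_id in HP. unfold id in HP. lra.
Qed.

Lemma nondecreasing_of_derive (f df : R -> R) (a b : R) :
  a <= b ->
  (forall x, a < x < b -> is_derive f x (df x)) ->
  (forall x, a <= x <= b -> continuous f x) ->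
  (forall x, a < x < b -> 0 <= df x) ->
  f a <= f b.
Proof.
intros Hab Hd Hc Hpos.
destruct (Rle_lt_or_eq_dec a b Hab) as [Hlt|<-]; [|lra].
destruct (mean_value f df a b Hlt Hd Hc) as [c [Hcc He]].
assert (0 <= df c * (b - a)) by (apply Rmult_le_pos; [apply Hpos, Hcc|lra]).
lra.
Qed.

Lemma is_derive_continuous (f : R -> R) (x l : R) : is_derive f x l -> continuous f x.
Proof.
intros H. apply (ex_derive_continuous (K := R_AbsRing) (V := R_NormedModule)). exists l. exact H.
Qed.

Lemma le_of_derive_le (f g df dg : R -> R) (a b : R) :
  a <= b ->
  (forall x, a <= x <= b -> is_derive f x (df x)) ->
  (forall x, a <= x <= b -> is_derive g x (dg x)) ->
  (forall x, a <= x <= b -> df x <= dg x) ->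
  f b - f a <= g b - g a.
Proof.
intros Hab Hf Hg Hle.
assert (g a - f a <= g b - f b); [|lra].
apply (nondecreasing_of_derive (fun x => g x - f x) (fun x => dg x - df x)); [exact Hab| | |].
- intros x Hx. apply (is_derive_minus (K := R_AbsRing) (V := R_NormedModule)); [apply Hg|apply Hf]; lra.
- intros x Hx. apply (continuous_minus (K := R_AbsRing) (V := R_NormedModule));
    eapply is_derive_continuous; [apply Hg|apply Hf]; lra.
- intros x Hx. assert (df x <= dg x) by (apply Hle; lra). lra.
Qed.

Lemma is_derive_reflect (f : R -> R) (x l : R) :
  is_derive f (- x) l -> is_derive (fun y => f (- y)) x (- l).
Proof.
intros H. evar_last.
- apply (is_derive_comp f (fun y => - y) x l (- 1) H).
  auto_derive; [trivial|ring].
- simpl. unfold scal; simpl; unfold mult; simpl. ring.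
Qed.

(** Integrating the weight A K exp (K |x|) from 0 costs a factor 1 / K. In the norm with this weight
    Picard iteration contracts on the whole line at once, with no restriction to short intervals. *)
Lemma exp_bound_of_derive (g dg : R -> R) (A K : R) :
  0 < K -> 0 <= A -> g 0 = 0 ->
  (forall x, is_derive g x (dg x)) ->
  (forall x, Rabs (dg x) <= A * K * exp (K * Rabs x)) ->
  forall u, Rabs (g u) <= A * exp (K * Rabs u).
Proof.
intros HK HA.
assert (Hpos : forall (g dg : R -> R), g 0 = 0 ->
  (forall x, is_derive g x (dg x)) ->
  (forall x, Rabs (dg x) <= A * K * exp (K * Rabs x)) ->
  forall u, 0 <= u -> Rabs (g u) <= A * exp (K * u)).
{ clear g dg. intros g dg H0 Hd Hb u Hu.
  assert (He : forall x, is_derive (fun y => A * exp (K * y)) x (A * K * exp (K * x))).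
  { intros x. auto_derive; [trivial|ring]. }
  assert (Hbx : forall x, 0 <= x <= u -> Rabs (dg x) <= A * K * exp (K * x)).
  { intros x Hx. rewrite <- (Rabs_pos_eq x) at 2 by lra. apply Hb. }
  assert (H1 := le_of_derive_le g _ dg _ 0 u Hu (fun x _ => Hd x) (fun x _ => He x)
     (fun x Hx => Rle_trans _ _ _ (Rle_abs _) (Hbx x Hx))).
  assert (H2 := le_of_derive_le (fun x => - g x) _ (fun x => - dg x) _ 0 u Hu
     (fun x _ => is_derive_opp g x _ (Hd x)) (fun x _ => He x)
     (fun x Hx => Rle_trans _ _ _ (Rle_trans _ _ _ (Rle_abs _) (Req_le _ _ (Rabs_Ropp _))) (Hbx x Hx))).
  cbv beta in H1, H2. rewrite H0, Rmult_0_r, exp_0 in H1, H2.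
  apply Rabs_le. lra. }
intros H0 Hd Hb u.
destruct (Rle_dec 0 u) as [Hu|Hu].
- rewrite (Rabs_pos_eq u) by lra. apply (Hpos g dg); assumption.
- rewrite (Rabs_left u) by lra.
  rewrite <- (Ropp_involutive u) at 1.
  apply (Hpos (fun x => g (- x)) (fun x => - dg (- x))); [| | |lra].
  + rewrite Ropp_0; exact H0.
  + intros x. apply is_derive_reflect, Hd.
  + intros x. rewrite Rabs_Ropp, <- (Rabs_Ropp x). apply Hb.
Qed.

(** The intervals of radius 2 c / 2^k around a k are nested; l is the supremum of their left
    ends. *)
Lemma geometric_cauchy (a : nat -> R) (c : R) :
  (forall k, Rabs (a (S k) - a k) <= c * (/ 2) ^ k) ->
  exists l, forall k, Rabs (a k - l) <= 2 * c * (/ 2) ^ k.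
Proof.
intros H.
assert (Hp : forall k j, a (k + j)%nat - 2 * c * (/ 2) ^ (k + j) >= a k - 2 * c * (/ 2) ^ k
              /\ a (k + j)%nat + 2 * c * (/ 2) ^ (k + j) <= a k + 2 * c * (/ 2) ^ k).
{ intros k j. induction j as [|j IH].
  - rewrite Nat.add_0_r; lra.
  - rewrite <- plus_n_Sm. specialize (H (k + j)%nat). apply Rabs_le_between in H. simpl. lra. }
assert (Hpos : forall k, 0 <= c * (/ 2) ^ k).
{ intros k. eapply Rle_trans; [apply Rabs_pos|apply H]. }
destruct (completeness (fun x => exists k, x = a k - 2 * c * (/ 2) ^ k)) as [l [Hub Hlub]].
- exists (a 0%nat + 2 * c). intros x [k ->].
  destruct (Hp 0%nat k) as [_ Hk]. simpl in Hk. specialize (Hpos k). lra.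
- exists (a 0%nat - 2 * c * (/ 2) ^ 0), 0%nat. reflexivity.
- exists l. intros k. apply Rabs_le_between.
  assert (a k - 2 * c * (/ 2) ^ k <= l) by (apply Hub; exists k; reflexivity).
  assert (l <= a k + 2 * c * (/ 2) ^ k); [|lra].
  apply Hlub. intros x [j ->].
  destruct (Nat.le_gt_cases k j) as [Hkj|Hkj].
  + replace j with (k + (j - k))%nat by lia. destruct (Hp k (j - k)%nat).
    specialize (Hpos (k + (j - k))%nat). lra.
  + replace k with (j + (k - j))%nat by lia. destruct (Hp j (k - j)%nat).
    specialize (Hpos (j + (k - j))%nat). lra.
Qed.

Lemma eq_of_abs_le_geometric (x y c : R) :
  (forall k : nat, Rabs (x - y) <= c * (/ 2) ^ k) -> x = y.
Proof.
intros H.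
assert (Hl : is_lim_seq (fun k => c * (/ 2) ^ k) 0).
{ replace (Finite 0) with (Rbar_mult c 0) by (simpl; f_equal; ring).
  apply is_lim_seq_scal_l. apply is_lim_seq_geom. rewrite Rabs_pos_eq; lra. }
assert (Rbar_le (Rabs (x - y)) 0).
{ apply (is_lim_seq_le (fun _ => Rabs (x - y)) (fun k => c * (/ 2) ^ k)); [exact H| |exact Hl].
  apply is_lim_seq_const. }
simpl in H0. assert (Rabs (x - y) = 0) by (apply Rle_antisym; [exact H0|apply Rabs_pos]).
apply Rabs_eq_0 in H1. lra.
Qed.

Lemma is_derive_integral (p : R -> R) (c : R) :
  (forall x, continuous p x) ->
  forall x, is_derive (fun u => c + RInt p 0 u) x (p x).
Proof.
intros Hp x.
evar_last.
- apply (is_derive_plus (fun _ => c) (fun u => RInt p 0 u)).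
  + apply (is_derive_const (V := R_NormedModule)).
  + apply (is_derive_RInt p _ 0).
    * apply filter_forall. intros u. apply (RInt_correct (V := R_CompleteNormedModule)).
      apply (ex_RInt_continuous (V := R_CompleteNormedModule)). intros; apply Hp.
    * apply Hp.
- simpl. unfold plus, zero; simpl. ring.
Qed.

Lemma exp_abs_ge_1 (K x : R) : 0 < K -> 1 <= exp (K * Rabs x).
Proof.
intros HK. rewrite <- exp_0.
assert (0 <= K * Rabs x) by (apply Rmult_le_pos; [lra|apply Rabs_pos]).
destruct (Rle_lt_or_eq_dec _ _ H) as [Hlt|<-]; [left; apply exp_increasing; exact Hlt|lra].
Qed.

Lemma lipschitz_of_derive_bound (F dF : R -> R) (C : R) :
  (forall x, is_derive F x (dF x)) -> (forall x, Rabs (dF x) <= C) ->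
  forall x y, Rabs (F x - F y) <= C * Rabs (x - y).
Proof.
intros Hd Hb x y.
destruct (MVT_gen F y x dF) as [c [_ Hc]].
- intros; apply Hd.
- intros t _. apply continuity_pt_filterlim. eapply is_derive_continuous, Hd.
- rewrite Hc, Rabs_mult. apply Rmult_le_compat_r; [apply Rabs_pos|apply Hb].
Qed.

(** * Global existence and continuous dependence for planar Lipschitz systems *)

Section PlanarODE.

Variables (f g : R -> R -> R -> R) (L M : R).
Hypothesis L_pos : 0 < L.
Hypothesis f_cont : forall x y z, continuous (fun x => f x y z) x.
Hypothesis g_cont : forall x y z, continuous (fun x => g x y z) x.
Hypothesis f_lip : forall x y z y' z',
  Rabs (f x y z - f x y' z') <= L * (Rabs (y - y') + Rabs (z - z')).
Hypothesis g_lip : forall x y z y' z',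
  Rabs (g x y z - g x y' z') <= L * (Rabs (y - y') + Rabs (z - z')).
Hypothesis f_bound : forall x y z, Rabs (f x y z) <= M.
Hypothesis g_bound : forall x y z, Rabs (g x y z) <= M.

Lemma lipschitz_field_continuous (F : R -> R -> R -> R) :
  (forall x y z, continuous (fun x => F x y z) x) ->
  (forall x y z y' z', Rabs (F x y z - F x y' z') <= L * (Rabs (y - y') + Rabs (z - z'))) ->
  forall y z : R -> R, (forall x, continuous y x) -> (forall x, continuous z x) ->
  forall x, continuous (fun x => F x (y x) (z x)) x.
Proof.
intros Hc Hl y z Hy Hz x.
apply filterlim_locally. intros eps.
assert (He : 0 < eps / (4 * L)).
{ apply Rdiv_lt_0_compat; [apply cond_pos|lra]. }
assert (He2 : 0 < eps / 2) by (destruct eps; simpl; lra).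
generalize (proj1 (filterlim_locally _ _) (Hy x) (mkposreal _ He))
  (proj1 (filterlim_locally _ _) (Hz x) (mkposreal _ He))
  (proj1 (filterlim_locally _ _) (Hc x (y x) (z x)) (mkposreal _ He2)).
intros H1 H2 H3.
generalize (filter_and _ _ H1 (filter_and _ _ H2 H3)).
apply filter_imp. intros x' [B1 [B2 B3]].
change (Rabs (y x' - y x) < eps / (4 * L)) in B1.
change (Rabs (z x' - z x) < eps / (4 * L)) in B2.
change (Rabs (F x' (y x) (z x) - F x (y x) (z x)) < eps / 2) in B3.
change (Rabs (F x' (y x') (z x') - F x (y x) (z x)) < eps).
specialize (Hl x' (y x') (z x') (y x) (z x)).
assert (L * (Rabs (y x' - y x) + Rabs (z x' - z x)) < L * (2 * (eps / (4 * L)))).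
{ apply Rmult_lt_compat_l; lra. }
replace (L * (2 * (eps / (4 * L)))) with (eps / 2) in H by (field; lra).
replace (F x' (y x') (z x') - F x (y x) (z x)) with
  ((F x' (y x') (z x') - F x' (y x) (z x)) + (F x' (y x) (z x) - F x (y x) (z x))) by ring.
eapply Rle_lt_trans; [apply Rabs_triang|]. lra.
Qed.

Fixpoint picard (y0 z0 : R) (k : nat) : (R -> R) * (R -> R) :=
  match k with
  | O => (fun _ => y0, fun _ => z0)
  | S k =>
      let Y := fst (picard y0 z0 k) in
      let Z := snd (picard y0 z0 k) in
      (fun u => y0 + RInt (fun x => f x (Y x) (Z x)) 0 u,
       fun u => z0 + RInt (fun x => g x (Y x) (Z x)) 0 u)
  end.

Lemma picard_continuous y0 z0 k x :
  continuous (fst (picard y0 z0 k)) x /\ continuous (snd (picard y0 z0 k)) x.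
Proof.
revert x. induction k as [|k IH]; intros x.
- split; apply continuous_const.
- split; simpl; eapply is_derive_continuous;
    apply (is_derive_integral (fun x => _ x (fst (picard y0 z0 k) x) (snd (picard y0 z0 k) x)));
    (apply (lipschitz_field_continuous _ f_cont f_lip)
     || apply (lipschitz_field_continuous _ g_cont g_lip)); intros; apply IH.
Qed.

Lemma picard_derive y0 z0 k x :
  let Y := fst (picard y0 z0 k) in
  let Z := snd (picard y0 z0 k) in
  is_derive (fst (picard y0 z0 (S k))) x (f x (Y x) (Z x)) /\
  is_derive (snd (picard y0 z0 (S k))) x (g x (Y x) (Z x)).
Proof.
split; simpl;
  apply (is_derive_integral (fun x => _ x (fst (picard y0 z0 k) x) (snd (picard y0 z0 k) x)));
    (apply (lipschitz_field_continuous _ f_cont f_lip)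
     || apply (lipschitz_field_continuous _ g_cont g_lip)); intros; apply picard_continuous.
Qed.

Lemma picard_0 y0 z0 k : fst (picard y0 z0 k) 0 = y0 /\ snd (picard y0 z0 k) 0 = z0.
Proof.
destruct k; simpl; [tauto|].
rewrite !RInt_point. unfold zero; simpl. split; ring.
Qed.

Lemma bound_nonneg : 0 <= M.
Proof. eapply Rle_trans; [apply Rabs_pos|apply (f_bound 0 0 0)]. Qed.

(** The weight exp (4 L |x|) makes each step halve the error: the Lipschitz bound multiplies it by 2
    L, one L for each component, and integration divides it by 4 L. *)
Lemma picard_step y0 z0 k x :
  Rabs (fst (picard y0 z0 (S k)) x - fst (picard y0 z0 k) x)
    <= M / (4 * L) * (/ 2) ^ k * exp (4 * L * Rabs x) /\
  Rabs (snd (picard y0 z0 (S k)) x - snd (picard y0 z0 k) x)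
    <= M / (4 * L) * (/ 2) ^ k * exp (4 * L * Rabs x).
Proof.
assert (HM := bound_nonneg).
assert (HML : 0 <= M / (4 * L)).
{ apply Rmult_le_pos; [lra|]. left; apply Rinv_0_lt_compat; lra. }
revert x. induction k as [|k IH]; intros x.
- assert (Hmain : forall F : R -> R -> R -> R,
    (forall x y z, continuous (fun x => F x y z) x) ->
    (forall x y z, Rabs (F x y z) <= M) -> forall c,
    Rabs ((c + RInt (fun x => F x y0 z0) 0 x) - c) <= M / (4 * L) * exp (4 * L * Rabs x)).
  { intros F Fc Fb c.
    apply (exp_bound_of_derive (fun x => (c + RInt (fun x => F x y0 z0) 0 x) - c)
              (fun x => F x y0 z0)); [lra|lra| | |].
    - rewrite RInt_point. unfold zero; simpl. ring.
    - intros t. evar_last.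
      + apply (is_derive_minus (fun x => c + RInt (fun x => F x y0 z0) 0 x) (fun _ => c)).
        * apply (is_derive_integral (fun x => F x y0 z0)). intros; apply Fc.
        * apply (is_derive_const (V := R_NormedModule)).
      + unfold minus, plus, opp, zero; simpl. ring.
    - intros t. replace (M / (4 * L) * (4 * L)) with M by (field; lra).
      assert (H1 := exp_abs_ge_1 (4 * L) t ltac:(lra)).
      eapply Rle_trans; [apply Fb|]. rewrite <- (Rmult_1_r M) at 1.
      apply Rmult_le_compat_l; lra. }
  simpl. rewrite Rmult_1_r.
  split; apply Hmain; auto.
- assert (Hmain : forall (F : R -> R -> R -> R) (P Q : R -> R),
    (forall x y z y' z', Rabs (F x y z - F x y' z') <= L * (Rabs (y - y') + Rabs (z - z'))) ->
    P 0 = Q 0 ->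
    (forall x, is_derive P x (F x (fst (picard y0 z0 (S k)) x) (snd (picard y0 z0 (S k)) x))) ->
    (forall x, is_derive Q x (F x (fst (picard y0 z0 k) x) (snd (picard y0 z0 k) x))) ->
    Rabs (P x - Q x) <= M / (4 * L) * (/ 2) ^ (S k) * exp (4 * L * Rabs x)).
  { intros F P Q Fl HPQ HP HQ.
    apply (exp_bound_of_derive (fun x => P x - Q x) (fun x =>
      F x (fst (picard y0 z0 (S k)) x) (snd (picard y0 z0 (S k)) x)
      - F x (fst (picard y0 z0 k) x) (snd (picard y0 z0 k) x))); [lra| |lra| |].
    - apply Rmult_le_pos; [lra|]. apply pow_le; lra.
    - intros t. apply (is_derive_minus P Q); [apply HP|apply HQ].
    - intros t. eapply Rle_trans; [apply Fl|].
      destruct (IH t) as [I1 I2].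
      eapply Rle_trans; [apply Rmult_le_compat_l; [lra|apply Rplus_le_compat; [exact I1|exact I2]]|].
      simpl. right. field. lra. }
  split.
  + apply (Hmain f (fst (picard y0 z0 (S (S k)))) (fst (picard y0 z0 (S k))) f_lip).
    * rewrite (proj1 (picard_0 y0 z0 (S (S k)))), (proj1 (picard_0 y0 z0 (S k))); reflexivity.
    * intros t. apply (proj1 (picard_derive y0 z0 (S k) t)).
    * intros t. apply (proj1 (picard_derive y0 z0 k t)).
  + apply (Hmain g (snd (picard y0 z0 (S (S k)))) (snd (picard y0 z0 (S k))) g_lip).
    * rewrite (proj2 (picard_0 y0 z0 (S (S k)))), (proj2 (picard_0 y0 z0 (S k))); reflexivity.
    * intros t. apply (proj2 (picard_derive y0 z0 (S k) t)).
    * intros t. apply (proj2 (picard_derive y0 z0 k t)).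
Qed.

Lemma picard_lipschitz y0 z0 k x y :
  Rabs (fst (picard y0 z0 k) x - fst (picard y0 z0 k) y) <= M * Rabs (x - y) /\
  Rabs (snd (picard y0 z0 k) x - snd (picard y0 z0 k) y) <= M * Rabs (x - y).
Proof.
assert (HM := bound_nonneg).
destruct k as [|k].
- simpl. rewrite !Rminus_diag, Rabs_R0.
  split; apply Rmult_le_pos; (lra || apply Rabs_pos).
- split.
  + apply (lipschitz_of_derive_bound _ _ M (fun t => proj1 (picard_derive y0 z0 k t))).
    intros t. apply f_bound.
  + apply (lipschitz_of_derive_bound _ _ M (fun t => proj2 (picard_derive y0 z0 k t))).
    intros t. apply g_bound.
Qed.

Lemma planar_ode_solution (y0 z0 : R) :
  exists y z : R -> R, y 0 = y0 /\ z 0 = z0 /\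
    forall x, is_derive y x (f x (y x) (z x)) /\ is_derive z x (g x (y x) (z x)).
Proof.
assert (HM := bound_nonneg).
assert (HML : 0 <= M / (4 * L)).
{ apply Rmult_le_pos; [lra|]. left; apply Rinv_0_lt_compat; lra. }
assert (Hlim : forall x, exists l : R * R, forall k,
  Rabs (fst (picard y0 z0 k) x - fst l) <= 2 * (M / (4 * L) * exp (4 * L * Rabs x)) * (/ 2) ^ k /\
  Rabs (snd (picard y0 z0 k) x - snd l) <= 2 * (M / (4 * L) * exp (4 * L * Rabs x)) * (/ 2) ^ k).
{ intros x.
  destruct (geometric_cauchy (fun k => fst (picard y0 z0 k) x) (M / (4 * L) * exp (4 * L * Rabs x)))
    as [l1 H1].
  { intros k. eapply Rle_trans; [apply (proj1 (picard_step y0 z0 k x))|]. right; ring. }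
  destruct (geometric_cauchy (fun k => snd (picard y0 z0 k) x) (M / (4 * L) * exp (4 * L * Rabs x)))
    as [l2 H2].
  { intros k. eapply Rle_trans; [apply (proj2 (picard_step y0 z0 k x))|]. right; ring. }
  exists (l1, l2). intros k; split; [apply H1|apply H2]. }
set (l := fun x => proj1_sig (constructive_indefinite_description _ (Hlim x))).
assert (Hl : forall x k,
  Rabs (fst (picard y0 z0 k) x - fst (l x)) <= 2 * (M / (4 * L) * exp (4 * L * Rabs x)) * (/ 2) ^ k /\
  Rabs (snd (picard y0 z0 k) x - snd (l x)) <= 2 * (M / (4 * L) * exp (4 * L * Rabs x)) * (/ 2) ^ k).
{ intros x. unfold l. destruct (constructive_indefinite_description _ (Hlim x)). simpl. assumption. }
clearbody l.
(* The iterates share the Lipschitz constant M, which survives pointwise limits; this gives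
   continuity of the limit. *)
assert (Hlip : forall (P : nat -> R -> R) (p : R -> R),
  (forall x k, Rabs (P k x - p x) <= 2 * (M / (4 * L) * exp (4 * L * Rabs x)) * (/ 2) ^ k) ->
  (forall k x y, Rabs (P k x - P k y) <= M * Rabs (x - y)) ->
  forall x, continuous p x).
{ intros P p HP HPl x.
  assert (Hpl : forall y, Rabs (p y - p x) <= M * Rabs (y - x)).
  { intros y.
    set (c := 2 * (M / (4 * L) * exp (4 * L * Rabs x)) + 2 * (M / (4 * L) * exp (4 * L * Rabs y))).
    assert (Hk : forall k, Rabs (p y - p x) - M * Rabs (y - x) <= c * (/ 2) ^ k).
    { intros k. specialize (HPl k y x).
      assert (A1 := HP x k). assert (A2 := HP y k). rewrite Rabs_minus_sym in A2.
      unfold c.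
      assert (Rabs (p y - p x) <= Rabs (p y - P k y) + Rabs (P k y - P k x) + Rabs (P k x - p x)).
      { replace (p y - p x) with ((p y - P k y) + (P k y - P k x) + (P k x - p x)) by ring.
        eapply Rle_trans; [apply Rabs_triang|]. apply Rplus_le_compat_r, Rabs_triang. }
      lra. }
    destruct (Rle_dec (Rabs (p y - p x) - M * Rabs (y - x)) 0) as [Hle|Hgt]; [lra|].
    exfalso. assert (Rabs (p y - p x) - M * Rabs (y - x) = 0); [|lra].
    apply (eq_of_abs_le_geometric _ _ c). intros k. rewrite Rminus_0_r, Rabs_pos_eq by lra. apply Hk. }
  apply filterlim_locally. intros eps.
  assert (Hd : 0 < eps / (M + 1)) by (apply Rdiv_lt_0_compat; [apply cond_pos|lra]).
  exists (mkposreal _ Hd). intros y Hy.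
  change (Rabs (y - x) < eps / (M + 1)) in Hy.
  change (Rabs (p y - p x) < eps).
  eapply Rle_lt_trans; [apply Hpl|].
  apply Rmult_lt_compat_r with (r := M + 1) in Hy; [|lra].
  replace (eps / (M + 1) * (M + 1)) with (pos eps) in Hy by (field; lra).
  assert (0 <= Rabs (y - x)) by apply Rabs_pos. lra. }
assert (Cy : forall x, continuous (fun x => fst (l x)) x).
{ apply (Hlip (fun k => fst (picard y0 z0 k))).
  - intros x k; apply (proj1 (Hl x k)).
  - intros k x y; apply (proj1 (picard_lipschitz y0 z0 k x y)). }
assert (Cz : forall x, continuous (fun x => snd (l x)) x).
{ apply (Hlip (fun k => snd (picard y0 z0 k))).
  - intros x k; apply (proj2 (Hl x k)).
  - intros k x y; apply (proj2 (picard_lipschitz y0 z0 k x y)). }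
(* No limit is exchanged with an integral: the iterate [P (S k)] and the integral W of the limit
   field both vary smoothly, and their difference is bounded through its derivative in the weighted
   norm. *)
assert (Hfix : forall (F : R -> R -> R -> R) (P : nat -> R -> R) (p : R -> R) (c : R),
  (forall x y z, continuous (fun x => F x y z) x) ->
  (forall x y z y' z', Rabs (F x y z - F x y' z') <= L * (Rabs (y - y') + Rabs (z - z'))) ->
  (forall k, P k 0 = c) ->
  (forall k x, is_derive (P (S k)) x (F x (fst (picard y0 z0 k) x) (snd (picard y0 z0 k) x))) ->
  (forall x k, Rabs (P k x - p x) <= 2 * (M / (4 * L) * exp (4 * L * Rabs x)) * (/ 2) ^ k) ->
  forall x, p x = c + RInt (fun x => F x (fst (l x)) (snd (l x))) 0 x).
{ intros F P p c Fc Fl P0 PD HP x.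
  apply (eq_of_abs_le_geometric _ _ (3 * (M / (4 * L) * exp (4 * L * Rabs x)))).
  intros k.
  set (W := fun x => c + RInt (fun x => F x (fst (l x)) (snd (l x))) 0 x).
  assert (HW : Rabs (P (S k) x - W x) <= (M / (4 * L) * (/ 2) ^ k) * exp (4 * L * Rabs x)).
  { apply (exp_bound_of_derive (fun x => P (S k) x - W x) (fun x =>
      F x (fst (picard y0 z0 k) x) (snd (picard y0 z0 k) x) - F x (fst (l x)) (snd (l x)))); [lra| | | |].
    - apply Rmult_le_pos; [lra|]. apply pow_le; lra.
    - unfold W. rewrite RInt_point, P0. unfold zero; simpl. ring.
    - intros t. apply (is_derive_minus (P (S k)) W); [apply PD|].
      apply (is_derive_integral (fun x => F x (fst (l x)) (snd (l x)))).
      apply (lipschitz_field_continuous F Fc Fl); assumption.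
    - intros t. eapply Rle_trans; [apply Fl|]. destruct (Hl t k) as [I1 I2].
      eapply Rle_trans; [apply Rmult_le_compat_l; [lra|apply Rplus_le_compat; [exact I1|exact I2]]|].
      right. field. lra. }
  assert (A := HP x (S k)). rewrite Rabs_minus_sym in A.
  fold (W x). replace (p x - W x) with ((p x - P (S k) x) + (P (S k) x - W x)) by ring.
  eapply Rle_trans; [apply Rabs_triang|].
  simpl in A.
  set (E := M / (4 * L) * exp (4 * L * Rabs x)) in *.
  replace (M / (4 * L) * (/ 2) ^ k * exp (4 * L * Rabs x)) with (E * (/ 2) ^ k) in HW by (unfold E; ring).
  assert (0 <= E * (/ 2) ^ k).
  { apply Rmult_le_pos; [|apply pow_le; lra]. apply Rmult_le_pos; [lra|left; apply exp_pos]. }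
  lra. }
exists (fun x => fst (l x)), (fun x => snd (l x)).
assert (E1 := Hfix f (fun k => fst (picard y0 z0 k)) (fun x => fst (l x)) y0 f_cont f_lip
  (fun k => proj1 (picard_0 y0 z0 k)) (fun k x => proj1 (picard_derive y0 z0 k x))
  (fun x k => proj1 (Hl x k))).
assert (E2 := Hfix g (fun k => snd (picard y0 z0 k)) (fun x => snd (l x)) z0 g_cont g_lip
  (fun k => proj2 (picard_0 y0 z0 k)) (fun k x => proj2 (picard_derive y0 z0 k x))
  (fun x k => proj2 (Hl x k))).
split; [|split].
- rewrite E1, RInt_point. unfold zero; simpl. ring.
- rewrite E2, RInt_point. unfold zero; simpl. ring.
- intros x. split.
  + eapply is_derive_ext; [intros t; symmetry; apply E1|].
    apply (is_derive_integral (fun x => f x (fst (l x)) (snd (l x)))).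
    apply (lipschitz_field_continuous f f_cont f_lip); assumption.
  + eapply is_derive_ext; [intros t; symmetry; apply E2|].
    apply (is_derive_integral (fun x => g x (fst (l x)) (snd (l x)))).
    apply (lipschitz_field_continuous g g_cont g_lip); assumption.
Qed.

(** Gronwall for the squared distance E, where |E'| <= 2 L (|p| + |q|)^2 <= 4 L E. The equations are
    required only between x0 and x, so that functions which solve the same system merely on a
    segment can be compared there. It gives both uniqueness and continuity in the initial data. *)
Lemma planar_ode_dependence (y z y' z' : R -> R) (x0 x : R) :
  (forall t, Rmin x0 x <= t <= Rmax x0 x ->
     is_derive y t (f t (y t) (z t)) /\ is_derive z t (g t (y t) (z t))) ->
  (forall t, Rmin x0 x <= t <= Rmax x0 x ->
     is_derive y' t (f t (y' t) (z' t)) /\ is_derive z' t (g t (y' t) (z' t))) ->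
  (y x - y' x) ^ 2 + (z x - z' x) ^ 2
    <= ((y x0 - y' x0) ^ 2 + (z x0 - z' x0) ^ 2) * exp (4 * L * Rabs (x - x0)).
Proof.
intros H H'.
set (E := fun x => (y x - y' x) ^ 2 + (z x - z' x) ^ 2).
set (dE := fun x => 2 * (y x - y' x) * (f x (y x) (z x) - f x (y' x) (z' x))
                    + 2 * (z x - z' x) * (g x (y x) (z x) - g x (y' x) (z' x))).
assert (DE : forall x1, Rmin x0 x <= x1 <= Rmax x0 x -> is_derive E x1 (dE x1)).
{ intros x1 Hx1. unfold E, dE.
  destruct (H x1 Hx1) as [A1 A2], (H' x1 Hx1) as [A3 A4].
  auto_derive.
  - repeat split; eexists; eassumption.
  - rewrite (is_derive_unique (fun x : R => y x) _ _ A1), (is_derive_unique (fun x : R => z x) _ _ A2),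
      (is_derive_unique (fun x : R => y' x) _ _ A3), (is_derive_unique (fun x : R => z' x) _ _ A4). ring. }
assert (BE : forall x, Rabs (dE x) <= 4 * L * E x).
{ clear DE. intros x1. unfold dE, E.
  assert (F1 := f_lip x1 (y x1) (z x1) (y' x1) (z' x1)).
  assert (G1 := g_lip x1 (y x1) (z x1) (y' x1) (z' x1)).
  set (p := y x1 - y' x1) in *. set (q := z x1 - z' x1) in *.
  set (df := f x1 (y x1) (z x1) - f x1 (y' x1) (z' x1)) in *.
  set (dg := g x1 (y x1) (z x1) - g x1 (y' x1) (z' x1)) in *.
  clearbody p q df dg.
  assert (P2 : p ^ 2 = Rabs p ^ 2) by (rewrite pow2_abs; reflexivity).
  assert (Q2 : q ^ 2 = Rabs q ^ 2) by (rewrite pow2_abs; reflexivity).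
  rewrite P2, Q2.
  assert (Rabs (2 * p * df + 2 * q * dg) <= 2 * Rabs p * Rabs df + 2 * Rabs q * Rabs dg).
  { eapply Rle_trans; [apply Rabs_triang|]. rewrite !Rabs_mult.
    rewrite (Rabs_pos_eq 2) by lra. lra. }
  assert (Ap := Rabs_pos p). assert (Aq := Rabs_pos q).
  set (a := Rabs p) in *. set (b := Rabs q) in *. clearbody a b.
  assert (a * Rabs df <= a * (L * (a + b))) by (apply Rmult_le_compat_l; assumption).
  assert (b * Rabs dg <= b * (L * (a + b))) by (apply Rmult_le_compat_l; assumption).
  assert (0 <= L * (a - b) ^ 2) by (apply Rmult_le_pos; [lra|apply pow2_ge_0]).
  nra. }
assert (DEe : forall c x1, Rmin x0 x <= x1 <= Rmax x0 x ->
   is_derive (fun t => E t * exp (c * (t - x0))) x1 ((dE x1 + c * E x1) * exp (c * (x1 - x0)))).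
{ intros c x1 Hx1. auto_derive.
  - repeat split. exists (dE x1); apply DE, Hx1.
  - rewrite (is_derive_unique (fun x : R => E x) _ _ (DE x1 Hx1)). unfold Rminus. ring. }
fold (E x). fold (E x0).
destruct (Rle_dec x0 x) as [Hx|Hx].
- rewrite Rmin_left, Rmax_right in DEe by lra. rewrite Rabs_pos_eq by lra.
  assert (A := nondecreasing_of_derive (fun t => - (E t * exp (- (4 * L) * (t - x0))))
     (fun t => - ((dE t + - (4 * L) * E t) * exp (- (4 * L) * (t - x0)))) x0 x Hx).
  cbv beta in A. rewrite Rminus_diag, Rmult_0_r, exp_0 in A.
  assert (E x * exp (- (4 * L) * (x - x0)) <= E x0).
  { rewrite Rmult_1_r in A. apply Ropp_le_cancel, A.
    - intros t Ht. apply (is_derive_opp (fun t => E t * exp (- (4 * L) * (t - x0)))). apply DEe; lra.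
    - intros t Ht. eapply is_derive_continuous.
      apply (is_derive_opp (fun t => E t * exp (- (4 * L) * (t - x0)))). apply DEe; lra.
    - intros t _. specialize (BE t). apply Rabs_le_between in BE.
      assert (0 <= (- dE t + 4 * L * E t) * exp (- (4 * L) * (t - x0))); [|lra].
      apply Rmult_le_pos; [lra|left; apply exp_pos]. }
  apply Rmult_le_compat_r with (r := exp (4 * L * (x - x0))) in H0; [|left; apply exp_pos].
  rewrite Rmult_assoc, <- exp_plus in H0.
  replace (- (4 * L) * (x - x0) + 4 * L * (x - x0)) with 0 in H0 by ring.
  rewrite exp_0, Rmult_1_r in H0. exact H0.
- rewrite Rmin_right, Rmax_left in DEe by lra. rewrite Rabs_left by lra.
  assert (A := nondecreasing_of_derive (fun t => E t * exp (4 * L * (t - x0)))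
     (fun t => (dE t + 4 * L * E t) * exp (4 * L * (t - x0))) x x0 ltac:(lra)).
  cbv beta in A. rewrite Rminus_diag, Rmult_0_r, exp_0, Rmult_1_r in A.
  assert (E x * exp (4 * L * (x - x0)) <= E x0).
  { apply A.
    - intros t Ht. apply DEe; lra.
    - intros t Ht. eapply is_derive_continuous. apply DEe; lra.
    - intros t _. specialize (BE t). apply Rabs_le_between in BE.
      apply Rmult_le_pos; [lra|left; apply exp_pos]. }
  apply Rmult_le_compat_r with (r := exp (4 * L * - (x - x0))) in H0; [|left; apply exp_pos].
  rewrite Rmult_assoc, <- exp_plus in H0.
  replace (4 * L * (x - x0) + 4 * L * - (x - x0)) with 0 in H0 by ring.
  rewrite exp_0, Rmult_1_r in H0. exact H0.
Qed.

End PlanarODE.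

(** Continuity of the inverse is separate from its differentiability because the derivative of g may
    vanish: physical time stands still, relative to u, at each double collision. *)
Lemma increasing_inverse (g : R -> R) :
  (forall x y, x < y -> g x < g y) ->
  (forall t, exists x, g x = t) ->
  exists v : R -> R,
    (forall x, v (g x) = x) /\ (forall t, g (v t) = t) /\
    (forall t, continuous v t) /\
    (forall x l, is_derive g x l -> l <> 0 -> is_derive v (g x) (/ l)).
Proof.
intros Hinc Hsurj.
set (v := fun t => proj1_sig (constructive_indefinite_description _ (Hsurj t))).
assert (Hgv : forall t, g (v t) = t).
{ intros t. unfold v. destruct (constructive_indefinite_description _ (Hsurj t)). assumption. }
clearbody v.
assert (Hlt : forall x y, g x < g y -> x < y).
{ intros x y H. destruct (Rtotal_order x y) as [|[->|H2]]; [assumption|lra|].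
  apply Hinc in H2. lra. }
assert (Hvg : forall x, v (g x) = x).
{ intros x. destruct (Rtotal_order (v (g x)) x) as [H|[H|H]]; [|assumption|];
    apply Hinc in H; rewrite Hgv in H; lra. }
assert (Hcont : forall t, continuous v t).
{ intros t. apply filterlim_locally. intros eps.
  assert (He := cond_pos eps).
  assert (H1 : g (v t - eps) < t) by (rewrite <- (Hgv t) at 2; apply Hinc; lra).
  assert (H2 : t < g (v t + eps)) by (rewrite <- (Hgv t) at 1; apply Hinc; lra).
  assert (Hd : 0 < Rmin (t - g (v t - eps)) (g (v t + eps) - t)) by (apply Rmin_glb_lt; lra).
  exists (mkposreal _ Hd). intros s Hs.
  change (Rabs (s - t) < Rmin (t - g (v t - eps)) (g (v t + eps) - t)) in Hs.
  assert (M1 := Rmin_l (t - g (v t - eps)) (g (v t + eps) - t)).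
  assert (M2 := Rmin_r (t - g (v t - eps)) (g (v t + eps) - t)).
  apply Rabs_def2 in Hs.
  change (Rabs (v s - v t) < eps). apply Rabs_def1.
  - assert (v s < v t + eps); [apply Hlt; rewrite Hgv; lra|lra].
  - assert (v t - eps < v s); [apply Hlt; rewrite Hgv; lra|lra]. }
exists v. split; [exact Hvg|split; [exact Hgv|split; [exact Hcont|]]].
intros x l Hd Hl.
apply is_derive_Reals. apply is_derive_Reals in Hd.
intros eps Heps.
assert (Hic : continuity_pt (fun y => / y) l).
{ apply continuity_pt_inv; [apply continuity_pt_id|exact Hl]. }
destruct (Hic eps Heps) as [a1 [Ha1 Hinv]].
destruct (Hd a1 Ha1) as [[d2 Hd2] Hquot].
destruct (proj1 (filterlim_locally v (v (g x))) (Hcont (g x)) (mkposreal d2 Hd2)) as [d3 Hv3].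
exists d3. intros h Hh0 Hh.
assert (B : Rabs (v (g x + h) - x) < d2).
{ specialize (Hv3 (g x + h)). rewrite Hvg in Hv3. apply Hv3.
  change (Rabs (g x + h - g x) < d3). replace (g x + h - g x) with h by ring. exact Hh. }
set (k := v (g x + h) - x) in *.
assert (Hxk : v (g x + h) = x + k) by (unfold k; ring).
assert (Hgk : g (x + k) = g x + h) by (rewrite <- Hxk; apply Hgv).
assert (Hk0 : k <> 0).
{ intros K. rewrite K, Rplus_0_r in Hgk. lra. }
specialize (Hquot k Hk0 B). rewrite Hgk in Hquot.
replace (g x + h - g x) with h in Hquot by ring.
rewrite Hvg, Hxk. replace ((x + k - x) / h) with (/ (h / k)) by (field; split; assumption).
destruct (Req_dec (h / k) l) as [->|Hne].
- rewrite Rminus_diag, Rabs_R0. exact Heps.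
- apply (Hinv (h / k)). split.
  + split; [exact I|]. intros E; apply Hne; symmetry; exact E.
  + exact Hquot.
Qed.

(** * Calculus of real-valued functions *)

Lemma continuous_comp_real {T : UniformSpace} (f : R -> R) (g : T -> R) (x : T) :
  continuous g x -> continuous f (g x) -> continuous (fun x => f (g x)) x.
Proof. intros H1 H2. apply (continuous_comp g f); assumption. Qed.

Lemma ex_derive_cont (f : R -> R) (x : R) : ex_derive f x -> continuous f x.
Proof. apply (ex_derive_continuous (K := R_AbsRing) (V := R_NormedModule)). Qed.

Lemma continuous_Rmult {T : UniformSpace} (f g : T -> R) (x : T) :
  continuous f x -> continuous g x -> continuous (fun x => f x * g x) x.
Proof. apply (continuous_mult (K := R_AbsRing)). Qed.

Lemma continuous_Rplus {T : UniformSpace} (f g : T -> R) (x : T) :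
  continuous f x -> continuous g x -> continuous (fun x => f x + g x) x.
Proof. apply (continuous_plus (K := R_AbsRing) (V := R_NormedModule)). Qed.

Lemma continuous_Rminus {T : UniformSpace} (f g : T -> R) (x : T) :
  continuous f x -> continuous g x -> continuous (fun x => f x - g x) x.
Proof. apply (continuous_minus (K := R_AbsRing) (V := R_NormedModule)). Qed.

Ltac cont_deriv := apply ex_derive_cont; auto_derive; trivial.

Lemma is_derive_comp_real (f g : R -> R) (x df dg : R) :
  is_derive f (g x) df -> is_derive g x dg -> is_derive (fun x => f (g x)) x (df * dg).
Proof.
intros Hf Hg. evar_last; [apply (is_derive_comp f g); eassumption|].
unfold scal; simpl; unfold mult; simpl. ring.
Qed.

Lemma is_derive_Rmult (f g : R -> R) (x df dg : R) :
  is_derive f x df -> is_derive g x dg -> is_derive (fun x => f x * g x) x (df * g x + f x * dg).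
Proof.
intros Hf Hg. apply (is_derive_mult f g); [exact Hf|exact Hg|]. intros; apply Rmult_comm.
Qed.

Lemma is_derive_Rplus (f g : R -> R) (x df dg : R) :
  is_derive f x df -> is_derive g x dg -> is_derive (fun x => f x + g x) x (df + dg).
Proof. apply (is_derive_plus f g). Qed.

Lemma is_derive_Rminus (f g : R -> R) (x df dg : R) :
  is_derive f x df -> is_derive g x dg -> is_derive (fun x => f x - g x) x (df - dg).
Proof. apply (is_derive_minus f g). Qed.

Lemma is_derive_Rscal (c : R) (f : R -> R) (x df : R) :
  is_derive f x df -> is_derive (fun x => c * f x) x (c * df).
Proof. apply (is_derive_scal f). Qed.

Lemma bounded_on_segment (f : R -> R) (a b : R) :
  a <= b -> (forall x, a <= x <= b -> continuous f x) ->
  exists C, 0 < C /\ forall x, a <= x <= b -> Rabs (f x) <= C.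
Proof.
intros Hab Hc.
destruct (continuity_ab_maj (fun x => Rabs (f x)) a b Hab) as [x0 [H0 _]].
- intros x Hx. apply continuity_pt_filterlim.
  apply (continuous_comp f Rabs); [apply Hc, Hx|apply continuous_Rabs].
- exists (Rabs (f x0) + 1). split; [assert (H := Rabs_pos (f x0)); lra|].
  intros x Hx. specialize (H0 x Hx). simpl in H0. lra.
Qed.

Lemma lipschitz_on_segment (f df : R -> R) (lo hi C : R) :
  (forall x, lo <= x <= hi -> is_derive f x (df x)) ->
  (forall x, lo <= x <= hi -> Rabs (df x) <= C) ->
  forall x y, lo <= x <= hi -> lo <= y <= hi -> Rabs (f x - f y) <= C * Rabs (x - y).
Proof.
intros Hd Hb x y Hx Hy.
assert (Hr : forall t, Rmin y x <= t <= Rmax y x -> lo <= t <= hi).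
{ intros t Ht. assert (lo <= Rmin y x) by (apply Rmin_glb; lra).
  assert (Rmax y x <= hi) by (apply Rmax_lub; lra). lra. }
destruct (MVT_gen f y x df) as [c [Hc1 Hc]].
- intros t Ht. apply Hd, Hr. lra.
- intros t Ht. apply continuity_pt_filterlim. eapply is_derive_continuous, Hd, Hr, Ht.
- rewrite Hc, Rabs_mult. apply Rmult_le_compat_r; [apply Rabs_pos|apply Hb, Hr, Hc1].
Qed.

(** Squaring removes the corner of min (x, 0); hence the truncated angular momentum can be
    differentiated even where nu crosses 0. *)
Lemma is_derive_Rmin_sq x : is_derive (fun x => Rmin x 0 ^ 2) x (2 * Rmin x 0).
Proof.
destruct (Rtotal_order x 0) as [H|[->|H]].
- rewrite Rmin_left by lra. apply (is_derive_ext_loc (fun x => x ^ 2)).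
  + apply (locally_interval _ x m_infty 0); simpl; [trivial|lra|].
    intros y _ Hy. simpl in Hy. rewrite Rmin_left; lra.
  + auto_derive; [trivial|ring].
- rewrite Rmin_left, Rmult_0_r by lra. apply is_derive_Reals. intros eps Heps.
  exists (mkposreal _ Heps). intros y Hy Hy'. simpl in Hy'.
  rewrite Rplus_0_l, (Rmin_left 0 0) by lra. rewrite Rminus_0_r.
  unfold Rmin. destruct (Rle_dec y 0).
  + replace ((y ^ 2 - 0 ^ 2) / y) with y by (field; exact Hy). exact Hy'.
  + replace ((0 ^ 2 - 0 ^ 2) / y) with 0 by (field; exact Hy). rewrite Rabs_R0. exact Heps.
- rewrite Rmin_right by lra. apply (is_derive_ext_loc (fun x => 0)).
  + apply (locally_interval _ x 0 p_infty); simpl; [lra|trivial|].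
    intros y Hy _. simpl in Hy. rewrite Rmin_right by lra. ring.
  + rewrite Rmult_0_r. apply (is_derive_const (V := R_NormedModule)).
Qed.

Lemma nonneg_at_right_end (f : R -> R) (a b : R) :
  a < b -> continuous f b -> (forall x, a <= x < b -> 0 <= f x) -> 0 <= f b.
Proof.
intros Hab Hc Hf. destruct (Rle_dec 0 (f b)) as [|Hn]; [assumption|exfalso].
assert (He : 0 < - f b) by lra.
destruct (proj1 (filterlim_locally f (f b)) Hc (mkposreal _ He)) as [d Hd].
assert (Hdp := cond_pos d).
set (x := Rmax a (b - d / 2)).
assert (Hx : a <= x < b /\ b - d / 2 <= x).
{ unfold x. split; [split; [apply Rmax_l|apply Rmax_lub_lt; lra]|apply Rmax_r]. }
specialize (Hf x ltac:(lra)).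
assert (Hb : Rabs (f x - f b) < - f b).
{ apply Hd. change (Rabs (x - b) < d). rewrite Rabs_left; lra. }
apply Rabs_def2 in Hb. lra.
Qed.

Lemma continuous_Rmin {T : UniformSpace} (f g : T -> R) (x : T) :
  continuous f x -> continuous g x -> continuous (fun x => Rmin (f x) (g x)) x.
Proof.
intros Hf Hg.
apply (continuous_ext (fun x => (f x + g x - Rabs (f x - g x)) * / 2)).
- intros y. unfold Rmin. destruct (Rle_dec (f y) (g y)); unfold Rabs; destruct Rcase_abs; field_simplify; lra.
- apply continuous_Rmult; [|apply continuous_const].
  apply continuous_Rminus; [apply continuous_Rplus; assumption|].
  apply (continuous_comp (fun x => f x - g x) Rabs); [apply continuous_Rminus; assumption|apply continuous_Rabs].
Qed.

Lemma is_derive_supplement (f : R -> R) (x l : R) :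
  is_derive f (PI - x) l -> is_derive (fun y => f (PI - y)) x (- l).
Proof.
intros H. evar_last.
- apply (is_derive_comp_real f (fun y => PI - y) x l (- 1) H). auto_derive; [trivial|ring].
- ring.
Qed.

(** The two reflections compose to the translation by pi, and [0, pi / 2] is a fundamental domain of
    the group they generate. *)
Lemma reflection_induction (P : R -> Prop) :
  (forall u, 0 <= u <= PI / 2 -> P u) -> (forall u, P u -> P (- u)) -> (forall u, P u -> P (PI - u)) ->
  forall u, P u.
Proof.
intros H0 Hm Hp. assert (HP := PI_RGT_0).
assert (Hn : forall j u, 0 <= u <= INR j * PI -> P u).
{ induction j as [|j IH]; intros u Hu.
  - apply H0. simpl in Hu. lra.
  - rewrite S_INR in Hu.
    destruct (Rle_dec u (PI / 2)) as [H1|H1]; [apply H0; lra|].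
    replace u with (PI - - (u - PI)) by ring. apply Hp.
    destruct (Rle_dec PI u) as [H2|H2].
    + apply Hm, IH. lra.
    + apply H0. lra. }
assert (Hpos : forall u, 0 <= u -> P u).
{ intros u Hu. destruct (nfloor_ex (u / PI)) as [j Hk].
  - apply Rmult_le_pos; [exact Hu|left; apply Rinv_0_lt_compat, HP].
  - apply (Hn (S j)). split; [exact Hu|]. rewrite S_INR.
    apply Rmult_le_reg_r with (/ PI); [apply Rinv_0_lt_compat, HP|].
    rewrite Rmult_assoc, Rinv_r by lra. unfold Rdiv in Hk. lra. }
intros u. destruct (Rle_dec 0 u); [apply Hpos; assumption|].
rewrite <- (Ropp_involutive u). apply Hm, Hpos. lra.
Qed.

Lemma eq_increment_of_derive (f g d : R -> R) :
  (forall x, is_derive f x (d x)) -> (forall x, is_derive g x (d x)) ->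
  forall x y, f y - f x = g y - g x.
Proof.
intros Hf Hg.
assert (H : forall x y, x <= y -> f y - f x = g y - g x).
{ intros x y Hxy. apply Rle_antisym.
  - apply (le_of_derive_le f g d d); auto; intros; lra.
  - apply (le_of_derive_le g f d d); auto; intros; lra. }
intros x y. destruct (Rle_dec x y); [apply H; assumption|].
assert (E := H y x ltac:(lra)). lra.
Qed.

(** * Time changes whose speed may vanish with cos u *)

Definition cos2_primitive (u : R) : R := u / 2 + sin (2 * u) / 4.

Lemma cos2_primitive_derive (u : R) : is_derive cos2_primitive u (cos u ^ 2).
Proof.
unfold cos2_primitive. auto_derive; [trivial|]. rewrite cos_2a_cos. field.
Qed.

(** With d = y - x the increment is (d + cos (x + y) sin d) / 2, and |sin d| < d. *)
Lemma cos2_primitive_increasing x y : x < y -> cos2_primitive x < cos2_primitive y.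
Proof.
intros Hxy. unfold cos2_primitive.
assert (E := form4 (2 * y) (2 * x)).
replace ((2 * y - 2 * x) / 2) with (y - x) in E by field.
set (d := y - x) in *. assert (Hd : 0 < d) by (unfold d; lra).
assert (H1 := sin_lt_x d Hd).
assert (H2 : - d < sin d).
{ destruct (Rlt_dec d PI) as [Hp|Hp].
  - assert (0 < sin d) by (apply sin_gt_0; lra). lra.
  - assert (Hb := SIN_bound d). assert (HP := PI2_3_2). lra. }
assert (Hc := COS_bound ((2 * y + 2 * x) / 2)).
set (c := cos ((2 * y + 2 * x) / 2)) in *. clearbody c.
assert (- d < c * sin d) by (destruct (Rle_dec 0 (sin d)); nra).
assert (y / 2 - x / 2 = d / 2) by (unfold d; field). lra.
Qed.

(** Although cos u has zeros, comparison with c times [cos2_primitive], which is strictly increasing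
    and stays within 1 / 4 of u / 2, makes g strictly increasing and onto. *)
Lemma time_change_inverse (g dg : R -> R) (c : R) :
  0 < c -> (forall x, is_derive g x (dg x)) -> (forall x, c * cos x ^ 2 <= dg x) ->
  exists v : R -> R,
    (forall x, v (g x) = x) /\ (forall t, g (v t) = t) /\ (forall t, continuous v t) /\
    (forall x l, is_derive g x l -> l <> 0 -> is_derive v (g x) (/ l)).
Proof.
intros Hc Hd Hl.
assert (Hg : forall x y, x <= y -> c * (cos2_primitive y - cos2_primitive x) <= g y - g x).
{ intros x y Hxy. rewrite Rmult_minus_distr_l.
  apply (le_of_derive_le (fun u => c * cos2_primitive u) g (fun u => c * cos u ^ 2) dg); auto.
  intros u _. apply is_derive_Rscal, cos2_primitive_derive. }
apply increasing_inverse.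
- intros x y Hxy. assert (H1 := Hg x y ltac:(lra)). assert (H2 := cos2_primitive_increasing x y Hxy).
  assert (0 < c * (cos2_primitive y - cos2_primitive x)) by (apply Rmult_lt_0_compat; lra). lra.
- intros t.
  set (b := 2 * (Rabs t + Rabs (g 0)) / c + 1).
  assert (A1 := Rabs_pos t). assert (A2 := Rabs_pos (g 0)).
  assert (Hb0 : 0 <= 2 * (Rabs t + Rabs (g 0)) / c).
  { apply Rmult_le_pos; [lra|left; apply Rinv_0_lt_compat, Hc]. }
  assert (Hcb : c * (b / 2 - / 4) > Rabs t + Rabs (g 0)).
  { unfold b. replace (c * ((2 * (Rabs t + Rabs (g 0)) / c + 1) / 2 - / 4))
      with (Rabs t + Rabs (g 0) + c / 4) by (field; lra). lra. }
  assert (HC0 : cos2_primitive 0 = 0) by (unfold cos2_primitive; rewrite Rmult_0_r, sin_0; field).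
  assert (H1 := Hg 0 b ltac:(unfold b; lra)). assert (H2 := Hg (- b) 0 ltac:(unfold b; lra)).
  rewrite HC0 in H1, H2.
  assert (B1 : b / 2 - / 4 <= cos2_primitive b).
  { unfold cos2_primitive. assert (Hs := SIN_bound (2 * b)). lra. }
  assert (B2 : b / 2 - / 4 <= - cos2_primitive (- b)).
  { unfold cos2_primitive. assert (Hs := SIN_bound (2 * - b)). lra. }
  assert (B3 : c * (b / 2 - / 4) <= c * (cos2_primitive b - 0)) by (apply Rmult_le_compat_l; lra).
  assert (B4 : c * (b / 2 - / 4) <= c * (0 - cos2_primitive (- b))) by (apply Rmult_le_compat_l; lra).
  assert (T1 := Rle_abs t). assert (T2 := Rle_abs (- t)). rewrite Rabs_Ropp in T2.
  assert (G1 := Rle_abs (g 0)). assert (G2 := Rle_abs (- g 0)). rewrite Rabs_Ropp in G2.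
  destruct (IVT_cor (fun x => g x - t) (- b) b) as [x [_ Hx]].
  + intros x. apply continuity_pt_filterlim.
    apply (continuous_Rminus g (fun _ => t)); [eapply is_derive_continuous, Hd|apply continuous_const].
  + unfold b. lra.
  + cbv beta. assert (g (- b) - t < 0) by lra. assert (0 < g b - t) by lra. nra.
  + exists x. lra.
Qed.

(** * Truncations and bounded Lipschitz fields *)

Definition clamp (lo hi x : R) : R := Rmax lo (Rmin hi x).

Lemma clamp_bounds lo hi x : lo <= hi -> lo <= clamp lo hi x <= hi.
Proof.
intros H. unfold clamp. split; [apply Rmax_l|].
apply Rmax_lub; [exact H|apply Rmin_l].
Qed.

Lemma clamp_id lo hi x : lo <= x <= hi -> clamp lo hi x = x.
Proof. intros H. unfold clamp. rewrite Rmin_right, Rmax_right; lra. Qed.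

Lemma Rmax_lipschitz c x y : Rabs (Rmax c x - Rmax c y) <= Rabs (x - y).
Proof.
unfold Rmax. destruct (Rle_dec c x), (Rle_dec c y); unfold Rabs; repeat destruct Rcase_abs; lra.
Qed.

Lemma Rmin_lipschitz c x y : Rabs (Rmin c x - Rmin c y) <= Rabs (x - y).
Proof.
unfold Rmin. destruct (Rle_dec c x), (Rle_dec c y); unfold Rabs; repeat destruct Rcase_abs; lra.
Qed.

Lemma clamp_lipschitz lo hi x y : Rabs (clamp lo hi x - clamp lo hi y) <= Rabs (x - y).
Proof. eapply Rle_trans; [apply Rmax_lipschitz|apply Rmin_lipschitz]. Qed.

(** The floor d^2 keeps the square root away from its infinite slope at 0. *)
Lemma sqrt_Rmax_lipschitz d x y : 0 < d ->
  Rabs (sqrt (Rmax (d ^ 2) x) - sqrt (Rmax (d ^ 2) y)) <= / d * Rabs (x - y).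
Proof.
intros Hd.
assert (Hs : forall z, d <= sqrt (Rmax (d ^ 2) z)).
{ intros z. rewrite <- (sqrt_pow2 d) at 1 by lra. apply sqrt_le_1_alt, Rmax_l. }
assert (Hq : forall z, sqrt (Rmax (d ^ 2) z) ^ 2 = Rmax (d ^ 2) z).
{ intros z. apply pow2_sqrt. apply Rle_trans with (d ^ 2); [apply pow2_ge_0|apply Rmax_l]. }
assert (Hl := Rmax_lipschitz (d ^ 2) x y). rewrite <- (Hq x), <- (Hq y) in Hl.
assert (Hx := Hs x). assert (Hy := Hs y).
set (s := sqrt (Rmax (d ^ 2) x)) in *. set (t := sqrt (Rmax (d ^ 2) y)) in *. clearbody s t.
replace (s ^ 2 - t ^ 2) with ((s - t) * (s + t)) in Hl by ring.
rewrite Rabs_mult, (Rabs_pos_eq (s + t)) in Hl by lra.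
assert (Hp := Rabs_pos (s - t)).
apply Rmult_le_reg_l with d; [exact Hd|].
rewrite <- Rmult_assoc, Rinv_r, Rmult_1_l by lra. nra.
Qed.

Lemma inv_sqrt_Rmax_lipschitz d x y : 0 < d ->
  Rabs (/ sqrt (Rmax (d ^ 2) x) - / sqrt (Rmax (d ^ 2) y)) <= / d ^ 3 * Rabs (x - y).
Proof.
intros Hd.
assert (Hs : forall z, d <= sqrt (Rmax (d ^ 2) z)).
{ intros z. rewrite <- (sqrt_pow2 d) at 1 by lra. apply sqrt_le_1_alt, Rmax_l. }
assert (Hl := sqrt_Rmax_lipschitz d x y Hd).
assert (Hx := Hs x). assert (Hy := Hs y).
set (s := sqrt (Rmax (d ^ 2) x)) in *. set (t := sqrt (Rmax (d ^ 2) y)) in *. clearbody s t.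
replace (/ s - / t) with (- (s - t) * (/ s * / t)) by (field; lra).
rewrite Rabs_mult, Rabs_Ropp.
assert (0 < / s <= / d). { split; [apply Rinv_0_lt_compat; lra|apply Rinv_le_contravar; lra]. }
assert (0 < / t <= / d). { split; [apply Rinv_0_lt_compat; lra|apply Rinv_le_contravar; lra]. }
rewrite (Rabs_pos_eq (/ s * / t)) by (apply Rmult_le_pos; lra).
replace (/ d ^ 3 * Rabs (x - y)) with (/ d * Rabs (x - y) * (/ d * / d)) by (field; lra).
apply Rmult_le_compat; [apply Rabs_pos|apply Rmult_le_pos; lra|exact Hl|].
apply Rmult_le_compat; lra.
Qed.

(* Fields to which [planar_ode_solution] applies; they form an algebra. *)
Definition tame (G : R -> R -> R -> R) : Prop :=
  (forall x y z, continuous (fun x => G x y z) x) /\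
  exists C, 0 < C /\ forall x y z y' z',
    Rabs (G x y z) <= C /\ Rabs (G x y z - G x y' z') <= C * (Rabs (y - y') + Rabs (z - z')).

Lemma tame_plus G G' : tame G -> tame G' -> tame (fun x y z => G x y z + G' x y z).
Proof.
intros [Hc [C [HC HG]]] [Hc' [C' [HC' HG']]]. split.
- intros x y z. apply continuous_Rplus; [apply Hc|apply Hc'].
- exists (C + C'). split; [lra|]. intros x y z y' z'.
  destruct (HG x y z y' z') as [B1 B2]. destruct (HG' x y z y' z') as [B3 B4]. split.
  + eapply Rle_trans; [apply Rabs_triang|]. lra.
  + replace (G x y z + G' x y z - (G x y' z' + G' x y' z'))
      with ((G x y z - G x y' z') + (G' x y z - G' x y' z')) by ring.
    eapply Rle_trans; [apply Rabs_triang|]. lra.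
Qed.

Lemma tame_mult G G' : tame G -> tame G' -> tame (fun x y z => G x y z * G' x y z).
Proof.
intros [Hc [C [HC HG]]] [Hc' [C' [HC' HG']]]. split.
- intros x y z. apply continuous_Rmult; [apply Hc|apply Hc'].
- exists (2 * (C * C')). split; [assert (0 < C * C') by (apply Rmult_lt_0_compat; assumption); lra|].
  intros x y z y' z'.
  destruct (HG x y z y' z') as [B1 B2]. destruct (HG' x y z y' z') as [B3 B4].
  destruct (HG x y' z' y' z') as [B5 _].
  assert (P1 := Rabs_pos (G x y z)). assert (P2 := Rabs_pos (G' x y z)).
  assert (P3 := Rabs_pos (y - y')). assert (P4 := Rabs_pos (z - z')).
  assert (P5 := Rabs_pos (G x y' z')). assert (P6 := Rabs_pos (G x y z - G x y' z')).
  assert (P7 := Rabs_pos (G' x y z - G' x y' z')).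
  split.
  + rewrite Rabs_mult. assert (Rabs (G x y z) * Rabs (G' x y z) <= C * C') by (apply Rmult_le_compat; assumption).
    assert (0 < C * C') by (apply Rmult_lt_0_compat; assumption). lra.
  + replace (G x y z * G' x y z - G x y' z' * G' x y' z')
      with ((G x y z - G x y' z') * G' x y z + G x y' z' * (G' x y z - G' x y' z')) by ring.
    eapply Rle_trans; [apply Rabs_triang|]. rewrite !Rabs_mult.
    set (s := Rabs (y - y') + Rabs (z - z')) in *.
    assert (Rabs (G x y z - G x y' z') * Rabs (G' x y z) <= C * s * C') by (apply Rmult_le_compat; assumption).
    assert (Rabs (G x y' z') * Rabs (G' x y z - G' x y' z') <= C * (C' * s)) by (apply Rmult_le_compat; assumption).
    lra.
Qed.

Lemma tame_time (f : R -> R) (C : R) :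
  (forall x, continuous f x) -> (forall x, Rabs (f x) <= C) -> tame (fun x _ _ => f x).
Proof.
intros Hc Hb. split; [intros x y z; apply Hc|].
assert (0 <= C) by (eapply Rle_trans; [apply Rabs_pos|apply (Hb 0)]).
exists (C + 1). split; [lra|]. intros x y z y' z'. split; [specialize (Hb x); lra|].
rewrite Rminus_diag, Rabs_R0. apply Rmult_le_pos; [lra|].
assert (A1 := Rabs_pos (y - y')). assert (A2 := Rabs_pos (z - z')). lra.
Qed.

Lemma tame_const (c : R) : tame (fun _ _ _ => c).
Proof. apply (tame_time (fun _ => c) (Rabs c)); [intros; apply continuous_const|intros; lra]. Qed.

Lemma lipschitz_continuous (phi : R -> R) (L : R) :
  0 < L -> (forall s t, Rabs (phi s - phi t) <= L * Rabs (s - t)) -> forall x, continuous phi x.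
Proof.
intros HL Hl x. apply filterlim_locally. intros eps.
assert (Hd : 0 < eps / L) by (apply Rdiv_lt_0_compat; [apply cond_pos|exact HL]).
exists (mkposreal _ Hd). intros y Hy.
change (Rabs (y - x) < eps / L) in Hy. change (Rabs (phi y - phi x) < eps).
eapply Rle_lt_trans; [apply Hl|].
apply Rmult_lt_compat_l with (r := L) in Hy; [|exact HL].
replace (L * (eps / L)) with (pos eps) in Hy by (field; lra). exact Hy.
Qed.

Lemma tame_comp (phi : R -> R) (L : R) G :
  0 < L -> (forall s t, Rabs (phi s - phi t) <= L * Rabs (s - t)) ->
  tame G -> tame (fun x y z => phi (G x y z)).
Proof.
intros HL Hl [Hc [C [HC HG]]]. split.
- intros x y z. apply (continuous_comp_real phi (fun x => G x y z)); [apply Hc|].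
  apply (lipschitz_continuous phi L HL Hl).
- exists (Rabs (phi 0) + L * C). assert (0 < L * C) by (apply Rmult_lt_0_compat; assumption).
  assert (Hp := Rabs_pos (phi 0)). split; [lra|]. intros x y z y' z'.
  destruct (HG x y z y' z') as [B1 B2]. split.
  + replace (phi (G x y z)) with (phi 0 + (phi (G x y z) - phi 0)) by ring.
    eapply Rle_trans; [apply Rabs_triang|]. apply Rplus_le_compat_l.
    eapply Rle_trans; [apply Hl|]. rewrite Rminus_0_r. apply Rmult_le_compat_l; lra.
  + eapply Rle_trans; [apply Hl|].
    assert (Q1 := Rabs_pos (y - y')). assert (Q2 := Rabs_pos (z - z')).
    apply Rle_trans with (L * (C * (Rabs (y - y') + Rabs (z - z')))); [apply Rmult_le_compat_l; lra|].
    rewrite <- Rmult_assoc. apply Rmult_le_compat_r; lra.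
Qed.

Lemma tame_opp G : tame G -> tame (fun x y z => - G x y z).
Proof.
apply (tame_comp Ropp 1); [lra|].
intros s t. rewrite <- Rabs_Ropp. right. rewrite Rmult_1_l. f_equal. ring.
Qed.

(** * The functions x / sin x and x cot x *)

Lemma CV_radius_sin_n : CV_radius sin_n = p_infty.
Proof.
apply CV_radius_infinite_DAlembert.
- intros j. unfold sin_n. apply Rmult_integral_contrapositive_currified.
  + apply pow_nonzero; lra.
  + apply Rinv_neq_0_compat, INR_fact_neq_0.
- apply is_lim_seq_spec. intros eps.
  destruct (Alembert_sin eps (cond_pos eps)) as [N HN].
  exists N. intros j Hj. specialize (HN j Hj).
  unfold R_dist in HN. rewrite Rminus_0_r in *. rewrite Rabs_Rabsolu in *. exact HN.
Qed.

(** The entire function y |-> sin (sqrt y) / sqrt y; the next three are its successive derivatives.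
    Being a power series in y = x^2, it makes x / sin x smooth at 0 without a case distinction. *)
Definition sinc_sq : R -> R := PSeries sin_n.
Definition sinc_sq1 : R -> R := PSeries (PS_derive sin_n).
Definition sinc_sq2 : R -> R := PSeries (PS_derive (PS_derive sin_n)).
Definition sinc_sq3 : R -> R := PSeries (PS_derive (PS_derive (PS_derive sin_n))).

Lemma is_derive_sinc_sq x : is_derive sinc_sq x (sinc_sq1 x).
Proof. apply is_derive_PSeries. rewrite CV_radius_sin_n. exact I. Qed.
Lemma is_derive_sinc_sq1 x : is_derive sinc_sq1 x (sinc_sq2 x).
Proof. apply is_derive_PSeries. rewrite CV_radius_derive, CV_radius_sin_n. exact I. Qed.
Lemma is_derive_sinc_sq2 x : is_derive sinc_sq2 x (sinc_sq3 x).
Proof. apply is_derive_PSeries. rewrite !CV_radius_derive, CV_radius_sin_n. exact I. Qed.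

Lemma sin_sinc_sq x : sin x = x * sinc_sq (x ^ 2).
Proof.
unfold sin. destruct (exist_sin (Rsqr x)) as [l Hl].
f_equal. unfold sinc_sq. symmetry.
replace (x ^ 2) with (Rsqr x) by (unfold Rsqr; ring).
apply is_pseries_unique. apply is_pseries_R, is_series_Reals.
exact Hl.
Qed.

Lemma sinc_sq_pos x : Rabs x < PI -> 0 < sinc_sq (x ^ 2).
Proof.
assert (Hp : forall y, 0 < y < PI -> 0 < sinc_sq (y ^ 2)).
{ intros y Hy. assert (Hs := sin_gt_0 y (proj1 Hy) (proj2 Hy)).
  rewrite sin_sinc_sq in Hs. apply Rmult_lt_reg_l with y; lra. }
intros Hx. apply Rabs_def2 in Hx.
destruct (Rtotal_order x 0) as [H|[->|H]].
- replace (x ^ 2) with ((- x) ^ 2) by ring. apply Hp; lra.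
- replace (0 ^ 2) with 0 by ring. unfold sinc_sq. rewrite PSeries_0. unfold sin_n. simpl. lra.
- apply Hp; lra.
Qed.

(* [xcsc x] and [xcot x] are the analytic continuations to |x| < PI of x / sin x and
   x cot x, including the value 1 at 0. *)
Definition xcsc (x : R) : R := / sinc_sq (x ^ 2).
Definition xcsc1 (x : R) : R := - (2 * x * sinc_sq1 (x ^ 2)) / sinc_sq (x ^ 2) ^ 2.
Definition xcot (x : R) : R := cos x * xcsc x.
Definition xcot1 (x : R) : R := - sin x * xcsc x + cos x * xcsc1 x.
Definition xcsc2 (x : R) : R :=
  - (2 * sinc_sq1 (x ^ 2) + 4 * x ^ 2 * sinc_sq2 (x ^ 2)) / sinc_sq (x ^ 2) ^ 2
  + 8 * x ^ 2 * sinc_sq1 (x ^ 2) ^ 2 / sinc_sq (x ^ 2) ^ 3.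
Definition xcot2 (x : R) : R := - cos x * xcsc x - 2 * sin x * xcsc1 x + cos x * xcsc2 x.

Lemma is_derive_xcsc x : Rabs x < PI -> is_derive xcsc x (xcsc1 x).
Proof.
intros Hx. assert (H := sinc_sq_pos x Hx). unfold xcsc, xcsc1.
assert (D := is_derive_sinc_sq (x ^ 2)).
assert (Hg : is_derive (fun x => sinc_sq (x ^ 2)) x (2 * x * sinc_sq1 (x ^ 2))).
{ evar_last.
  - apply (is_derive_comp sinc_sq (fun x => x ^ 2) x); [exact D|]. auto_derive; [trivial|reflexivity].
  - simpl. unfold scal; simpl; unfold mult; simpl. ring. }
apply (is_derive_inv (fun x => sinc_sq (x ^ 2)) x _ Hg). lra.
Qed.

Lemma is_derive_xcsc1 x : Rabs x < PI -> is_derive xcsc1 x (xcsc2 x).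
Proof.
intros Hx. assert (H := sinc_sq_pos x Hx). unfold xcsc1, xcsc2.
assert (D0 := is_derive_sinc_sq (x ^ 2)). assert (D1 := is_derive_sinc_sq1 (x ^ 2)).
auto_derive.
- repeat split; [eexists; exact D1|eexists; exact D0|].
  rewrite Rmult_1_r. simpl in H. rewrite Rmult_1_r in H. nra.
- replace (x * (x * 1)) with (x ^ 2) by ring.
  rewrite (is_derive_unique (fun x : R => sinc_sq x) _ _ D0), (is_derive_unique (fun x : R => sinc_sq1 x) _ _ D1).
  field. lra.
Qed.

Lemma is_derive_xcot x : Rabs x < PI -> is_derive xcot x (xcot1 x).
Proof.
intros Hx. assert (D := is_derive_xcsc x Hx). unfold xcot, xcot1.
auto_derive.
- eexists; exact D.
- rewrite (is_derive_unique (fun x : R => xcsc x) _ _ D). ring.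
Qed.

Lemma is_derive_xcot1 x : Rabs x < PI -> is_derive xcot1 x (xcot2 x).
Proof.
intros Hx. assert (D := is_derive_xcsc x Hx). assert (D1 := is_derive_xcsc1 x Hx). unfold xcot1, xcot2.
auto_derive.
- repeat split; eexists; eassumption.
- rewrite (is_derive_unique (fun x : R => xcsc x) _ _ D), (is_derive_unique (fun x : R => xcsc1 x) _ _ D1).
  ring.
Qed.

Lemma continuous_xcsc x : Rabs x < PI -> continuous xcsc x.
Proof. intros H. eapply is_derive_continuous, is_derive_xcsc, H. Qed.
Lemma continuous_xcot x : Rabs x < PI -> continuous xcot x.
Proof. intros H. eapply is_derive_continuous, is_derive_xcot, H. Qed.
Lemma continuous_xcot1 x : Rabs x < PI -> continuous xcot1 x.
Proof. intros H. eapply is_derive_continuous, is_derive_xcot1, H. Qed.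

Lemma continuous_xcot2 x : Rabs x < PI -> continuous xcot2 x.
Proof.
intros Hx. assert (H := sinc_sq_pos x Hx).
apply (ex_derive_continuous (K := R_AbsRing) (V := R_NormedModule)).
assert (E1 : ex_derive xcsc2 x).
{ unfold xcsc2. auto_derive. rewrite Rmult_1_r. simpl in H. rewrite Rmult_1_r in H.
  assert (0 < sinc_sq (x * x) * sinc_sq (x * x)) by nra.
  assert (0 < sinc_sq (x * x) * sinc_sq (x * x) * sinc_sq (x * x)) by nra.
  repeat split;
    try (exists (sinc_sq1 (x * x)); apply is_derive_sinc_sq); try (exists (sinc_sq2 (x * x)); apply is_derive_sinc_sq1);
    try (exists (sinc_sq3 (x * x)); apply is_derive_sinc_sq2); rewrite Rmult_1_r; lra. }
unfold xcot2. auto_derive.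
repeat split; [exists (xcsc1 x); apply is_derive_xcsc, Hx|exists (xcsc2 x); apply is_derive_xcsc1, Hx|exact E1].
Qed.

Lemma xcsc_sin x : 0 < x < PI -> xcsc x = x / sin x.
Proof.
intros Hx. assert (H := sinc_sq_pos x ltac:(rewrite Rabs_pos_eq; lra)).
unfold xcsc. rewrite sin_sinc_sq. field. lra.
Qed.

Lemma xcsc_0 : xcsc 0 = 1.
Proof.
unfold xcsc. replace (0 ^ 2) with 0 by ring. unfold sinc_sq. rewrite PSeries_0.
unfold sin_n. simpl. field.
Qed.

Lemma sin_xcsc x : Rabs x < PI -> sin x * xcsc x = x.
Proof. intros H. apply sinc_sq_pos in H. unfold xcsc. rewrite sin_sinc_sq. field. lra. Qed.

Lemma xcsc_pos x : Rabs x < PI -> 0 < xcsc x.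
Proof. intros H. apply Rinv_0_lt_compat, sinc_sq_pos, H. Qed.

Lemma xcot_cot x : 0 < x < PI -> xcot x = x * (cos x / sin x).
Proof.
intros Hx. unfold xcot. rewrite xcsc_sin by exact Hx.
assert (0 < sin x) by (apply sin_gt_0; lra). field. lra.
Qed.

Lemma is_derive_cot x : sin x <> 0 -> is_derive cot x (- / sin x ^ 2).
Proof.
intros H. unfold cot. auto_derive; [exact H|].
assert (E := sin2_cos2 x). unfold Rsqr in E.
apply Rmult_eq_reg_r with (sin x ^ 2); [|apply pow_nonzero, H].
field_simplify; [|exact H|exact H]. nra.
Qed.

Lemma xcot1_cot x : 0 < x < PI -> xcot1 x = cos x / sin x - x / sin x ^ 2.
Proof.
intros Hx. assert (Hs : 0 < sin x) by (apply sin_gt_0; lra).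
rewrite <- (is_derive_unique xcot x (xcot1 x)) by (apply is_derive_xcot; rewrite Rabs_pos_eq; lra).
apply is_derive_unique.
apply (is_derive_ext_loc (fun x => x * (cos x / sin x))).
- apply (locally_interval _ x 0 PI); simpl; [lra|lra|].
  intros y H1 H2. symmetry. apply xcot_cot. simpl in *; lra.
- auto_derive; [lra|]. assert (E := sin2_cos2 x). unfold Rsqr in E.
  apply Rmult_eq_reg_r with (sin x ^ 2); [|apply pow_nonzero; lra].
  field_simplify; [|lra|lra]. nra.
Qed.

Lemma sin_le_id x : 0 <= x -> sin x <= x.
Proof. intros [H|<-]; [left; apply sin_lt_x, H|rewrite sin_0; lra]. Qed.

Lemma xcot1_0 : xcot1 0 = 0.
Proof. unfold xcot1, xcsc1. rewrite sin_0. unfold Rdiv. ring. Qed.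

(** The sign is that of sin x cos x - x. *)
Lemma xcot1_nonpos x : 0 <= x < PI -> xcot1 x <= 0.
Proof.
intros [[Hx|<-] Hp]; [|rewrite xcot1_0; lra].
assert (Hs : 0 < sin x) by (apply sin_gt_0; lra).
rewrite xcot1_cot by lra.
replace (cos x / sin x - x / sin x ^ 2) with ((sin x * cos x - x) / sin x ^ 2) by (field; lra).
assert (sin x * cos x <= x).
{ assert (sin x < x) by (apply sin_lt_x; lra).
  assert (cos x <= 1) by apply COS_bound. nra. }
assert (0 < / sin x ^ 2) by (apply Rinv_0_lt_compat; nra).
unfold Rdiv. nra.
Qed.

Lemma xcot_0 : xcot 0 = 1.
Proof. unfold xcot. rewrite xcsc_0, cos_0. ring. Qed.

Lemma xcot_decreasing x y : 0 <= x <= y -> y < PI -> xcot y <= xcot x.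
Proof.
intros Hx Hy.
assert (A := nondecreasing_of_derive (fun t => - xcot t) (fun t => - xcot1 t) x y ltac:(lra)).
cbv beta in A.
assert (- xcot x <= - xcot y); [|lra]. apply A.
- intros t Ht. apply (is_derive_opp xcot), is_derive_xcot. rewrite Rabs_pos_eq; lra.
- intros t Ht. apply (continuous_opp xcot), continuous_xcot. rewrite Rabs_pos_eq; lra.
- intros t Ht. assert (xcot1 t <= 0) by (apply xcot1_nonpos; lra). lra.
Qed.

Lemma xcot_le_1 x : 0 <= x < PI -> xcot x <= 1.
Proof. intros H. rewrite <- xcot_0. apply xcot_decreasing; lra. Qed.

Lemma cos_ge_quadratic x : 1 - x ^ 2 / 2 <= cos x.
Proof.
assert (Hp : forall x, 0 <= x -> 1 - x ^ 2 / 2 <= cos x).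
{ clear x. intros x Hx.
  assert (cos 0 - (1 - 0 ^ 2 / 2) <= cos x - (1 - x ^ 2 / 2)); [|rewrite cos_0 in H; lra].
  apply (nondecreasing_of_derive (fun t => cos t - (1 - t ^ 2 / 2)) (fun t => t - sin t)); [exact Hx| | |].
  - intros t Ht. auto_derive; [trivial|field].
  - intros t Ht. cont_deriv.
  - intros t Ht. assert (sin t <= t) by (apply sin_le_id; lra). lra. }
destruct (Rle_dec 0 x); [apply Hp; assumption|].
rewrite <- cos_neg. replace (x ^ 2) with ((- x) ^ 2) by ring. apply Hp; lra.
Qed.

Lemma sin_ge_cubic x : 0 <= x -> x - x ^ 3 / 6 <= sin x.
Proof.
intros Hx.
assert (sin 0 - (0 - 0 ^ 3 / 6) <= sin x - (x - x ^ 3 / 6)); [|rewrite sin_0 in H; lra].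
apply (nondecreasing_of_derive (fun t => sin t - (t - t ^ 3 / 6)) (fun t => cos t - (1 - t ^ 2 / 2))); [exact Hx| | |].
- intros t Ht. auto_derive; [trivial|field].
- intros t Ht. cont_deriv.
- intros t Ht. assert (H := cos_ge_quadratic t). lra.
Qed.

Lemma xcot_ge_quadratic x : 0 <= x <= 1 -> 1 - x ^ 2 / 2 <= xcot x.
Proof.
intros [[Hx|<-] Hx1]; [|rewrite xcot_0; lra].
assert (HP := PI2_3_2).
rewrite xcot_cot by lra.
assert (Hs : 0 < sin x) by (apply sin_gt_0; lra).
assert (Hs2 : sin x < x) by (apply sin_lt_x; lra).
assert (Hc := cos_ge_quadratic x).
apply Rmult_le_reg_r with (sin x); [exact Hs|].
replace (x * (cos x / sin x) * sin x) with (x * cos x) by (field; lra).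
assert (0 <= 1 - x ^ 2 / 2) by nra. nra.
Qed.

Lemma xcsc_ge_1 x : 0 <= x < PI -> 1 <= xcsc x.
Proof.
intros [[Hx|<-] Hp]; [|rewrite xcsc_0; lra].
rewrite xcsc_sin by lra. assert (Hs : 0 < sin x) by (apply sin_gt_0; lra).
assert (sin x < x) by (apply sin_lt_x; lra).
apply Rmult_le_reg_r with (sin x); [exact Hs|].
replace (x / sin x * sin x) with x by (field; lra). lra.
Qed.

(** A partial sum of the Leibniz series ending with a positive term. The bound is coarse but yields
    the two numbers used later, theta_* < 4 / 5 and pi / 2 <= 1.6. *)
Lemma PI_upper : PI <= 3.2.
Proof.
destruct (PI_ineq 10) as [_ H].
unfold tg_alt, PI_tg in H. cbn [sum_f_R0 Nat.mul Nat.add pow] in H.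
rewrite !INR_IZR_INZ in H. cbn [Z.of_nat Pos.of_succ_nat Pos.succ] in H. lra.
Qed.

(** On this range x^2 <= 3, so sin x >= x - x^3 / 6 >= x / 2. *)
Lemma xcsc_le x : 0 <= x <= PI / 2 -> xcsc x <= 2.
Proof.
assert (HP := PI_upper). assert (HP' := PI_RGT_0).
intros [[Hx|<-] Hp]; [|rewrite xcsc_0; lra].
rewrite xcsc_sin by lra. assert (Hs : 0 < sin x) by (apply sin_gt_0; lra).
apply Rmult_le_reg_r with (sin x); [exact Hs|].
replace (x / sin x * sin x) with x by (field; lra).
assert (H := sin_ge_cubic x ltac:(lra)).
assert (x ^ 2 <= 3) by nra. assert (x ^ 3 = x * x ^ 2) by ring. nra.
Qed.


(** * The potential *)

(** A class, so that the masses, the energy and the hypotheses on them remain implicit arguments of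
    everything below. *)
Class three_body := {
  n : R; m : R; h : R;
  n_pos : 0 < n; m_pos : 0 < m; mass_sum : 2 * n + m = 1; h_le : h <= -1 }.

Section ThreeBody.
Context {B : three_body}.

Definition a : R := theta_star m.
Definition kap : R := / sqrt (mu1 n).
(** The scale for which the two inner distances add up to the outer one: sin (a + th) + sin (a - th)
    = 2 sin a cos th. *)
Definition lam : R := kap / (2 * sin a).
Definition rmax : R := 4 / (7 * kap).

Lemma kap_pos : 0 < kap.
Proof.
apply Rinv_0_lt_compat, sqrt_lt_R0. unfold mu1. assert (H := n_pos). lra.
Qed.

Lemma tan_a : tan a = sqrt m.
Proof. unfold a, theta_star. apply tan_atan. Qed.

(** The upper bound comes from m < 1. It keeps a + th and a - th in [0, pi / 2], where sine
    increases and cosine is nonnegative; every comparison of the inner distances rests on this. *)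
Lemma a_bounds : 0 < a < PI / 4.
Proof.
assert (Hn := n_pos). assert (Hm := m_pos). assert (Hs := mass_sum).
unfold a, theta_star. rewrite <- atan_0, <- atan_1.
split; apply atan_increasing.
- apply sqrt_lt_R0; lra.
- rewrite <- sqrt_1. apply sqrt_lt_1; lra.
Qed.

Lemma a_lt : a < 4 / 5.
Proof. assert (H := a_bounds). assert (H' := PI_upper). lra. Qed.

Lemma sin_a_pos : 0 < sin a.
Proof. assert (H := a_bounds). apply sin_gt_0; lra. Qed.

Lemma lam_pos : 0 < lam.
Proof.
unfold lam. apply Rdiv_lt_0_compat; [apply kap_pos|]. assert (H := sin_a_pos). lra.
Qed.

Lemma rmax_pos : 0 < rmax.
Proof. unfold rmax. assert (H := kap_pos). apply Rdiv_lt_0_compat; lra. Qed.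

Lemma kap_rmax : kap * rmax = 4 / 7.
Proof. unfold rmax. assert (H := kap_pos). field. lra. Qed.

(* [q th] is cos^2 u for th = a sin u. *)
Definition q (th : R) : R := 1 - (th / a) ^ 2.
(* The distances are r * c12 th, r * c13 th and r * c23 th. *)
Definition c12 (th : R) : R := kap * cos th.
Definition c13 (th : R) : R := lam * sin (a + th).
Definition c23 (th : R) : R := lam * sin (a - th).
(* The weight [A_ij] is the analytic extension of q / c_ij to |th| = a. *)
Definition A12 (th : R) : R := q th / (kap * cos th).
Definition A13 (th : R) : R := (a - th) * xcsc (a + th) / (a ^ 2 * lam).
Definition A23 (th : R) : R := (a + th) * xcsc (a - th) / (a ^ 2 * lam).

(* Equal to r U cos^2 u for th = a sin u, |th| < a. *)
Definition F (r th : R) : R :=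
  n ^ 2 * (A12 th * xcot (r * c12 th))
  + n * m * (A13 th * xcot (r * c13 th) + A23 th * xcot (r * c23 th)).
(* The partial derivative of [F] with respect to r. *)
Definition D (r th : R) : R :=
  q th * (n ^ 2 * xcot1 (r * c12 th) + n * m * (xcot1 (r * c13 th) + xcot1 (r * c23 th))).
Definition dA12 (th : R) : R :=
  (- 2 * th / a ^ 2 * cos th + q th * sin th) / (kap * cos th ^ 2).
Definition dA13 (th : R) : R := (- xcsc (a + th) + (a - th) * xcsc1 (a + th)) / (a ^ 2 * lam).
Definition dA23 (th : R) : R := (xcsc (a - th) - (a + th) * xcsc1 (a - th)) / (a ^ 2 * lam).
(* The partial derivative of [F] with respect to th. *)
Definition Fth (r th : R) : R :=
  n ^ 2 * (dA12 th * xcot (r * c12 th) - A12 th * xcot1 (r * c12 th) * (r * (kap * sin th)))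
  + n * m * (dA13 th * xcot (r * c13 th) + A13 th * xcot1 (r * c13 th) * (r * (lam * cos (a + th)))
    + (dA23 th * xcot (r * c23 th) - A23 th * xcot1 (r * c23 th) * (r * (lam * cos (a - th))))).

Lemma c12_split th : c12 th = c13 th + c23 th.
Proof.
unfold c12, c13, c23, lam. rewrite sin_plus, sin_minus. field.
assert (H := sin_a_pos). lra.
Qed.

Lemma cos_pos_th th : Rabs th <= a -> 0 < cos th.
Proof.
intros H. apply Rabs_le_between in H. assert (Ha := a_bounds). apply cos_gt_0; lra.
Qed.

Lemma c12_pos th : Rabs th <= a -> 0 < c12 th.
Proof.
intros H. apply Rmult_lt_0_compat; [apply kap_pos|apply cos_pos_th, H].
Qed.

Lemma c12_le th : Rabs th <= a -> c12 th <= kap.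
Proof.
intros H. unfold c12. assert (H1 := kap_pos). assert (cos th <= 1) by apply COS_bound. nra.
Qed.

Lemma c13_nonneg th : Rabs th <= a -> 0 <= c13 th.
Proof.
intros H. apply Rabs_le_between in H. assert (Ha := a_bounds).
apply Rmult_le_pos; [left; apply lam_pos|apply sin_ge_0; lra].
Qed.

Lemma c23_nonneg th : Rabs th <= a -> 0 <= c23 th.
Proof.
intros H. apply Rabs_le_between in H. assert (Ha := a_bounds).
apply Rmult_le_pos; [left; apply lam_pos|apply sin_ge_0; lra].
Qed.

Lemma c13_pos th : Rabs th < a -> 0 < c13 th.
Proof.
intros H. apply Rabs_lt_between in H. assert (Ha := a_bounds).
apply Rmult_lt_0_compat; [apply lam_pos|apply sin_gt_0; lra].
Qed.

Lemma c23_pos th : Rabs th < a -> 0 < c23 th.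
Proof.
intros H. apply Rabs_lt_between in H. assert (Ha := a_bounds).
apply Rmult_lt_0_compat; [apply lam_pos|apply sin_gt_0; lra].
Qed.

Lemma arcs_lt_PI r th : Rabs th <= a -> 0 <= r -> r * c12 th < PI ->
  0 <= r * c12 th < PI /\ 0 <= r * c13 th < PI /\ 0 <= r * c23 th < PI.
Proof.
intros H Hr Hlt.
assert (H1 := c12_pos th H). assert (H2 := c13_nonneg th H). assert (H3 := c23_nonneg th H).
rewrite c12_split in *.
assert (0 <= r * c13 th) by (apply Rmult_le_pos; assumption).
assert (0 <= r * c23 th) by (apply Rmult_le_pos; assumption).
rewrite Rmult_plus_distr_l in *. lra.
Qed.

Lemma arcs_small r th : Rabs th <= a -> 0 <= r <= rmax ->
  0 <= r * c12 th <= 4 / 7 /\ 0 <= r * c13 th <= 4 / 7 /\ 0 <= r * c23 th <= 4 / 7.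
Proof.
intros H Hr.
assert (r * c12 th <= 4 / 7).
{ rewrite <- kap_rmax. assert (H1 := c12_le th H). assert (H2 := c12_pos th H). nra. }
assert (HP := PI2_3_2).
destruct (arcs_lt_PI r th H (proj1 Hr) ltac:(lra)) as [? [? ?]].
rewrite c12_split, Rmult_plus_distr_l in *. lra.
Qed.

Lemma A12_mult th : Rabs th <= a -> A12 th * c12 th = q th.
Proof.
intros H. assert (H1 := kap_pos). assert (H2 := cos_pos_th th H).
unfold A12, c12. field. lra.
Qed.

Lemma angles_lt_PI th : Rabs th <= a -> Rabs (a + th) < PI /\ Rabs (a - th) < PI.
Proof.
intros H. apply Rabs_le_between in H. assert (Ha := a_bounds).
split; apply Rabs_lt_between; lra.
Qed.

(** Since q = (a - th) (a + th) / a^2, the zero of q at th = - a matches the simple zero of [c13];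
    [A23] plays the same role at th = a. *)
Lemma A13_mult th : Rabs th <= a -> A13 th * c13 th = q th.
Proof.
intros H. assert (H1 := lam_pos). assert (Ha := a_bounds).
assert (H2 := sin_xcsc (a + th) (proj1 (angles_lt_PI th H))).
unfold A13, c13, q.
replace ((a - th) * xcsc (a + th) / (a ^ 2 * lam) * (lam * sin (a + th)))
  with ((a - th) * (sin (a + th) * xcsc (a + th)) / a ^ 2) by (field; lra).
rewrite H2. field. lra.
Qed.

Lemma A23_mult th : Rabs th <= a -> A23 th * c23 th = q th.
Proof.
intros H. assert (H1 := lam_pos). assert (Ha := a_bounds).
assert (H2 := sin_xcsc (a - th) (proj2 (angles_lt_PI th H))).
unfold A23, c23, q.
replace ((a + th) * xcsc (a - th) / (a ^ 2 * lam) * (lam * sin (a - th)))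
  with ((a + th) * (sin (a - th) * xcsc (a - th)) / a ^ 2) by (field; lra).
rewrite H2. field. lra.
Qed.

Lemma q_nonneg th : Rabs th <= a -> 0 <= q th <= 1.
Proof.
intros H. assert (Ha := a_bounds). unfold q.
assert (Rabs (th / a) <= 1).
{ unfold Rdiv. rewrite Rabs_mult, (Rabs_pos_eq (/ a)) by (left; apply Rinv_0_lt_compat; lra).
  apply Rmult_le_reg_r with a; [lra|]. rewrite Rmult_assoc, Rinv_l by lra. lra. }
apply Rabs_le_between in H0. split; nra.
Qed.

(** The upper bound is q <= cos th, which holds because a <= 1: 1 - (th / a)^2 <= 1 - th^2 / 2. *)
Lemma A12_bounds th : Rabs th <= a -> 0 <= A12 th <= / kap.
Proof.
intros H. assert (H1 := kap_pos). assert (H2 := cos_pos_th th H).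
assert (Hq := q_nonneg th H). assert (Ha := a_bounds). assert (Ha' := a_lt).
unfold A12. split.
- apply Rmult_le_pos; [lra|]. left. apply Rinv_0_lt_compat. nra.
- apply Rmult_le_reg_r with (kap * cos th); [nra|].
  replace (q th / (kap * cos th) * (kap * cos th)) with (q th) by (field; lra).
  replace (/ kap * (kap * cos th)) with (cos th) by (field; lra).
  eapply Rle_trans; [|apply cos_ge_quadratic].
  assert (Hth := pow2_ge_0 th).
  unfold q. assert (th ^ 2 <= (th / a) ^ 2); [|lra].
  replace (th ^ 2) with ((th / a) ^ 2 * a ^ 2) by (field; lra).
  assert (0 <= (th / a) ^ 2) by apply pow2_ge_0. assert (a ^ 2 <= 1) by nra. nra.
Qed.

(** Bounding both factors x / sin x by 2 leaves 2 (a - th) + 2 (a + th) = 4 a. The result is twice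
    the Euler value 4 / kap, the source of the factor 2 in [F_le]. *)
Lemma A_pair_bounds th : Rabs th <= a -> 0 <= A13 th /\ 0 <= A23 th /\ A13 th + A23 th <= 8 / kap.
Proof.
intros H. assert (H1 := lam_pos). assert (Ha := a_bounds). assert (Hk := kap_pos).
assert (Hs := sin_a_pos).
destruct (angles_lt_PI th H) as [P1 P2].
assert (HJ1 := xcsc_pos _ P1). assert (HJ2 := xcsc_pos _ P2).
apply Rabs_le_between in H.
assert (HJ1' := xcsc_le (a + th) ltac:(lra)). assert (HJ2' := xcsc_le (a - th) ltac:(lra)).
assert (Hal : 0 < a ^ 2 * lam) by (apply Rmult_lt_0_compat; [nra|lra]).
assert (Hi : 0 < / (a ^ 2 * lam)) by (apply Rinv_0_lt_compat; lra).
unfold A13, A23. split; [|split].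
- apply Rmult_le_pos; [apply Rmult_le_pos; lra|lra].
- apply Rmult_le_pos; [apply Rmult_le_pos; lra|lra].
- apply Rmult_le_reg_r with (a ^ 2 * lam); [exact Hal|].
  replace (((a - th) * xcsc (a + th) / (a ^ 2 * lam) + (a + th) * xcsc (a - th) / (a ^ 2 * lam))
    * (a ^ 2 * lam)) with ((a - th) * xcsc (a + th) + (a + th) * xcsc (a - th)) by (field; lra).
  replace (8 / kap * (a ^ 2 * lam)) with (4 * a * (a / sin a)) by (unfold lam; field; lra).
  assert (1 <= a / sin a).
  { rewrite <- xcsc_sin by lra. apply xcsc_ge_1; lra. }
  nra.
Qed.

(* The limit of r U on the Euler line as r -> 0. *)
Definition V0 : R := (n ^ 2 + 4 * (n * m)) / kap.

Lemma F_le r th : Rabs th <= a -> 0 <= r <= rmax -> F r th <= 2 * V0.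
Proof.
intros H Hr. assert (Hk := kap_pos). assert (Hn := n_pos). assert (Hm := m_pos).
assert (HP := PI2_3_2).
destruct (arcs_small r th H Hr) as [D1 [D2 D3]].
assert (K1 := xcot_le_1 (r * c12 th) ltac:(lra)). assert (K2 := xcot_le_1 (r * c13 th) ltac:(lra)).
assert (K3 := xcot_le_1 (r * c23 th) ltac:(lra)).
assert (B1 := A12_bounds th H). destruct (A_pair_bounds th H) as [B2 [B3 B4]].
unfold F, V0.
replace (2 * ((n ^ 2 + 4 * (n * m)) / kap)) with (n ^ 2 * (2 * / kap) + n * m * (8 / kap)) by (field; lra).
assert (0 < / kap) by (apply Rinv_0_lt_compat; lra).
apply Rplus_le_compat; apply Rmult_le_compat_l; nra.
Qed.

(** The weights of the two inner pairs suffice: x / sin x >= 1 gives (a - th) + (a + th) = 2 a, and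
    x cot x >= 1 / 2 up to 4 / 7. At a collision w^2 = 2 F, so this is what keeps w positive
    there. *)
Lemma F_lower : exists c, 0 < c /\
  forall r th, Rabs th <= a -> 0 <= r <= rmax -> c <= F r th.
Proof.
assert (Hl := lam_pos). assert (Hn := n_pos). assert (Hm := m_pos). assert (Ha := a_bounds).
exists (n * m * (/ (a * lam) / 2)). split.
{ apply Rmult_lt_0_compat; [nra|]. assert (0 < / (a * lam)); [|lra].
  apply Rinv_0_lt_compat; nra. }
intros r th H Hr.
destruct (arcs_small r th H Hr) as [D1 [D2 D3]].
assert (Hhalf : forall d, 0 <= d <= 4 / 7 -> / 2 <= xcot d).
{ intros d Hd. assert (K := xcot_ge_quadratic d ltac:(lra)). nra. }
assert (K1 := Hhalf _ D1). assert (K2 := Hhalf _ D2). assert (K3 := Hhalf _ D3).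
assert (B1 := A12_bounds th H). destruct (A_pair_bounds th H) as [B2 [B3 _]].
assert (B5 : / (a * lam) <= A13 th + A23 th).
{ apply Rabs_le_between in H. unfold A13, A23.
  assert (HJ1 := xcsc_ge_1 (a + th) ltac:(lra)). assert (HJ2 := xcsc_ge_1 (a - th) ltac:(lra)).
  assert (Hal : 0 < a ^ 2 * lam) by (apply Rmult_lt_0_compat; [nra|lra]).
  apply Rmult_le_reg_r with (a ^ 2 * lam); [exact Hal|].
  replace (((a - th) * xcsc (a + th) / (a ^ 2 * lam) + (a + th) * xcsc (a - th) / (a ^ 2 * lam))
    * (a ^ 2 * lam)) with ((a - th) * xcsc (a + th) + (a + th) * xcsc (a - th)) by (field; lra).
  replace (/ (a * lam) * (a ^ 2 * lam)) with a by (field; lra). nra. }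
unfold F.
assert (0 <= n ^ 2 * (A12 th * xcot (r * c12 th))).
{ apply Rmult_le_pos; [nra|]. apply Rmult_le_pos; nra. }
assert (n * m * (/ (a * lam) / 2) <= n * m * (A13 th * xcot (r * c13 th) + A23 th * xcot (r * c23 th))); [|lra].
apply Rmult_le_compat_l; [nra|].
assert (A13 th / 2 <= A13 th * xcot (r * c13 th)) by nra.
assert (A23 th / 2 <= A23 th * xcot (r * c23 th)) by nra.
lra.
Qed.

Definition regular (r th : R) : Prop := Rabs th <= a /\ 0 <= r /\ r * c12 th < PI.

Lemma regular_abs r th : regular r th ->
  Rabs (r * c12 th) < PI /\ Rabs (r * c13 th) < PI /\ Rabs (r * c23 th) < PI.
Proof.
intros [H1 [H2 H3]]. destruct (arcs_lt_PI r th H1 H2 H3) as [? [? ?]].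
rewrite !Rabs_pos_eq; lra.
Qed.

Lemma regular_small r th : Rabs th <= a -> 0 <= r <= rmax -> regular r th.
Proof.
intros H Hr. split; [exact H|split; [lra|]].
destruct (arcs_small r th H Hr) as [? _]. assert (HP := PI2_3_2). lra.
Qed.

(** * Continuity and derivatives of the regularized potential along paths *)

Section ContinuousPaths.
Context {T : UniformSpace} (r th : T -> R) (x : T).
Hypothesis r_cont : continuous r x.
Hypothesis th_cont : continuous th x.
Hypothesis reg : regular (r x) (th x).

Lemma continuous_path_arcs (f : R -> R) :
  (forall y, Rabs y < PI -> continuous f y) ->
  continuous (fun y => f (r y * c12 (th y))) x /\
  continuous (fun y => f (r y * c13 (th y))) x /\
  continuous (fun y => f (r y * c23 (th y))) x.
Proof.
intros Hf. destruct (regular_abs _ _ reg) as [R1 [R2 R3]].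
split; [|split]; apply (continuous_comp_real f); try (apply Hf; assumption);
  apply continuous_Rmult; try exact r_cont; apply (continuous_comp_real _ th); try exact th_cont;
  unfold c12, c13, c23; cont_deriv.
Qed.

Lemma continuous_path_A :
  continuous (fun y => A12 (th y)) x /\ continuous (fun y => A13 (th y)) x /\
  continuous (fun y => A23 (th y)) x.
Proof.
destruct reg as [Hth _]. assert (Ha := a_bounds). assert (Hl := lam_pos). assert (Hk := kap_pos).
assert (Hc := cos_pos_th _ Hth). destruct (angles_lt_PI _ Hth) as [H1 H2].
split; [|split]; apply (continuous_comp_real _ th); try exact th_cont; unfold A12, A13, A23, q;
  apply ex_derive_cont; auto_derive.
- nra.
- exists (xcsc1 (a + th x)); apply is_derive_xcsc, H1.
- exists (xcsc1 (a - th x)); apply is_derive_xcsc, H2.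
Qed.

Lemma continuous_path_dA :
  continuous (fun y => dA12 (th y)) x /\ continuous (fun y => dA13 (th y)) x /\
  continuous (fun y => dA23 (th y)) x.
Proof.
destruct reg as [Hth _]. assert (Ha := a_bounds). assert (Hl := lam_pos). assert (Hk := kap_pos).
assert (Hc := cos_pos_th _ Hth). destruct (angles_lt_PI _ Hth) as [H1 H2].
split; [|split]; apply (continuous_comp_real _ th); try exact th_cont; unfold dA12, dA13, dA23, q;
  apply ex_derive_cont; auto_derive.
- apply Rgt_not_eq; rewrite Rmult_1_r; apply Rmult_lt_0_compat; nra.
- repeat split; [exists (xcsc1 (a + th x)); apply is_derive_xcsc, H1
                |exists (xcsc2 (a + th x)); apply is_derive_xcsc1, H1].
- repeat split; [exists (xcsc1 (a - th x)); apply is_derive_xcsc, H2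
                |exists (xcsc2 (a - th x)); apply is_derive_xcsc1, H2].
Qed.

Lemma continuous_path_F : continuous (fun y => F (r y) (th y)) x.
Proof.
destruct (continuous_path_arcs xcot continuous_xcot) as [K1 [K2 K3]].
destruct continuous_path_A as [C1 [C2 C3]].
unfold F. apply continuous_Rplus; apply continuous_Rmult; try apply continuous_const.
- apply continuous_Rmult; assumption.
- apply continuous_Rplus; apply continuous_Rmult; assumption.
Qed.

Lemma continuous_path_q : continuous (fun y => q (th y)) x.
Proof.
apply (continuous_comp_real q); [exact th_cont|]. unfold q. cont_deriv.
Qed.

Lemma continuous_path_D : continuous (fun y => D (r y) (th y)) x.
Proof.
destruct (continuous_path_arcs xcot1 continuous_xcot1) as [K1 [K2 K3]].
unfold D. apply continuous_Rmult; [apply continuous_path_q|].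
apply continuous_Rplus; apply continuous_Rmult; try apply continuous_const; [assumption|].
apply continuous_Rplus; assumption.
Qed.

Lemma continuous_path_Fth : continuous (fun y => Fth (r y) (th y)) x.
Proof.
destruct (continuous_path_arcs xcot continuous_xcot) as [K1 [K2 K3]].
destruct (continuous_path_arcs xcot1 continuous_xcot1) as [L1 [L2 L3]].
destruct continuous_path_A as [C1 [C2 C3]].
destruct continuous_path_dA as [E1 [E2 E3]].
assert (G : forall f : R -> R, (forall t, ex_derive f t) -> continuous (fun y => r y * f (th y)) x).
{ intros f Hf. apply continuous_Rmult; [exact r_cont|].
  apply (continuous_comp_real f); [exact th_cont|]. apply ex_derive_cont, Hf. }
unfold Fth. apply continuous_Rplus; (apply continuous_Rmult; [apply continuous_const|]).
- apply continuous_Rminus; [apply continuous_Rmult; assumption|].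
  apply continuous_Rmult; [apply continuous_Rmult; assumption|].
  apply (G (fun t => kap * sin t)). intros t. auto_derive; trivial.
- apply continuous_Rplus; [apply continuous_Rplus|apply continuous_Rminus];
    try (apply continuous_Rmult; assumption);
    (apply continuous_Rmult; [apply continuous_Rmult; assumption|]).
  + apply (G (fun t => lam * cos (a + t))). intros t. auto_derive; trivial.
  + apply (G (fun t => lam * cos (a - t))). intros t. auto_derive; trivial.
Qed.

End ContinuousPaths.

Section DerivativePaths.
Variables (r th : R -> R) (u dr dth : R).
Hypothesis r_der : is_derive r u dr.
Hypothesis th_der : is_derive th u dth.
Hypothesis reg : regular (r u) (th u).

Lemma is_derive_arcs :
  is_derive (fun y => r y * c12 (th y)) u (dr * c12 (th u) - r u * (kap * sin (th u)) * dth) /\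
  is_derive (fun y => r y * c13 (th y)) u (dr * c13 (th u) + r u * (lam * cos (a + th u)) * dth) /\
  is_derive (fun y => r y * c23 (th y)) u (dr * c23 (th u) - r u * (lam * cos (a - th u)) * dth).
Proof.
split; [|split]; (evar_last; [apply is_derive_Rmult; [exact r_der|];
  apply (is_derive_comp_real _ th); [|exact th_der]|]).
- unfold c12. auto_derive; [trivial|reflexivity].
- simpl. ring.
- unfold c13. auto_derive; [trivial|reflexivity].
- simpl. ring.
- unfold c23. auto_derive; [trivial|reflexivity].
- simpl. unfold Rminus. ring.
Qed.

Lemma is_derive_A :
  is_derive A12 (th u) (dA12 (th u)) /\ is_derive A13 (th u) (dA13 (th u)) /\
  is_derive A23 (th u) (dA23 (th u)).
Proof.
destruct reg as [Hth _]. assert (Ha := a_bounds). assert (Hl := lam_pos). assert (Hk := kap_pos).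
assert (Hc := cos_pos_th _ Hth). destruct (angles_lt_PI _ Hth) as [H1 H2].
apply is_derive_xcsc in H1. apply is_derive_xcsc in H2.
unfold A12, A13, A23, dA12, dA13, dA23, q.
split; [|split]; auto_derive.
- nra.
- field. lra.
- exists (xcsc1 (a + th u)); exact H1.
- rewrite (is_derive_unique (fun x : R => xcsc x) _ _ H1). field. lra.
- exists (xcsc1 (a - th u)); exact H2.
- unfold Rminus in *. rewrite (is_derive_unique (fun x : R => xcsc x) _ _ H2). field. lra.
Qed.

Lemma is_derive_F : is_derive (fun y => F (r y) (th y)) u (D (r u) (th u) * dr + Fth (r u) (th u) * dth).
Proof.
destruct (regular_abs _ _ reg) as [R1 [R2 R3]].
destruct is_derive_arcs as [E1 [E2 E3]]. destruct is_derive_A as [B1 [B2 B3]].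
assert (Hth := proj1 reg).
assert (G1 := is_derive_Rscal (n ^ 2) _ _ _ (is_derive_Rmult (fun y => A12 (th y)) (fun y => xcot (r y * c12 (th y))) u _ _
  (is_derive_comp_real A12 th u _ _ B1 th_der)
  (is_derive_comp_real xcot (fun y => r y * c12 (th y)) u _ _ (is_derive_xcot _ R1) E1))).
assert (G2 := is_derive_Rmult (fun y => A13 (th y)) (fun y => xcot (r y * c13 (th y))) u _ _
  (is_derive_comp_real A13 th u _ _ B2 th_der)
  (is_derive_comp_real xcot (fun y => r y * c13 (th y)) u _ _ (is_derive_xcot _ R2) E2)).
assert (G3 := is_derive_Rmult (fun y => A23 (th y)) (fun y => xcot (r y * c23 (th y))) u _ _
  (is_derive_comp_real A23 th u _ _ B3 th_der)
  (is_derive_comp_real xcot (fun y => r y * c23 (th y)) u _ _ (is_derive_xcot _ R3) E3)).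
assert (G4 := is_derive_Rscal (n * m) _ _ _ (is_derive_Rplus
  (fun y => A13 (th y) * xcot (r y * c13 (th y))) (fun y => A23 (th y) * xcot (r y * c23 (th y))) u _ _ G2 G3)).
assert (G5 := is_derive_Rplus (fun y => n ^ 2 * (A12 (th y) * xcot (r y * c12 (th y))))
  (fun y => n * m * (A13 (th y) * xcot (r y * c13 (th y)) + A23 (th y) * xcot (r y * c23 (th y)))) u _ _ G1 G4).
unfold F. evar_last; [exact G5|].
replace (D (r u) (th u)) with
  (n ^ 2 * (A12 (th u) * c12 (th u) * xcot1 (r u * c12 (th u)))
   + n * m * (A13 (th u) * c13 (th u) * xcot1 (r u * c13 (th u))
              + A23 (th u) * c23 (th u) * xcot1 (r u * c23 (th u)))).
- unfold Fth. ring.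
- rewrite A12_mult, A13_mult, A23_mult by exact Hth. unfold D. ring.
Qed.

End DerivativePaths.

(** * Monotonicity properties of the potential *)

Definition Upot (r th : R) : R :=
  n ^ 2 * cot (r * c12 th) + n * m * (cot (r * c13 th) + cot (r * c23 th)).

Lemma arcs_pos r th : Rabs th < a -> 0 < r -> r * c12 th < PI ->
  0 < r * c12 th < PI /\ 0 < r * c13 th < PI /\ 0 < r * c23 th < PI.
Proof.
intros H Hr Hlt.
assert (H1 := c12_pos th (Rlt_le _ _ H)). assert (H2 := c13_pos th H). assert (H3 := c23_pos th H).
rewrite c12_split in *.
assert (0 < r * c13 th) by (apply Rmult_lt_0_compat; assumption).
assert (0 < r * c23 th) by (apply Rmult_lt_0_compat; assumption).
rewrite Rmult_plus_distr_l in *. lra.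
Qed.

Lemma arcs_pos_small r th : Rabs th < a -> 0 < r <= rmax ->
  0 < r * c12 th <= 4 / 7 /\ 0 < r * c13 th <= 4 / 7 /\ 0 < r * c23 th <= 4 / 7.
Proof.
intros H Hr.
destruct (arcs_small r th (Rlt_le _ _ H) ltac:(lra)) as [? [? ?]].
assert (HP := PI2_3_2).
destruct (arcs_pos r th H ltac:(lra) ltac:(lra)) as [? [? ?]]. lra.
Qed.

Lemma F_Upot r th : Rabs th < a -> 0 < r -> r * c12 th < PI ->
  F r th = r * Upot r th * q th.
Proof.
intros H Hr Hlt. destruct (arcs_pos r th H Hr Hlt) as [D1 [D2 D3]].
assert (H' := Rlt_le _ _ H).
unfold F, Upot. rewrite !xcot_cot by assumption. unfold cot.
replace (r * (n ^ 2 * (cos (r * c12 th) / sin (r * c12 th)) +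
  n * m * (cos (r * c13 th) / sin (r * c13 th) + cos (r * c23 th) / sin (r * c23 th))) * q th)
with (r * (n ^ 2 * (cos (r * c12 th) / sin (r * c12 th)) * q th +
  n * m * (cos (r * c13 th) / sin (r * c13 th) * q th + cos (r * c23 th) / sin (r * c23 th) * q th)))
  by ring.
rewrite <- (A12_mult th H') at 1. rewrite <- (A13_mult th H') at 1. rewrite <- (A23_mult th H') at 1.
ring.
Qed.

(* The mass-weighted sum of [g] over the pairs is 2 U + r U_r. *)
Definition g (d : R) : R := 2 * cot d - d / sin d ^ 2.
Definition Gam (r th : R) : R :=
  2 * h + (n ^ 2 * g (r * c12 th) + n * m * (g (r * c13 th) + g (r * c23 th))).

Definition g1 (d : R) : R := (2 * d * cos d / sin d - 3) / sin d ^ 2.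

Lemma is_derive_g d : 0 < d < PI -> is_derive g d (g1 d).
Proof.
intros Hd. assert (Hs : 0 < sin d) by (apply sin_gt_0; lra).
unfold g, g1.
assert (E := is_derive_cot d ltac:(lra)).
evar_last.
- apply is_derive_Rminus; [apply is_derive_Rscal; exact E|].
  auto_derive; [|reflexivity]. rewrite Rmult_1_r. nra.
- field. lra.
Qed.

(** Since d cot d <= 1, the numerator is at most 2 - 3. *)
Lemma g1_nonpos d : 0 < d < PI -> g1 d <= 0.
Proof.
intros Hd. assert (Hs : 0 < sin d) by (apply sin_gt_0; lra).
assert (K := xcot_le_1 d ltac:(lra)). rewrite xcot_cot in K by exact Hd.
unfold g1. assert (0 < / sin d ^ 2) by (apply Rinv_0_lt_compat; nra).
unfold Rdiv in *. nra.
Qed.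

(** Convexity of [g]. The numerator of its second derivative splits as 8 = 6 + 2: d cos d <= sin d
    handles d cos^2 d, and d sin d <= d^2 <= cos d, valid up to 4 / 7, handles d sin^2 d. *)
Lemma g1_monotone x y : 0 < x <= y -> y <= 4 / 7 -> g1 x <= g1 y.
Proof.
intros Hx Hy. assert (HP := PI2_3_2).
apply (nondecreasing_of_derive g1 (fun d =>
  (8 * (cos d * sin d) - 6 * (d * cos d ^ 2) - 2 * (d * sin d ^ 2)) / sin d ^ 4)); [lra| | |].
- intros d Hd. assert (Hs : 0 < sin d) by (apply sin_gt_0; lra).
  unfold g1. auto_derive.
  + split; [lra|]. rewrite Rmult_1_r. split; [nra|trivial].
  + field. lra.
- intros d Hd. assert (Hs : 0 < sin d) by (apply sin_gt_0; lra).
  apply ex_derive_cont. unfold g1. auto_derive. rewrite Rmult_1_r.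
  split; [lra|]. split; [nra|trivial].
- intros d Hd. assert (Hs : 0 < sin d) by (apply sin_gt_0; lra).
  assert (K := xcot_le_1 d ltac:(lra)). rewrite xcot_cot in K by lra.
  assert (Hc := cos_ge_quadratic d). assert (Hs' := sin_le_id d ltac:(lra)).
  assert (Hdc : d * cos d <= sin d).
  { apply Rmult_le_compat_r with (r := sin d) in K; [|lra].
    replace (d * (cos d / sin d) * sin d) with (d * cos d) in K by (field; lra). lra. }
  assert (0 < sin d ^ 4) by (apply pow_lt, Hs).
  apply Rmult_le_pos; [|left; apply Rinv_0_lt_compat; lra].
  assert (0 < cos d) by nra.
  assert (d * cos d ^ 2 <= cos d * sin d) by nra.
  assert (d * sin d ^ 2 <= cos d * sin d).
  { assert (d * sin d <= cos d); [|nra]. nra. }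
  nra.
Qed.

Lemma g_decreasing x y : 0 < x <= y -> y < PI -> g y <= g x.
Proof.
intros Hx Hy.
assert (A := nondecreasing_of_derive (fun t => - g t) (fun t => - g1 t) x y ltac:(lra)).
cbv beta in A. assert (- g x <= - g y); [|lra]. apply A.
- intros t Ht. apply (is_derive_opp g), is_derive_g. lra.
- intros t Ht. apply (continuous_opp g). eapply is_derive_continuous, is_derive_g. lra.
- intros t Ht. assert (g1 t <= 0) by (apply g1_nonpos; lra). lra.
Qed.

Lemma Rabs_lt_a th : 0 <= th < a -> Rabs th < a.
Proof. intros H. rewrite Rabs_pos_eq; lra. Qed.

Lemma cos_shift_order th : 0 <= th < a -> 0 <= cos (a + th) <= cos (a - th).
Proof.
intros H. assert (Ha := a_bounds). split; [apply cos_ge_0; lra|].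
apply cos_decr_1; lra.
Qed.

Lemma arcs_order r th : 0 <= th < a -> 0 < r -> r * c23 th <= r * c13 th.
Proof.
intros H Hr. apply Rmult_le_compat_l; [lra|].
apply Rmult_le_compat_l; [left; apply lam_pos|].
assert (Ha := a_bounds). apply sin_incr_1; lra.
Qed.

Definition dGam (r t : R) : R :=
  n ^ 2 * (g1 (r * c12 t) * (- (r * (kap * sin t))))
  + n * m * (g1 (r * c13 t) * (r * (lam * cos (a + t))) + g1 (r * c23 t) * (- (r * (lam * cos (a - t))))).

(** As th grows, the outer distance shrinks, which raises the decreasing [g]. Of the inner ones, the
    smaller shrinks and the larger grows; convexity makes [g] steeper at the smaller, which moreover
    moves faster because cos (a - th) >= cos (a + th). *)
Lemma Gam_monotone_th r th th' : 0 < r <= rmax -> 0 <= th <= th' -> th' < a ->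
  Gam r th <= Gam r th'.
Proof.
intros Hr Hth Hth'. assert (HP := PI2_3_2).
assert (HD : forall t, 0 <= t < a -> is_derive (Gam r) t (dGam r t)).
{ intros t Ht. destruct (arcs_pos_small r t (Rabs_lt_a t Ht) Hr) as [D1 [D2 D3]].
  assert (Hcomp : forall c dc, is_derive c t dc -> 0 < r * c t < PI ->
    is_derive (fun t => g (r * c t)) t (g1 (r * c t) * (r * dc))).
  { intros c dc Hc Hp. apply (is_derive_comp_real g (fun t => r * c t)).
    - apply is_derive_g, Hp.
    - apply is_derive_Rscal, Hc. }
  assert (E1 : is_derive c12 t (kap * - sin t)) by (unfold c12; auto_derive; [trivial|ring]).
  assert (E2 : is_derive c13 t (lam * cos (a + t))) by (unfold c13; auto_derive; [trivial|ring]).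
  assert (E3 : is_derive c23 t (- (lam * cos (a - t)))).
  { unfold c23; auto_derive; [trivial|unfold Rminus; ring]. }
  apply Hcomp in E1; [|lra]. apply Hcomp in E2; [|lra]. apply Hcomp in E3; [|lra].
  unfold Gam. evar_last.
  - apply is_derive_Rplus; [apply (is_derive_const (V := R_NormedModule))|].
    apply (is_derive_Rplus (fun t => n ^ 2 * g (r * c12 t))
      (fun t => n * m * (g (r * c13 t) + g (r * c23 t)))).
    + apply is_derive_Rscal. exact E1.
    + apply is_derive_Rscal. apply is_derive_Rplus; [exact E2|exact E3].
  - unfold dGam, zero; simpl. ring. }
apply (nondecreasing_of_derive (Gam r) (dGam r)); [lra| | |].
- intros t Ht. apply HD; lra.
- intros t Ht. eapply is_derive_continuous, HD. lra.
- intros t Ht. unfold dGam.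
  destruct (arcs_pos_small r t (Rabs_lt_a t ltac:(lra)) Hr) as [D1 [D2 D3]].
  assert (G1 := g1_nonpos (r * c12 t) ltac:(lra)). assert (G2 := g1_nonpos (r * c13 t) ltac:(lra)).
  assert (G3 := g1_monotone _ _ (conj (proj1 D3) (arcs_order r t ltac:(lra) ltac:(lra))) (proj2 D2)).
  assert (Hc := cos_shift_order t ltac:(lra)).
  assert (Hs : 0 <= sin t). { assert (Ha := a_bounds). apply sin_ge_0; lra. }
  assert (Hk := kap_pos). assert (Hl := lam_pos). assert (Hn := n_pos). assert (Hm := m_pos).
  set (p := r * lam). assert (0 < p) by (unfold p; nra).
  replace (g1 (r * c13 t) * (r * (lam * cos (a + t))) + g1 (r * c23 t) * (- (r * (lam * cos (a - t)))))
    with (p * (g1 (r * c13 t) * cos (a + t) - g1 (r * c23 t) * cos (a - t))) by (unfold p; ring).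
  set (x := g1 (r * c13 t)) in *. set (y := g1 (r * c23 t)) in *. clearbody x y p.
  assert (0 <= x * cos (a + t) - y * cos (a - t)) by nra.
  apply Rplus_le_le_0_compat.
  + apply Rmult_le_pos; [nra|].
    replace (g1 (r * c12 t) * - (r * (kap * sin t))) with ((- g1 (r * c12 t)) * (r * (kap * sin t))) by ring.
    apply Rmult_le_pos; [lra|]. apply Rmult_le_pos; [lra|]. apply Rmult_le_pos; lra.
  + apply Rmult_le_pos; [nra|]. apply Rmult_le_pos; lra.
Qed.

Lemma Gam_monotone_r r r' th : 0 < r' <= r -> r <= rmax -> 0 <= th < a -> Gam r th <= Gam r' th.
Proof.
intros Hr Hr' Hth. assert (HP := PI2_3_2).
destruct (arcs_pos_small r th (Rabs_lt_a th Hth) ltac:(lra)) as [D1 [D2 D3]].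
destruct (arcs_pos_small r' th (Rabs_lt_a th Hth) ltac:(lra)) as [D1' [D2' D3']].
assert (0 < c12 th /\ 0 < c13 th /\ 0 < c23 th) as [C1 [C2 C3]].
{ assert (Ht := Rabs_lt_a th Hth). repeat split; [apply c12_pos; lra|apply c13_pos; lra|apply c23_pos; lra]. }
assert (G1 := g_decreasing (r' * c12 th) (r * c12 th) ltac:(nra) ltac:(lra)).
assert (G2 := g_decreasing (r' * c13 th) (r * c13 th) ltac:(nra) ltac:(lra)).
assert (G3 := g_decreasing (r' * c23 th) (r * c23 th) ltac:(nra) ltac:(lra)).
assert (Hn := n_pos). assert (Hm := m_pos).
unfold Gam. apply Rplus_le_compat_l, Rplus_le_compat; apply Rmult_le_compat_l; nra.
Qed.

Lemma Gam_monotone r th r' th' : 0 < r' <= r -> r <= rmax -> 0 <= th <= th' -> th' < a ->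
  Gam r th <= Gam r' th'.
Proof.
intros. apply Rle_trans with (Gam r th').
- apply Gam_monotone_th; lra.
- apply Gam_monotone_r; lra.
Qed.

Definition Ur (r th : R) : R :=
  - (n ^ 2 * (c12 th * / sin (r * c12 th) ^ 2)
     + n * m * (c13 th * / sin (r * c13 th) ^ 2 + c23 th * / sin (r * c23 th) ^ 2)).
Definition Uth (r th : R) : R :=
  n ^ 2 * (/ sin (r * c12 th) ^ 2 * (r * kap * sin th))
  + n * m * (r * lam * (/ sin (r * c23 th) ^ 2 * cos (a - th) - / sin (r * c13 th) ^ 2 * cos (a + th))).

Lemma is_derive_Upot (r th : R -> R) (u dr dth : R) :
  is_derive r u dr -> is_derive th u dth ->
  Rabs (th u) < a -> 0 < r u -> r u * c12 (th u) < PI ->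
  is_derive (fun y => Upot (r y) (th y)) u (Ur (r u) (th u) * dr + Uth (r u) (th u) * dth).
Proof.
intros Hr Hth H1 H2 H3.
destruct (arcs_pos (r u) (th u) H1 H2 H3) as [D1 [D2 D3]].
destruct (is_derive_arcs r th u dr dth Hr Hth) as [E1 [E2 E3]].
assert (S1 : 0 < sin (r u * c12 (th u))) by (apply sin_gt_0; lra).
assert (S2 : 0 < sin (r u * c13 (th u))) by (apply sin_gt_0; lra).
assert (S3 : 0 < sin (r u * c23 (th u))) by (apply sin_gt_0; lra).
assert (T1 := is_derive_comp_real cot (fun y => r y * c12 (th y)) u _ _
  (is_derive_cot _ (Rgt_not_eq _ _ S1)) E1).
assert (T2 := is_derive_comp_real cot (fun y => r y * c13 (th y)) u _ _
  (is_derive_cot _ (Rgt_not_eq _ _ S2)) E2).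
assert (T3 := is_derive_comp_real cot (fun y => r y * c23 (th y)) u _ _
  (is_derive_cot _ (Rgt_not_eq _ _ S3)) E3).
unfold Upot. evar_last.
- apply (is_derive_Rplus (fun y => n ^ 2 * cot (r y * c12 (th y)))
    (fun y => n * m * (cot (r y * c13 (th y)) + cot (r y * c23 (th y))))).
  + apply is_derive_Rscal. exact T1.
  + apply is_derive_Rscal. apply is_derive_Rplus; [exact T2|exact T3].
- unfold Ur, Uth. ring.
Qed.

Lemma r_Ur r th : Rabs th < a -> 0 < r -> r * c12 th < PI ->
  q th * (Upot r th + r * Ur r th) = D r th.
Proof.
intros H1 H2 H3. destruct (arcs_pos r th H1 H2 H3) as [D1 [D2 D3]].
unfold D. rewrite !xcot1_cot by assumption. unfold Upot, Ur, cot, Rdiv. ring.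
Qed.

Lemma Gam_U r th : Gam r th = 2 * h + 2 * Upot r th + r * Ur r th.
Proof. unfold Gam, Upot, Ur, g, Rdiv. ring. Qed.

(** The closer pair m2, m3 dominates: its factor 1 / sin^2 and its cosine are both the larger ones.
    Hence the torque always drives th towards that collision. *)
Lemma Uth_nonneg r th : 0 < r <= rmax -> 0 <= th < a -> 0 <= Uth r th.
Proof.
intros Hr Hth. assert (HP := PI2_3_2).
destruct (arcs_pos_small r th (Rabs_lt_a th Hth) Hr) as [D1 [D2 D3]].
assert (S1 : 0 < sin (r * c12 th)) by (apply sin_gt_0; lra).
assert (S2 : 0 < sin (r * c13 th)) by (apply sin_gt_0; lra).
assert (S3 : 0 < sin (r * c23 th)) by (apply sin_gt_0; lra).
assert (S4 : sin (r * c23 th) <= sin (r * c13 th)).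
{ apply sin_incr_1; try lra. apply arcs_order; lra. }
assert (I2 : 0 < / sin (r * c13 th) ^ 2) by (apply Rinv_0_lt_compat; nra).
assert (I3 : / sin (r * c13 th) ^ 2 <= / sin (r * c23 th) ^ 2).
{ apply Rinv_le_contravar; nra. }
assert (I1 : 0 < / sin (r * c12 th) ^ 2) by (apply Rinv_0_lt_compat; nra).
assert (Hc := cos_shift_order th Hth).
assert (Hs : 0 <= sin th). { assert (Ha := a_bounds). apply sin_ge_0; lra. }
assert (Hk := kap_pos). assert (Hl := lam_pos). assert (Hn := n_pos). assert (Hm := m_pos).
unfold Uth. apply Rplus_le_le_0_compat.
- apply Rmult_le_pos; [nra|]. apply Rmult_le_pos; [lra|]. apply Rmult_le_pos; [nra|lra].
- apply Rmult_le_pos; [nra|]. apply Rmult_le_pos; [nra|]. nra.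
Qed.

Lemma Upot_monotone_th r th th' : 0 < r <= rmax -> 0 <= th <= th' -> th' < a ->
  Upot r th <= Upot r th'.
Proof.
intros Hr Hth Hth'. assert (HP := PI2_3_2).
assert (HD : forall t, 0 <= t < a -> is_derive (Upot r) t (Uth r t)).
{ intros t Ht. destruct (arcs_pos_small r t (Rabs_lt_a t Ht) Hr) as [D1 _].
  evar_last.
  - apply (is_derive_Upot (fun _ => r) (fun t => t) t 0 1).
    + apply (is_derive_const (V := R_NormedModule)).
    + apply (is_derive_id (K := R_AbsRing)).
    + apply Rabs_lt_a, Ht.
    + lra.
    + lra.
  - ring. }
apply (nondecreasing_of_derive (Upot r) (Uth r)); [lra| | |].
- intros t Ht. apply HD; lra.
- intros t Ht. eapply is_derive_continuous, HD. lra.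
- intros t Ht. apply Uth_nonneg; lra.
Qed.

(* The configuration th = 0 is an equilibrium of the shape potential: by symmetry [Uth] is a
   difference of two values of one function, at a - th and a + th. *)
Lemma Uth_linear rho : 0 < rho -> exists K, 0 < K /\
  forall r th, rho <= r <= rmax -> 0 <= th <= a / 2 -> Uth r th <= K * th.
Proof.
intros Hrho. assert (HP := PI2_3_2). assert (Ha := a_bounds).
assert (Hk := kap_pos). assert (Hl := lam_pos). assert (Hn := n_pos). assert (Hm := m_pos).
assert (Hsa : 0 < sin (a / 2)) by (apply sin_gt_0; lra).
assert (Hca : 0 < cos a) by (apply cos_gt_0; lra).
destruct (Rle_dec rho rmax) as [Hrm|Hrm].
2:{ exists 1. split; [lra|]. intros; lra. }
assert (Hlow : 0 < rho * (lam * sin (a / 2)) <= 4 / 7).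
{ split; [apply Rmult_lt_0_compat; [lra|apply Rmult_lt_0_compat; lra]|].
  destruct (arcs_small rho (- (a / 2)) ltac:(rewrite Rabs_left; lra) ltac:(lra)) as [_ [H _]].
  unfold c13 in H. replace (a + - (a / 2)) with (a / 2) in H by field. lra. }
(* For th <= a / 2 both angles a - th and a + th lie in [a / 2, 3 a / 2], so [d0] bounds the inner
   distances from below, and s below bounds every reciprocal sine. *)
set (d0 := rho * (lam * sin (a / 2))) in *.
assert (Hd0 : 0 < sin d0) by (apply sin_gt_0; lra).
set (s := / sin d0).
assert (Hs : 0 < s) by (apply Rinv_0_lt_compat, Hd0).
assert (Hbig : forall d, d0 <= d <= 4 / 7 -> 0 < / sin d <= s).
{ intros d Hd. assert (0 < sin d) by (apply sin_gt_0; lra).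
  split; [apply Rinv_0_lt_compat; assumption|].
  apply Rinv_le_contravar; [assumption|]. apply sin_incr_1; lra. }
(* Bounds - dY, with sines and cosines replaced by 1; the two terms come from differentiating the
   cosine and the factor 1 / sin^2 of Y. *)
set (KY := s ^ 2 + 2 * (rmax * lam) * s ^ 3).
assert (Hrmx := rmax_pos).
assert (HKY : 0 < KY).
{ unfold KY. apply Rplus_lt_0_compat; [apply pow_lt, Hs|].
  apply Rmult_lt_0_compat; [nra|apply pow_lt, Hs]. }
exists (n ^ 2 * (s ^ 2 * (rmax * kap)) + n * m * (rmax * lam * (2 * KY))).
split.
{ assert (0 < n ^ 2) by nra. assert (0 < s ^ 2) by nra.
  assert (0 < rmax * kap) by nra. assert (0 < rmax * lam) by nra.
  apply Rplus_lt_0_compat; (apply Rmult_lt_0_compat; [nra|apply Rmult_lt_0_compat; lra]). }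
intros r th Hr Hth.
assert (Harc : forall y, a / 2 <= y <= 3 * a / 2 -> d0 <= r * (lam * sin y) <= 4 / 7).
{ intros y Hy. split.
  - apply Rmult_le_compat; [lra|nra|lra|]. apply Rmult_le_compat_l; [lra|].
    apply sin_incr_1; lra.
  - destruct (arcs_small r (y - a) ltac:(apply Rabs_le_between; lra) ltac:(lra)) as [_ [H _]].
    unfold c13 in H. replace (a + (y - a)) with y in H by ring. lra. }
set (Y := fun y => cos y * / sin (r * (lam * sin y)) ^ 2).
set (dY := fun y => - sin y * / sin (r * (lam * sin y)) ^ 2
   - 2 * cos y * cos (r * (lam * sin y)) * (r * lam * cos y) * (/ sin (r * (lam * sin y))) ^ 3).
assert (HdY : forall y, a / 2 <= y <= 3 * a / 2 -> is_derive Y y (dY y)).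
{ intros y Hy. specialize (Harc y Hy).
  assert (0 < sin (r * (lam * sin y))) by (apply sin_gt_0; lra).
  unfold Y, dY. auto_derive; [rewrite Rmult_1_r; nra|]. field. lra. }
assert (HbY : forall y, a / 2 <= y <= 3 * a / 2 -> - KY <= dY y).
{ intros y Hy. specialize (Harc y Hy). specialize (Hbig _ Harc).
  unfold dY, KY. rewrite <- pow_inv.
  set (t := / sin (r * (lam * sin y))) in *.
  assert (Hsy : 0 <= sin y <= 1). { split; [apply sin_ge_0; lra|apply SIN_bound]. }
  assert (Hcy : 0 <= cos y <= 1). { split; [apply cos_ge_0; lra|apply COS_bound]. }
  assert (Hcd : 0 <= cos (r * (lam * sin y)) <= 1). { split; [apply cos_ge_0; lra|apply COS_bound]. }
  set (cd := cos (r * (lam * sin y))) in *. clearbody cd t.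
  assert (Ht2 : t ^ 2 <= s ^ 2) by nra.
  assert (Ht3 : t ^ 3 <= s ^ 3) by (apply pow_incr; lra).
  assert (0 <= t ^ 3) by (apply pow_le; lra).
  assert (sin y * t ^ 2 <= s ^ 2) by nra.
  assert (H3 : 0 <= cos y * cd * cos y <= 1).
  { assert (0 <= cos y * cd <= 1) by nra. nra. }
  assert (H4 : 0 <= r * lam <= rmax * lam) by nra.
  assert (H5 : (cos y * cd * cos y) * (r * lam) <= rmax * lam) by nra.
  assert (H5' : 0 <= (cos y * cd * cos y) * (r * lam)) by nra.
  assert (H6 : ((cos y * cd * cos y) * (r * lam)) * t ^ 3 <= (rmax * lam) * s ^ 3).
  { apply Rmult_le_compat; lra. }
  lra. }
assert (HY : Y (a - th) - Y (a + th) <= KY * (2 * th)).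
{ assert (H := nondecreasing_of_derive (fun y => Y y + KY * y) (fun y => dY y + KY) (a - th) (a + th) ltac:(lra)).
  cbv beta in H. assert (Y (a - th) + KY * (a - th) <= Y (a + th) + KY * (a + th)); [|lra].
  apply H.
  - intros y Hy. apply is_derive_Rplus; [apply HdY; lra|]. auto_derive; [trivial|ring].
  - intros y Hy. apply continuous_Rplus; [eapply is_derive_continuous, HdY; lra|].
    cont_deriv.
  - intros y Hy. specialize (HbY y ltac:(lra)). lra. }
unfold Uth.
assert (Hst : 0 <= sin th <= th). { split; [apply sin_ge_0; lra|apply sin_le_id; lra]. }
assert (H12 : d0 <= r * c12 th <= 4 / 7).
{ destruct (arcs_small r th ltac:(rewrite Rabs_pos_eq; lra) ltac:(lra)) as [D1 [D2 D3]].
  split; [|lra]. destruct (Harc (a - th) ltac:(lra)) as [D4 _].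
  rewrite c12_split, Rmult_plus_distr_l. unfold c23 at 1. lra. }
assert (B12 := Hbig _ H12).
assert (T1 : / sin (r * c12 th) ^ 2 * (r * kap * sin th) <= s ^ 2 * (rmax * kap) * th).
{ rewrite <- pow_inv. set (t := / sin (r * c12 th)) in *. clearbody t.
  replace (s ^ 2 * (rmax * kap) * th) with (s ^ 2 * (rmax * kap * th)) by ring.
  assert (0 <= r * kap <= rmax * kap) by nra.
  apply Rmult_le_compat; [nra| |nra|].
  - apply Rmult_le_pos; lra.
  - apply Rmult_le_compat; lra. }
assert (T2 : r * lam * (/ sin (r * c23 th) ^ 2 * cos (a - th) - / sin (r * c13 th) ^ 2 * cos (a + th))
   <= rmax * lam * (2 * KY) * th).
{ unfold c23, c13.
  replace (/ sin (r * (lam * sin (a - th))) ^ 2 * cos (a - th) -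
     / sin (r * (lam * sin (a + th))) ^ 2 * cos (a + th)) with (Y (a - th) - Y (a + th)) by (unfold Y; ring).
  assert (0 <= r * lam <= rmax * lam) by nra.
  apply Rle_trans with (r * lam * (KY * (2 * th))); [apply Rmult_le_compat_l; lra|].
  replace (rmax * lam * (2 * KY) * th) with (rmax * lam * (KY * (2 * th))) by ring.
  apply Rmult_le_compat_r; [|lra]. apply Rmult_le_pos; lra. }
rewrite Rmult_plus_distr_r, !(Rmult_assoc _ _ th).
apply Rplus_le_compat; (rewrite (Rmult_assoc (n * m)) || idtac); apply Rmult_le_compat_l; nra.
Qed.

Lemma q_0 : q 0 = 1.
Proof. unfold q. assert (H := a_bounds). field. lra. Qed.

Lemma Euler_values : A12 0 = / kap /\ A13 0 + A23 0 = 4 / kap.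
Proof.
assert (Ha := a_bounds). assert (Hk := kap_pos). assert (Hs := sin_a_pos).
unfold A12, A13, A23. rewrite q_0, cos_0, Rplus_0_r, Rminus_0_r, xcsc_sin by lra.
split; [field; lra|]. unfold lam. field. lra.
Qed.

Lemma V0_pos : 0 < V0.
Proof.
unfold V0. assert (Hk := kap_pos). assert (Hn := n_pos). assert (Hm := m_pos).
apply Rdiv_lt_0_compat; nra.
Qed.

Lemma F_le_V0 r : 0 <= r <= rmax -> F r 0 <= V0.
Proof.
intros Hr. assert (Ha := a_bounds). assert (HP := PI2_3_2).
assert (H0 : Rabs 0 <= a) by (rewrite Rabs_R0; lra).
destruct (arcs_small r 0 H0 Hr) as [D1 [D2 D3]].
assert (K1 := xcot_le_1 (r * c12 0) ltac:(lra)). assert (K2 := xcot_le_1 (r * c13 0) ltac:(lra)).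
assert (K3 := xcot_le_1 (r * c23 0) ltac:(lra)).
destruct Euler_values as [E1 E2]. destruct (A_pair_bounds 0 H0) as [B2 [B3 _]].
assert (B1 := A12_bounds 0 H0). assert (Hk := kap_pos).
assert (Hn := n_pos). assert (Hm := m_pos).
unfold F, V0.
replace ((n ^ 2 + 4 * (n * m)) / kap) with (n ^ 2 * (/ kap) + n * m * (4 / kap)) by (field; lra).
rewrite <- E2, <- E1.
apply Rplus_le_compat; apply Rmult_le_compat_l; nra.
Qed.

(** At th = 0 each distance is at most kap r, so x cot x >= 1 - x^2 / 2 gives the same factor for
    all three pairs. *)
Lemma F_ge_V0 r : 0 <= r <= rmax -> (1 - (kap * r) ^ 2 / 2) * V0 <= F r 0.
Proof.
intros Hr. assert (Ha := a_bounds). assert (HP := PI2_3_2).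
assert (H0 : Rabs 0 <= a) by (rewrite Rabs_R0; lra).
destruct (arcs_small r 0 H0 Hr) as [D1 [D2 D3]].
assert (Hd : forall d, 0 <= d <= kap * r -> d <= 1 -> 1 - (kap * r) ^ 2 / 2 <= xcot d).
{ intros d Hd Hd1. assert (K := xcot_ge_quadratic d ltac:(lra)). nra. }
assert (E12 : r * c12 0 = kap * r). { unfold c12. rewrite cos_0. ring. }
assert (Hsum : r * c13 0 + r * c23 0 = kap * r).
{ rewrite <- Rmult_plus_distr_l, <- c12_split. exact E12. }
assert (K1 := Hd (r * c12 0) ltac:(lra) ltac:(lra)). assert (K2 := Hd (r * c13 0) ltac:(lra) ltac:(lra)).
assert (K3 := Hd (r * c23 0) ltac:(lra) ltac:(lra)).
destruct Euler_values as [E1 E2]. destruct (A_pair_bounds 0 H0) as [B2 [B3 _]].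
assert (B1 := A12_bounds 0 H0). assert (Hk := kap_pos).
assert (Hn := n_pos). assert (Hm := m_pos).
unfold F, V0. set (c := 1 - (kap * r) ^ 2 / 2) in *.
replace (c * ((n ^ 2 + 4 * (n * m)) / kap)) with (n ^ 2 * (/ kap * c) + n * m * (4 / kap * c)) by (field; lra).
rewrite <- E2, <- E1.
apply Rplus_le_compat; apply Rmult_le_compat_l; nra.
Qed.

Lemma D_nonpos r th : Rabs th <= a -> 0 <= r <= rmax -> D r th <= 0.
Proof.
intros H Hr. assert (HP := PI2_3_2).
destruct (arcs_small r th H Hr) as [D1 [D2 D3]].
assert (K1 := xcot1_nonpos (r * c12 th) ltac:(lra)). assert (K2 := xcot1_nonpos (r * c13 th) ltac:(lra)).
assert (K3 := xcot1_nonpos (r * c23 th) ltac:(lra)).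
assert (Hq := q_nonneg th H). assert (Hn := n_pos). assert (Hm := m_pos).
unfold D. assert (n ^ 2 * xcot1 (r * c12 th) + n * m * (xcot1 (r * c13 th) + xcot1 (r * c23 th)) <= 0); [|nra].
assert (0 < n * m) by nra. assert (0 < n ^ 2) by nra. nra.
Qed.

(** The factor q = cos^2 u is kept because Q is later divided by w, for which the first available
    lower bound is a multiple of cos u. *)
Lemma D_bound : exists C, 0 < C /\
  forall r th, Rabs th <= a -> 0 <= r <= rmax -> Rabs (D r th) <= C * q th.
Proof.
assert (HP := PI2_3_2). assert (Hn := n_pos). assert (Hm := m_pos).
destruct (bounded_on_segment xcot1 0 (4 / 7) ltac:(lra)) as [C [HC Hb]].
{ intros x Hx. apply continuous_xcot1. rewrite Rabs_pos_eq; lra. }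
exists ((n ^ 2 + 2 * (n * m)) * C). split; [apply Rmult_lt_0_compat; nra|].
intros r th H Hr. destruct (arcs_small r th H Hr) as [D1 [D2 D3]].
assert (K1 := Hb _ D1). assert (K2 := Hb _ D2). assert (K3 := Hb _ D3).
apply Rabs_le_between in K1. apply Rabs_le_between in K2. apply Rabs_le_between in K3.
assert (Hq := q_nonneg th H).
unfold D. rewrite Rabs_mult, (Rabs_pos_eq (q th)) by lra. rewrite Rmult_comm.
apply Rmult_le_compat_r; [lra|]. assert (0 < n * m) by nra. assert (0 < n ^ 2) by nra.
apply Rabs_le. split; nra.
Qed.

Lemma F_D_lipschitz : exists C, 0 < C /\
  forall th r r', Rabs th <= a -> 0 <= r <= rmax -> 0 <= r' <= rmax ->
  Rabs (F r th - F r' th) <= C * Rabs (r - r') /\ Rabs (D r th - D r' th) <= C * Rabs (r - r').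
Proof.
assert (HP := PI2_3_2). assert (Hn := n_pos). assert (Hm := m_pos). assert (Hk := kap_pos).
destruct D_bound as [C1 [HC1 Hb1]].
destruct (bounded_on_segment xcot2 0 (4 / 7) ltac:(lra)) as [C [HC Hb]].
{ intros x Hx. apply continuous_xcot2. rewrite Rabs_pos_eq; lra. }
set (C2 := (n ^ 2 + 2 * (n * m)) * (kap * C)).
assert (HC2 : 0 < C2) by (apply Rmult_lt_0_compat; nra).
exists (C1 + C2). split; [lra|].
intros th r r' H Hr Hr'. assert (Hq := q_nonneg th H).
assert (Hpos := Rabs_pos (r - r')).
split.
- apply Rle_trans with (C1 * Rabs (r - r')); [|nra].
  apply (lipschitz_on_segment (fun r => F r th) (fun r => D r th) 0 rmax); [| |exact Hr|exact Hr'].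
  + intros x Hx. evar_last.
    * apply (is_derive_F (fun r => r) (fun _ => th) x 1 0).
      -- apply (is_derive_id (K := R_AbsRing)).
      -- apply (is_derive_const (V := R_NormedModule)).
      -- apply regular_small; assumption.
    * ring.
  + intros x Hx. eapply Rle_trans; [apply Hb1; assumption|]. nra.
- apply Rle_trans with (C2 * Rabs (r - r')); [|nra].
  apply (lipschitz_on_segment (fun r => D r th) (fun r =>
    q th * (n ^ 2 * (c12 th * xcot2 (r * c12 th)) + n * m * (c13 th * xcot2 (r * c13 th) + c23 th * xcot2 (r * c23 th))))
    0 rmax); [| |exact Hr|exact Hr'].
  + intros x Hx. destruct (arcs_small x th H Hx) as [D1 [D2 D3]].
    assert (E : forall c, 0 <= x * c <= 4 / 7 -> is_derive (fun r => xcot1 (r * c)) x (c * xcot2 (x * c))).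
    { intros c Hc. rewrite Rmult_comm. apply (is_derive_comp_real xcot1 (fun r => r * c)).
      - apply is_derive_xcot1. rewrite Rabs_pos_eq; lra.
      - auto_derive; [trivial|ring]. }
    unfold D. apply is_derive_Rscal.
    apply (is_derive_Rplus (fun r => n ^ 2 * xcot1 (r * c12 th))
      (fun r => n * m * (xcot1 (r * c13 th) + xcot1 (r * c23 th)))).
    * apply is_derive_Rscal, E, D1.
    * apply is_derive_Rscal. apply is_derive_Rplus; [apply E, D2|apply E, D3].
  + intros x Hx. destruct (arcs_small x th H Hx) as [D1 [D2 D3]].
    assert (K1 := Hb _ D1). assert (K2 := Hb _ D2). assert (K3 := Hb _ D3).
    assert (B1 := c12_pos th H). assert (B2 := c13_nonneg th H). assert (B3 := c23_nonneg th H).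
    assert (B4 := c12_le th H). assert (B5 := c12_split th).
    rewrite Rabs_mult, (Rabs_pos_eq (q th)) by lra.
    assert (T : forall c v, 0 <= c <= kap -> Rabs v <= C -> - (kap * C) <= c * v <= kap * C).
    { intros c v Hc Hv. apply Rabs_le_between in Hv. split; nra. }
    assert (T1 := T (c12 th) _ ltac:(lra) K1). assert (T2 := T (c13 th) _ ltac:(lra) K2).
    assert (T3 := T (c23 th) _ ltac:(lra) K3).
    set (x1 := c12 th * xcot2 (x * c12 th)) in *. set (x2 := c13 th * xcot2 (x * c13 th)) in *.
    set (x3 := c23 th * xcot2 (x * c23 th)) in *. clearbody x1 x2 x3.
    assert (0 < n * m) by nra. assert (0 < n ^ 2) by nra.
    assert (Rabs (n ^ 2 * x1 + n * m * (x2 + x3)) <= C2).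
    { unfold C2. set (kc := kap * C) in *. clearbody kc. apply Rabs_le. split; nra. }
    assert (H3 := Rabs_pos (n ^ 2 * x1 + n * m * (x2 + x3))). nra.
Qed.

(** * Shooting from the Euler line *)

(* The square of w: the energy relation solved for w^2, with v = nu. *)
Definition W2 (u r v : R) : R :=
  2 * F r (a * sin u) + 2 * r * h * cos u ^ 2 - v ^ 2 * cos u ^ 2.
(* The equation for nu reads nu' = theta_* (w^2 / 2 - Q). *)
Definition Q (u r : R) : R := - (r * h * cos u ^ 2 + r * D r (a * sin u)).

Lemma Rabs_theta u : Rabs (a * sin u) <= a.
Proof.
assert (Ha := a_bounds). assert (Hs := SIN_bound u).
apply Rabs_le. split; nra.
Qed.

Lemma q_theta u : q (a * sin u) = cos u ^ 2.
Proof.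
assert (Ha := a_bounds). unfold q.
replace (a * sin u / a) with (sin u) by (field; lra).
assert (E := sin2_cos2 u). unfold Rsqr in E. lra.
Qed.

(** * The truncated field and its flow *)

Section ClampedField.
Variables (d lo hi : R).
Hypothesis d_pos : 0 < d.
Hypothesis lo_hi : lo <= hi.

(** The bounds lo and hi on nu are parameters because two truncations occur: [- N, 0] realizes min
    (nu, 0) during shooting, and [- N, N] is symmetric, as the reflections of the complete orbit
    require. *)
Definition Wc (u r v : R) : R :=
  sqrt (Rmax (d ^ 2) (W2 u (clamp 0 rmax r) (clamp lo hi v))).
Definition field_r (u r v : R) : R :=
  a * clamp lo hi v * clamp 0 rmax r * cos u ^ 2 * / Wc u r v.
Definition field_v (u r v : R) : R :=
  a * (Wc u r v / 2 - Q u (clamp 0 rmax r) * / Wc u r v).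

Lemma tame_clamp_r : tame (fun _ r _ => clamp 0 rmax r).
Proof.
assert (Hr := rmax_pos). split; [intros; apply continuous_const|].
exists (rmax + 1). split; [lra|]. intros _ y z y' z'.
assert (Hb := clamp_bounds 0 rmax y ltac:(lra)). split; [rewrite Rabs_pos_eq; lra|].
eapply Rle_trans; [apply clamp_lipschitz|].
assert (Q1 := Rabs_pos (y - y')). assert (Q2 := Rabs_pos (z - z')). nra.
Qed.

Lemma tame_clamp_v : tame (fun _ _ v => clamp lo hi v).
Proof.
split; [intros; apply continuous_const|].
exists (Rabs lo + Rabs hi + 1). assert (Q3 := Rabs_pos lo). assert (Q4 := Rabs_pos hi).
split; [lra|]. intros _ y z y' z'.
assert (Hb := clamp_bounds lo hi z lo_hi). split.
- assert (H1 := Rle_abs hi). assert (H2 := Rle_abs (- lo)). rewrite Rabs_Ropp in H2.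
  apply Rabs_le. lra.
- eapply Rle_trans; [apply clamp_lipschitz|].
  assert (Q1 := Rabs_pos (y - y')). assert (Q2 := Rabs_pos (z - z')). nra.
Qed.

Lemma tame_cos2 : tame (fun u _ _ => cos u ^ 2).
Proof.
apply (tame_time (fun u => cos u ^ 2) 1).
- intros x. cont_deriv.
- intros x. assert (H := COS_bound x). rewrite Rabs_pos_eq; nra.
Qed.

Lemma continuous_theta u : continuous (fun u => a * sin u) u.
Proof. cont_deriv. Qed.

Lemma tame_F_D : tame (fun u r _ => F (clamp 0 rmax r) (a * sin u)) /\
  tame (fun u r _ => D (clamp 0 rmax r) (a * sin u)).
Proof.
assert (Hr := rmax_pos).
assert (Hcl := fun y => clamp_bounds 0 rmax y (Rlt_le _ _ Hr)).
destruct F_D_lipschitz as [C [HC HL]]. destruct D_bound as [C' [HC' HD]].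
assert (HV := V0_pos). destruct F_lower as [c [Hc HF]].
split; (split; [intros u r _|]).
- apply (continuous_path_F (fun _ => clamp 0 rmax r) (fun u => a * sin u)).
  + apply continuous_const.
  + apply continuous_theta.
  + apply regular_small; [apply Rabs_theta|apply Hcl].
- exists (C + 2 * V0). split; [lra|]. intros u y z y' z'.
  assert (Q1 := Rabs_pos (y - y')). assert (Q2 := Rabs_pos (z - z')). split.
  + assert (F1 := F_le (clamp 0 rmax y) _ (Rabs_theta u) (Hcl y)).
    assert (F2 := HF (clamp 0 rmax y) _ (Rabs_theta u) (Hcl y)).
    rewrite Rabs_pos_eq; lra.
  + eapply Rle_trans; [apply HL; [apply Rabs_theta|apply Hcl|apply Hcl]|].
    assert (Q3 := clamp_lipschitz 0 rmax y y'). nra.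
- apply (continuous_path_D (fun _ => clamp 0 rmax r) (fun u => a * sin u)).
  + apply continuous_const.
  + apply continuous_theta.
  + apply regular_small; [apply Rabs_theta|apply Hcl].
- exists (C + C'). split; [lra|]. intros u y z y' z'.
  assert (Q1 := Rabs_pos (y - y')). assert (Q2 := Rabs_pos (z - z')). split.
  + eapply Rle_trans; [apply HD; [apply Rabs_theta|apply Hcl]|].
    assert (Q3 := q_nonneg _ (Rabs_theta u)). nra.
  + eapply Rle_trans; [apply HL; [apply Rabs_theta|apply Hcl|apply Hcl]|].
    assert (Q3 := clamp_lipschitz 0 rmax y y'). nra.
Qed.

Lemma tame_W2 : tame (fun u r v => W2 u (clamp 0 rmax r) (clamp lo hi v)).
Proof.
destruct tame_F_D as [TF _].
unfold W2. apply tame_plus.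
- apply tame_plus.
  + apply (tame_mult (fun _ _ _ => 2)); [apply tame_const|exact TF].
  + apply (tame_mult (fun _ r _ => 2 * clamp 0 rmax r * h)); [|apply tame_cos2].
    apply (tame_mult (fun _ r _ => 2 * clamp 0 rmax r)); [|apply tame_const].
    apply (tame_mult (fun _ _ _ => 2)); [apply tame_const|apply tame_clamp_r].
- apply (tame_comp Ropp 1); [lra| |].
  + intros s t. rewrite <- Rabs_Ropp. right. rewrite Rmult_1_l. f_equal. ring.
  + apply (tame_mult (fun _ _ v => clamp lo hi v ^ 2)); [|apply tame_cos2].
    apply (tame_mult (fun _ _ v => clamp lo hi v)); [apply tame_clamp_v|].
    apply (tame_mult (fun _ _ v => clamp lo hi v)); [apply tame_clamp_v|apply tame_const].
Qed.

Lemma tame_Wc : tame Wc /\ tame (fun u r v => / Wc u r v).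
Proof.
assert (H2 := tame_W2).
split.
- apply (tame_comp (fun x => sqrt (Rmax (d ^ 2) x)) (/ d)
    (fun u r v => W2 u (clamp 0 rmax r) (clamp lo hi v))); [|intros; apply sqrt_Rmax_lipschitz|]; auto.
  apply Rinv_0_lt_compat, d_pos.
- apply (tame_comp (fun x => / sqrt (Rmax (d ^ 2) x)) (/ d ^ 3)
    (fun u r v => W2 u (clamp 0 rmax r) (clamp lo hi v))); [|intros; apply inv_sqrt_Rmax_lipschitz|]; auto.
  apply Rinv_0_lt_compat, pow_lt, d_pos.
Qed.

Lemma tame_field : tame field_r /\ tame field_v.
Proof.
destruct tame_Wc as [T1 T2]. destruct tame_F_D as [_ TD].
split.
- apply (tame_mult (fun u r v => a * clamp lo hi v * clamp 0 rmax r * cos u ^ 2)); [|exact T2].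
  apply (tame_mult (fun u r v => a * clamp lo hi v * clamp 0 rmax r)); [|apply tame_cos2].
  apply (tame_mult (fun u r v => a * clamp lo hi v)); [|apply tame_clamp_r].
  apply (tame_mult (fun u r v => a)); [apply tame_const|apply tame_clamp_v].
- apply (tame_mult (fun u r v => a)); [apply tame_const|].
  apply tame_plus.
  + apply (tame_mult Wc); [exact T1|apply tame_const].
  + apply tame_opp. apply (tame_mult (fun u r v => Q u (clamp 0 rmax r))); [|exact T2].
    apply tame_opp. apply tame_plus.
    * apply (tame_mult (fun u r v => clamp 0 rmax r * h)); [|apply tame_cos2].
      apply (tame_mult (fun u r v => clamp 0 rmax r)); [apply tame_clamp_r|apply tame_const].
    * apply (tame_mult (fun u r v => clamp 0 rmax r)); [apply tame_clamp_r|exact TD].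
Qed.

Definition clamped_at (r v : R -> R) (u : R) : Prop :=
  is_derive r u (field_r u (r u) (v u)) /\ is_derive v u (field_v u (r u) (v u)).
Definition clamped_solution (r v : R -> R) : Prop := forall u, clamped_at r v u.

(** In the comparison the solutions are assumed only between u0 and u; this later identifies
    solutions of the two truncations on [0, pi / 2]. *)
Lemma clamped_flow : exists L, 0 < L /\
  (forall r0 v0, exists r v, r 0 = r0 /\ v 0 = v0 /\ clamped_solution r v) /\
  (forall r v r' v' u0 u,
     (forall t, Rmin u0 u <= t <= Rmax u0 u -> clamped_at r v t /\ clamped_at r' v' t) ->
     (r u - r' u) ^ 2 + (v u - v' u) ^ 2
       <= ((r u0 - r' u0) ^ 2 + (v u0 - v' u0) ^ 2) * exp (4 * L * Rabs (u - u0))).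
Proof.
destruct tame_field as [[Hc1 [C1 [HC1 H1]]] [Hc2 [C2 [HC2 H2]]]].
assert (L1 : forall x y z y' z',
  Rabs (field_r x y z - field_r x y' z') <= (C1 + C2) * (Rabs (y - y') + Rabs (z - z'))).
{ intros x y z y' z'. eapply Rle_trans; [apply H1|].
  assert (Q1 := Rabs_pos (y - y')). assert (Q2 := Rabs_pos (z - z')).
  apply Rmult_le_compat_r; lra. }
assert (L2 : forall x y z y' z',
  Rabs (field_v x y z - field_v x y' z') <= (C1 + C2) * (Rabs (y - y') + Rabs (z - z'))).
{ intros x y z y' z'. eapply Rle_trans; [apply H2|].
  assert (Q1 := Rabs_pos (y - y')). assert (Q2 := Rabs_pos (z - z')).
  apply Rmult_le_compat_r; lra. }
exists (C1 + C2). split; [lra|split].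
- intros r0 v0.
  apply (planar_ode_solution field_r field_v (C1 + C2) (C1 + C2)); try assumption; try lra.
  + intros x y z. destruct (H1 x y z y z). lra.
  + intros x y z. destruct (H2 x y z y z). lra.
- intros r v r' v' u0 u S.
  apply (planar_ode_dependence field_r field_v (C1 + C2)); try assumption; try lra; intros t Ht; apply S, Ht.
Qed.

End ClampedField.

Lemma theta_range u : 0 <= u < PI / 2 -> 0 <= a * sin u < a.
Proof.
intros Hu. assert (Ha := a_bounds).
assert (H1 : 0 <= sin u) by (apply sin_ge_0; lra).
assert (H2 : sin u < 1).
{ rewrite <- sin_PI2. apply sin_increasing_1; lra. }
split; nra.
Qed.

Lemma small_lt_PI r th : Rabs th <= a -> 0 <= r <= rmax -> r * c12 th < PI.
Proof. intros H1 H2. apply (regular_small r th H1 H2). Qed.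

Lemma W2_Upot u r v : 0 <= u < PI / 2 -> 0 < r <= rmax ->
  W2 u r v = 2 * cos u ^ 2 * (r * (Upot r (a * sin u) + h) - v ^ 2 / 2).
Proof.
intros Hu Hr. assert (Ht := theta_range u Hu).
unfold W2. rewrite F_Upot, q_theta.
- field.
- apply Rabs_lt_a, Ht.
- lra.
- apply small_lt_PI; [apply Rabs_theta|lra].
Qed.

Lemma Q_Upot u r : 0 <= u < PI / 2 -> 0 < r <= rmax ->
  Q u r = - (r * cos u ^ 2 * (h + Upot r (a * sin u) + r * Ur r (a * sin u))).
Proof.
intros Hu Hr. assert (Ht := theta_range u Hu).
unfold Q. rewrite <- r_Ur, q_theta.
- ring.
- apply Rabs_lt_a, Ht.
- lra.
- apply small_lt_PI; [apply Rabs_theta|lra].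
Qed.

(* The equations of motion on [0, b), with nu replaced by min (nu, 0) on the right-hand sides. *)
Definition descent (b : R) (r v : R -> R) : Prop :=
  forall u, 0 <= u < b ->
    0 < r u <= rmax /\ 0 < W2 u (r u) (Rmin (v u) 0) /\
    is_derive r u (a * Rmin (v u) 0 * r u * cos u ^ 2 / sqrt (W2 u (r u) (Rmin (v u) 0))) /\
    is_derive v u (a * (sqrt (W2 u (r u) (Rmin (v u) 0)) / 2
                        - Q u (r u) / sqrt (W2 u (r u) (Rmin (v u) 0)))).

(** * Monotone quantities along a descent *)

Section Monotonicity.
Variables (b : R) (r v : R -> R).
Hypothesis b_le : b <= PI / 2.
Hypothesis desc : descent b r v.

Lemma descent_continuous u : 0 <= u < b -> continuous r u /\ continuous v u.
Proof.
intros Hu. destruct (desc u Hu) as [_ [_ [H1 H2]]].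
split; eapply is_derive_continuous; eassumption.
Qed.

Lemma descent_r_nonincreasing x y : 0 <= x <= y -> y < b -> r y <= r x.
Proof.
intros Hx Hy. assert (Ha := a_bounds).
assert (A := nondecreasing_of_derive (fun u => - r u) (fun u => -
  (a * Rmin (v u) 0 * r u * cos u ^ 2 / sqrt (W2 u (r u) (Rmin (v u) 0)))) x y ltac:(lra)).
cbv beta in A. assert (- r x <= - r y); [|lra]. apply A.
- intros u Hu. apply (is_derive_opp r). apply desc. lra.
- intros u Hu. apply (continuous_opp r). apply descent_continuous. lra.
- intros u Hu. destruct (desc u ltac:(lra)) as [Hr [HW _]].
  assert (Rmin (v u) 0 <= 0) by apply Rmin_r.
  assert (Hs := sqrt_lt_R0 _ HW). assert (Hi := Rinv_0_lt_compat _ Hs).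
  assert (0 <= r u * cos u ^ 2 * / sqrt (W2 u (r u) (Rmin (v u) 0))).
  { apply Rmult_le_pos; [|lra]. apply Rmult_le_pos; [lra|apply pow2_ge_0]. }
  unfold Rdiv.
  replace (- (a * Rmin (v u) 0 * r u * cos u ^ 2 * / sqrt (W2 u (r u) (Rmin (v u) 0))))
    with (a * - Rmin (v u) 0 * (r u * cos u ^ 2 * / sqrt (W2 u (r u) (Rmin (v u) 0)))) by ring.
  apply Rmult_le_pos; [|assumption]. apply Rmult_le_pos; lra.
Qed.

Lemma descent_Gam x y : 0 <= x <= y -> y < b ->
  Gam (r x) (a * sin x) <= Gam (r y) (a * sin y).
Proof.
intros Hx Hy. assert (Ha := a_bounds).
assert (Hr := descent_r_nonincreasing x y Hx Hy).
destruct (desc x ltac:(lra)) as [Hrx _]. destruct (desc y ltac:(lra)) as [Hry _].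
assert (Hty := theta_range y ltac:(lra)). assert (Htx := theta_range x ltac:(lra)).
apply Gam_monotone; [lra|lra| |lra].
split; [lra|]. apply Rmult_le_compat_l; [lra|]. apply sin_incr_1; lra.
Qed.

(** The energy relation eliminates w^2 / 2 - Q, leaving the form in which [Gam] decides the sign. *)
Lemma descent_v_derive u : 0 <= u < b ->
  is_derive v u (a * cos u ^ 2 / sqrt (W2 u (r u) (Rmin (v u) 0))
                 * (r u * Gam (r u) (a * sin u) - Rmin (v u) 0 ^ 2 / 2)).
Proof.
intros Hu. destruct (desc u Hu) as [Hr [HW [_ Hv]]].
evar_last; [exact Hv|].
assert (Hs := sqrt_lt_R0 _ HW). assert (Hq := pow2_sqrt _ (Rlt_le _ _ HW)).
set (w := sqrt (W2 u (r u) (Rmin (v u) 0))) in *.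
rewrite Q_Upot, Gam_U by lra. rewrite W2_Upot in Hq by lra.
apply Rmult_eq_reg_r with w; [|lra].
set (U := Upot (r u) (a * sin u)) in *. set (U1 := Ur (r u) (a * sin u)).
clearbody w U U1.
transitivity (a * (w ^ 2 / 2 + r u * cos u ^ 2 * (h + U + r u * U1))); [field; lra|].
rewrite Hq. field. lra.
Qed.

(* Half the squared angular momentum, r w^2 / (2 cos^2 u), by the energy relation. *)
Definition momentum (u : R) : R :=
  r u ^ 2 * (Upot (r u) (a * sin u) + h) - r u * Rmin (v u) 0 ^ 2 / 2.

(** The radial terms cancel and only the torque remains. Truncation respects this cancellation: r'
    and the derivative of min (nu, 0)^2 both carry the factor min (nu, 0). *)
Lemma momentum_derive u : 0 <= u < b ->
  is_derive momentum u (r u ^ 2 * Uth (r u) (a * sin u) * (a * cos u)).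
Proof.
intros Hu. assert (Hv := descent_v_derive u Hu).
destruct (desc u Hu) as [Hr [HW [Hdr _]]].
assert (Ht := theta_range u ltac:(lra)).
assert (Hs := sqrt_lt_R0 _ HW).
assert (Hth : is_derive (fun u => a * sin u) u (a * cos u)) by (auto_derive; [trivial|ring]).
assert (HU := is_derive_Upot r (fun u => a * sin u) u _ _ Hdr Hth (Rabs_lt_a _ Ht) (proj1 Hr)
   (small_lt_PI (r u) _ (Rabs_theta u) ltac:(lra))).
assert (Hr2 : is_derive (fun u => r u ^ 2) u
  (2 * r u * (a * Rmin (v u) 0 * r u * cos u ^ 2 / sqrt (W2 u (r u) (Rmin (v u) 0))))).
{ apply (is_derive_comp_real (fun x => x ^ 2) r); [auto_derive; [trivial|ring]|exact Hdr]. }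
assert (Hp := is_derive_comp_real (fun x => Rmin x 0 ^ 2) v u _ _ (is_derive_Rmin_sq (v u)) Hv).
assert (HUh : is_derive (fun u => Upot (r u) (a * sin u) + h) u
  (Ur (r u) (a * sin u) * (a * Rmin (v u) 0 * r u * cos u ^ 2 / sqrt (W2 u (r u) (Rmin (v u) 0)))
   + Uth (r u) (a * sin u) * (a * cos u) + 0)).
{ apply is_derive_Rplus; [exact HU|apply (is_derive_const (V := R_NormedModule))]. }
assert (G1 := is_derive_Rmult _ _ _ _ _ Hr2 HUh).
assert (G2 := is_derive_Rmult _ _ _ _ _ Hdr Hp).
assert (G3 := is_derive_Rplus _ _ _ _ _ G1 (is_derive_Rscal (- / 2) _ _ _ G2)).
unfold momentum. eapply is_derive_ext; [|evar_last; [exact G3|]].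
- intros t. simpl. field.
- cbv beta. rewrite Gam_U. field. lra.
Qed.

Lemma momentum_monotone x y : 0 <= x <= y -> y < b -> momentum x <= momentum y.
Proof.
intros Hx Hy. assert (Ha := a_bounds).
apply (nondecreasing_of_derive momentum (fun u => r u ^ 2 * Uth (r u) (a * sin u) * (a * cos u))); [lra| | |].
- intros u Hu. apply momentum_derive. lra.
- intros u Hu. eapply is_derive_continuous, momentum_derive. lra.
- intros u Hu. destruct (desc u ltac:(lra)) as [Hr _].
  assert (Ht := theta_range u ltac:(lra)).
  assert (0 <= cos u) by (apply cos_ge_0; lra).
  apply Rmult_le_pos; [apply Rmult_le_pos; [apply pow2_ge_0|apply Uth_nonneg; lra]|].
  apply Rmult_le_pos; lra.
Qed.

Lemma W2_momentum u : 0 <= u < b ->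
  W2 u (r u) (Rmin (v u) 0) = 2 * cos u ^ 2 * momentum u / r u.
Proof.
intros Hu. destruct (desc u Hu) as [Hr _]. rewrite W2_Upot by lra.
unfold momentum. field. lra.
Qed.

Lemma momentum_0 : 0 < b -> v 0 = 0 -> momentum 0 = r 0 * (F (r 0) 0 + r 0 * h).
Proof.
intros Hb Hv0. destruct (desc 0 ltac:(lra)) as [Hr0 _].
unfold momentum. rewrite Hv0, Rmin_left by lra. rewrite sin_0, Rmult_0_r.
rewrite (F_Upot (r 0) 0), q_0; [field| |lra|].
- rewrite Rabs_R0. apply a_bounds.
- apply small_lt_PI; [rewrite Rabs_R0; left; apply a_bounds|lra].
Qed.

(** In w^2 = 2 cos^2 u (momentum / r) the momentum grows and r shrinks, so the quotient is at least
    its initial value, the energy excess. *)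
Lemma descent_W2_lower : 0 < b -> v 0 = 0 -> forall u, 0 <= u < b ->
  2 * (F (r 0) 0 + r 0 * h) * cos u ^ 2 <= W2 u (r u) (Rmin (v u) 0).
Proof.
intros Hb Hv0 u Hu. rewrite W2_momentum by exact Hu.
assert (Hm := momentum_monotone 0 u ltac:(lra) ltac:(lra)).
assert (Hrr := descent_r_nonincreasing 0 u ltac:(lra) ltac:(lra)).
destruct (desc u Hu) as [Hr _]. destruct (desc 0 ltac:(lra)) as [Hr0 [HW0 _]].
assert (E0 := momentum_0 Hb Hv0).
assert (Hpos : 0 < F (r 0) 0 + r 0 * h).
{ rewrite W2_momentum in HW0 by lra. rewrite E0, cos_0 in HW0.
  replace (2 * 1 ^ 2 * (r 0 * (F (r 0) 0 + r 0 * h)) / r 0) with (2 * (F (r 0) 0 + r 0 * h)) in HW0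
    by (field; lra). lra. }
set (e := F (r 0) 0 + r 0 * h) in *.
assert (e * r u <= momentum u) by nra.
assert (Hc := pow2_ge_0 (cos u)).
apply Rmult_le_reg_r with (r u); [lra|].
replace (2 * cos u ^ 2 * momentum u / r u * r u) with (2 * cos u ^ 2 * momentum u) by (field; lra).
replace (2 * e * cos u ^ 2 * r u) with (2 * cos u ^ 2 * (e * r u)) by ring.
apply Rmult_le_compat_l; lra.
Qed.

End Monotonicity.

(* The radial momentum nu changes sign at most once along a descent: [Gam], which decides the
   sign of nu' where nu = 0, is nondecreasing. *)
Lemma descent_v_stays_positive r v u1 : descent (PI / 2) r v ->
  v 0 = 0 -> (forall u, 0 <= u <= PI / 2 -> continuous v u) ->
  0 <= u1 < PI / 2 -> 0 < v u1 -> forall u, u1 <= u <= PI / 2 -> v u1 <= v u.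
Proof.
intros Hd Hv0 Hc Hu1 Hpos. assert (Ha := a_bounds).
assert (Hfac : forall u, 0 <= u < PI / 2 -> 0 <= a * cos u ^ 2 / sqrt (W2 u (r u) (Rmin (v u) 0))).
{ intros u Hu. destruct (Hd u Hu) as [_ [HW _]]. apply sqrt_lt_R0 in HW.
  apply Rmult_le_pos; [apply Rmult_le_pos; [lra|apply pow2_ge_0]|].
  left. apply Rinv_0_lt_compat, HW. }
(* If [Gam] were nonpositive at u1, it would be so on all of [0, u1]; v would decrease from 0 and
   could not be positive at u1. *)
assert (HG : 0 < Gam (r u1) (a * sin u1)).
{ destruct (Rlt_dec 0 (Gam (r u1) (a * sin u1))) as [|Hn]; [assumption|exfalso].
  assert (v u1 <= v 0); [|lra].
  assert (A := nondecreasing_of_derive (fun u => - v u) (fun u => -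
    (a * cos u ^ 2 / sqrt (W2 u (r u) (Rmin (v u) 0))
                 * (r u * Gam (r u) (a * sin u) - Rmin (v u) 0 ^ 2 / 2))) 0 u1 ltac:(lra)).
  cbv beta in A. assert (- v 0 <= - v u1); [|lra]. apply A.
  - intros u Hu. apply (is_derive_opp v). apply (descent_v_derive (PI / 2)); [lra|exact Hd|lra].
  - intros u Hu. apply (continuous_opp v). apply Hc. lra.
  - intros u Hu. destruct (Hd u ltac:(lra)) as [Hr _].
    assert (HGu := descent_Gam (PI / 2) r v ltac:(lra) Hd u u1 ltac:(lra) ltac:(lra)).
    assert (Hf := Hfac u ltac:(lra)). assert (Hsq := pow2_ge_0 (Rmin (v u) 0)).
    rewrite <- Ropp_mult_distr_r_reverse. apply Rmult_le_pos; [exact Hf|].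
    assert (0 <= r u * - Gam (r u) (a * sin u)) by (apply Rmult_le_pos; lra). lra. }
assert (Hall : forall x, u1 <= x <= PI / 2 -> 0 < v x /\ v u1 <= v x).
{ assert (Hstep : forall x, u1 <= x <= PI / 2 -> (forall y, u1 <= y < x -> 0 < v y) -> v u1 <= v x).
  { intros x Hx Hy.
    apply (nondecreasing_of_derive v (fun u =>
      a * cos u ^ 2 / sqrt (W2 u (r u) (Rmin (v u) 0))
                 * (r u * Gam (r u) (a * sin u) - Rmin (v u) 0 ^ 2 / 2)) u1 x); [lra| | |].
    - intros u Hu. apply (descent_v_derive (PI / 2)); [lra|exact Hd|lra].
    - intros u Hu. apply Hc. lra.
    - intros u Hu. destruct (Hd u ltac:(lra)) as [Hr _].
      assert (HGu := descent_Gam (PI / 2) r v ltac:(lra) Hd u1 u ltac:(lra) ltac:(lra)).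
      apply Rmult_le_pos; [apply Hfac; lra|].
      rewrite Rmin_right by (left; apply Hy; lra).
      assert (0 <= r u * Gam (r u) (a * sin u)) by (apply Rmult_le_pos; lra). lra. }
  assert (Hp : forall x, u1 <= x <= PI / 2 -> 0 < v x).
  { apply (continuous_induction v u1 (PI / 2)); [lra| |exact Hpos|].
    - intros x Hx. apply Hc. lra.
    - intros x Hx Hy. assert (v u1 <= v x) by (apply Hstep; [lra|exact Hy]). lra. }
  intros x Hx. split; [apply Hp, Hx|]. apply Hstep; [exact Hx|]. intros y Hy. apply Hp. lra. }
intros u Hu. apply Hall, Hu.
Qed.

(** The energy excess on the Euler line: w^2 = 2 Phi r at u = 0 when nu = 0. *)
Definition Phi (r : R) : R := F r 0 + r * h.

Lemma Q_upper : exists H, 0 < H /\ forall u r, 0 <= r <= rmax -> Q u r <= H * cos u ^ 2.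
Proof.
destruct D_bound as [C [HC HD]]. assert (Hr := rmax_pos). assert (Hh := h_le).
exists (rmax * (C - h)). split; [apply Rmult_lt_0_compat; lra|].
intros u r Hrr. unfold Q. specialize (HD r _ (Rabs_theta u) Hrr).
rewrite q_theta in HD. apply Rabs_le_between in HD.
assert (Hc := pow2_ge_0 (cos u)).
set (c := cos u ^ 2) in *. set (dd := D r (a * sin u)) in *. clearbody c dd.
assert (r * - dd <= rmax * (C * c)).
{ apply Rle_trans with (r * (C * c)); [apply Rmult_le_compat_l; lra|].
  apply Rmult_le_compat_r; [apply Rmult_le_pos; lra|lra]. }
assert (r * (- h * c) <= rmax * (- h * c)).
{ apply Rmult_le_compat_r; [apply Rmult_le_pos; lra|lra]. }
lra.
Qed.

(** From - h >= 1 and D <= 0. This is the inward pull that dominates nu' = theta_* (w^2 / 2 - Q)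
    whenever w is small. *)
Lemma Q_lower u r : 0 <= r <= rmax -> r * cos u ^ 2 <= Q u r.
Proof.
intros Hr. unfold Q. assert (HD := D_nonpos r _ (Rabs_theta u) Hr). assert (Hh := h_le).
assert (Hc := pow2_ge_0 (cos u)).
assert (0 <= r * - D r (a * sin u)) by (apply Rmult_le_pos; lra).
assert (0 <= r * cos u ^ 2) by (apply Rmult_le_pos; lra). nra.
Qed.

Lemma field_unclamped d N u r v : 0 < r <= rmax -> - N <= v -> 0 < N ->
  d ^ 2 <= W2 u r (Rmin v 0) ->
  field_r d (- N) 0 u r v = a * Rmin v 0 * r * cos u ^ 2 / sqrt (W2 u r (Rmin v 0)) /\
  field_v d (- N) 0 u r v = a * (sqrt (W2 u r (Rmin v 0)) / 2 - Q u r / sqrt (W2 u r (Rmin v 0))).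
Proof.
intros Hr Hv HN HW.
assert (Ec : clamp (- N) 0 v = Rmin v 0).
{ unfold clamp. rewrite (Rmin_comm 0 v). apply Rmax_right. apply Rmin_glb; lra. }
unfold field_r, field_v, Wc. rewrite Ec, (clamp_id 0 rmax r) by lra.
rewrite Rmax_right by exact HW. split; reflexivity.
Qed.

(* Along a descent from energy excess [e0], w^2 >= 2 e0 cos^2 u by monotonicity of the angular
   momentum; this bounds nu, and then w is bounded below near cos u = 0 because [F] is. *)
Lemma descent_a_priori e0 : 0 < e0 -> exists d N, 0 < d /\ 0 < N /\
  forall r v, clamped_solution d (- N) 0 r v -> 0 < r 0 <= rmax -> v 0 = 0 -> e0 <= Phi (r 0) ->
  forall u, 0 <= u <= PI / 2 ->
    0 < r u <= r 0 /\ - N <= v u /\ d ^ 2 <= W2 u (r u) (Rmin (v u) 0).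
Proof.
intros He0. destruct Q_upper as [H [HH HQ]]. destruct F_lower as [Fm [HFm HF]].
assert (Ha := a_bounds). assert (Ha' := a_lt). assert (HP := PI_upper).
assert (Hrm := rmax_pos). assert (Hh := h_le).
set (c := sqrt (2 * e0)). assert (Hc : 0 < c) by (apply sqrt_lt_R0; lra).
assert (Hc2 : c ^ 2 = 2 * e0) by (apply pow2_sqrt; lra).
(* With w >= c cos u and Q <= H cos^2 u, the u-derivative of nu is at least - H / c, and u ranges
   over an interval of length at most 1.6. *)
set (N := 2 * (H / c) + 1).
assert (HHc : 0 < H / c) by (apply Rdiv_lt_0_compat; assumption).
assert (HN : 0 < N) by (unfold N; lra).
set (E := N ^ 2 + 2 * - h * rmax).
assert (HE : 0 < E) by (unfold E; nra).
(* Half of the bound for w obtained in [HWlow]; the spare factor makes the inequality strict, as the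
   bootstrap needs. *)
set (d := sqrt (2 * Fm * c ^ 2 / (c ^ 2 + E)) / 2).
assert (Hx : 0 < 2 * Fm * c ^ 2 / (c ^ 2 + E)) by (apply Rdiv_lt_0_compat; nra).
assert (Hd : 0 < d) by (unfold d; apply sqrt_lt_R0 in Hx; lra).
assert (Hd2 : 4 * d ^ 2 = 2 * Fm * c ^ 2 / (c ^ 2 + E)).
{ unfold d. replace (4 * (sqrt (2 * Fm * c ^ 2 / (c ^ 2 + E)) / 2) ^ 2)
    with (sqrt (2 * Fm * c ^ 2 / (c ^ 2 + E)) ^ 2) by field. apply pow2_sqrt. lra. }
clearbody d. exists d, N. split; [exact Hd|split; [exact HN|]].
intros r v Hsol Hr0 Hv0 He.
assert (Hcr : forall u, continuous r u) by (intros u; eapply is_derive_continuous, Hsol).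
assert (Hcv : forall u, continuous v u) by (intros u; eapply is_derive_continuous, Hsol).
assert (Hcl : forall y, 0 <= clamp 0 rmax y <= rmax) by (intros y; apply clamp_bounds; lra).
assert (HcW : forall u, continuous (fun u => W2 u (clamp 0 rmax (r u)) (Rmin (v u) 0)) u).
{ intros u.
  assert (C1 : continuous (fun u => clamp 0 rmax (r u)) u).
  { apply (continuous_comp_real (clamp 0 rmax) r); [apply Hcr|].
    apply (lipschitz_continuous _ 1); [lra|]. intros s t. rewrite Rmult_1_l. apply clamp_lipschitz. }
  assert (C2 : continuous (fun u => Rmin (v u) 0) u).
  { apply continuous_Rmin; [apply Hcv|apply continuous_const]. }
  assert (C3 : continuous (fun u => cos u ^ 2) u) by (cont_deriv).
  unfold W2. apply continuous_Rminus; [apply continuous_Rplus|].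
  - apply continuous_Rmult; [apply continuous_const|].
    apply (continuous_path_F (fun u => clamp 0 rmax (r u)) (fun u => a * sin u));
      [exact C1|apply continuous_theta|]. apply regular_small; [apply Rabs_theta|apply Hcl].
  - apply continuous_Rmult; [|exact C3]. apply continuous_Rmult; [|apply continuous_const].
    apply continuous_Rmult; [apply continuous_const|exact C1].
  - apply continuous_Rmult; [|exact C3].
    apply (continuous_comp_real (fun x => x ^ 2) (fun u => Rmin (v u) 0)); [exact C2|].
    cont_deriv. }
assert (Hrle : forall u, 0 <= u <= PI / 2 -> r u <= r 0).
{ intros u Hu.
  assert (A := nondecreasing_of_derive (fun u => - r u) (fun u => - field_r d (- N) 0 u (r u) (v u)) 0 u ltac:(lra)).
  cbv beta in A. assert (- r 0 <= - r u); [|lra]. apply A.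
  - intros x Hx'. apply (is_derive_opp r). apply Hsol.
  - intros x Hx'. apply (continuous_opp r), Hcr.
  - intros x Hx'. unfold field_r.
    assert (B1 := clamp_bounds (- N) 0 (v x) ltac:(lra)). assert (B2 := Hcl (r x)).
    assert (0 < Wc d (- N) 0 x (r x) (v x)).
    { apply sqrt_lt_R0. eapply Rlt_le_trans; [|apply Rmax_l]. nra. }
    assert (0 < / Wc d (- N) 0 x (r x) (v x)) by (apply Rinv_0_lt_compat; assumption).
    assert (B3 := pow2_ge_0 (cos x)).
    replace (- (a * clamp (- N) 0 (v x) * clamp 0 rmax (r x) * cos x ^ 2 * / Wc d (- N) 0 x (r x) (v x)))
      with (a * - clamp (- N) 0 (v x) * clamp 0 rmax (r x) * cos x ^ 2 * / Wc d (- N) 0 x (r x) (v x)) by ring.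
    apply Rmult_le_pos; [apply Rmult_le_pos; [apply Rmult_le_pos; [apply Rmult_le_pos|]|]|]; lra. }
(* The three strict inequalities are packed into the positivity of one continuous function, so that
   [continuous_induction] applies. *)
set (G := fun u => Rmin (r u) (Rmin (v u + N) (W2 u (clamp 0 rmax (r u)) (Rmin (v u) 0) - d ^ 2))).
assert (HG : forall u, 0 < G u -> 0 < r u /\ - N < v u /\ d ^ 2 < W2 u (clamp 0 rmax (r u)) (Rmin (v u) 0)).
{ intros u Hu. unfold G in Hu.
  assert (M1 := Rmin_l (r u) (Rmin (v u + N) (W2 u (clamp 0 rmax (r u)) (Rmin (v u) 0) - d ^ 2))).
  assert (M2 := Rmin_r (r u) (Rmin (v u + N) (W2 u (clamp 0 rmax (r u)) (Rmin (v u) 0) - d ^ 2))).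
  assert (M3 := Rmin_l (v u + N) (W2 u (clamp 0 rmax (r u)) (Rmin (v u) 0) - d ^ 2)).
  assert (M4 := Rmin_r (v u + N) (W2 u (clamp 0 rmax (r u)) (Rmin (v u) 0) - d ^ 2)).
  lra. }
(* Convexity: the two lower bounds for w^2, weighted by E and c^2, add up to 2 Fm c^2. *)
assert (HWlow : forall u, 0 <= u <= PI / 2 -> 0 < r u -> - N <= v u ->
   c ^ 2 * cos u ^ 2 <= W2 u (r u) (Rmin (v u) 0) -> d ^ 2 < W2 u (r u) (Rmin (v u) 0)).
{ intros u Hu Hr Hv Hw. assert (Hru := Hrle u Hu).
  assert (Hp : Rmin (v u) 0 ^ 2 <= N ^ 2).
  { assert (- N <= Rmin (v u) 0) by (apply Rmin_glb; lra).
    assert (Rmin (v u) 0 <= 0) by apply Rmin_r. nra. }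
  assert (HFu := HF (r u) _ (Rabs_theta u) ltac:(lra)).
  assert (Hcc := pow2_ge_0 (cos u)).
  assert (H2 : 2 * Fm - E * cos u ^ 2 <= W2 u (r u) (Rmin (v u) 0)).
  { unfold W2, E. set (cc := cos u ^ 2) in *. set (pp := Rmin (v u) 0 ^ 2) in *.
    assert (pp * cc <= N ^ 2 * cc) by (apply Rmult_le_compat_r; lra).
    assert (r u * (- h * cc) <= rmax * (- h * cc)).
    { apply Rmult_le_compat_r; [apply Rmult_le_pos; lra|lra]. }
    lra. }
  set (W := W2 u (r u) (Rmin (v u) 0)) in *. clearbody W.
  assert (H3 : 2 * Fm * c ^ 2 <= W * (c ^ 2 + E)).
  { assert (E * (c ^ 2 * cos u ^ 2) <= E * W) by (apply Rmult_le_compat_l; lra).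
    assert (c ^ 2 * (2 * Fm - E * cos u ^ 2) <= c ^ 2 * W) by (apply Rmult_le_compat_l; nra). lra. }
  assert (H4 : 2 * Fm * c ^ 2 / (c ^ 2 + E) <= W).
  { apply Rmult_le_reg_r with (c ^ 2 + E); [nra|]. unfold Rdiv. rewrite Rmult_assoc, Rinv_l; [lra|nra]. }
  rewrite <- Hd2 in H4. nra. }
assert (HGall : forall u, 0 <= u <= PI / 2 -> 0 < G u).
{ apply continuous_induction; [lra| | |].
  - intros x _. apply continuous_Rmin; [apply Hcr|]. apply continuous_Rmin.
    + apply continuous_Rplus; [apply Hcv|apply continuous_const].
    + apply continuous_Rminus; [apply HcW|apply continuous_const].
  - unfold G. rewrite clamp_id by lra. apply Rmin_glb_lt; [lra|]. rewrite Hv0 at 1.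
    apply Rmin_glb_lt; [lra|].
    assert (d ^ 2 < W2 0 (r 0) (Rmin (v 0) 0)); [|lra].
    apply HWlow; [lra|lra|lra|]. rewrite Hv0, Rmin_left by lra.
    unfold W2. rewrite sin_0, Rmult_0_r, cos_0, Hc2. unfold Phi in He. lra.
  - intros x Hx' Hy. assert (HPx : x <= 1.6) by lra.
    assert (Hdesc : descent x r v).
    { intros u Hu. destruct (HG u (Hy u Hu)) as [G1 [G2 G3]].
      assert (Hru := Hrle u ltac:(lra)). rewrite clamp_id in G3 by lra.
      assert (Hd2p : 0 < d ^ 2) by nra.
      destruct (field_unclamped d N u (r u) (v u) ltac:(lra) ltac:(lra) HN ltac:(lra)) as [U1 U2].
      destruct (Hsol u) as [S1 S2]. rewrite U1 in S1. rewrite U2 in S2.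
      split; [lra|split; [lra|split; assumption]]. }
    assert (Hlow : forall u, 0 <= u < x -> c ^ 2 * cos u ^ 2 <= W2 u (r u) (Rmin (v u) 0)).
    { intros u Hu. eapply Rle_trans; [|apply (descent_W2_lower x r v ltac:(lra) Hdesc ltac:(lra) Hv0 u Hu)].
      rewrite Hc2. unfold Phi in He. assert (Hcc := pow2_ge_0 (cos u)).
      apply Rmult_le_compat_r; lra. }
    (* The function v + (H / c) u is nondecreasing on [0, x]. *)
    assert (HVx : - N < v x).
    { assert (v 0 + H / c * 0 <= v x + H / c * x).
      { apply (nondecreasing_of_derive (fun u => v u + H / c * u) (fun u =>
          a * (sqrt (W2 u (r u) (Rmin (v u) 0)) / 2 - Q u (r u) / sqrt (W2 u (r u) (Rmin (v u) 0))) + H / c));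
          [lra| | |].
        - intros u Hu. apply is_derive_Rplus; [apply Hdesc; lra|]. auto_derive; [trivial|ring].
        - intros u Hu. apply continuous_Rplus; [apply Hcv|]. cont_deriv.
        - intros u Hu. destruct (Hdesc u ltac:(lra)) as [D1 [D2 _]].
          specialize (Hlow u ltac:(lra)). specialize (HQ u (r u) ltac:(lra)).
          assert (Hcu : 0 < cos u <= 1). { split; [apply cos_gt_0; lra|apply COS_bound]. }
          assert (Hsw := sqrt_lt_R0 _ D2).
          assert (Hw : c * cos u <= sqrt (W2 u (r u) (Rmin (v u) 0))).
          { rewrite <- (sqrt_pow2 (c * cos u)) by (apply Rmult_le_pos; lra).
            apply sqrt_le_1_alt. rewrite Rpow_mult_distr. exact Hlow. }
          set (w := sqrt (W2 u (r u) (Rmin (v u) 0))) in *. clearbody w.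
          assert (Hqw : Q u (r u) / w <= H / c).
          { apply Rmult_le_reg_r with (w * c); [nra|].
            replace (Q u (r u) / w * (w * c)) with (Q u (r u) * c) by (field; lra).
            replace (H / c * (w * c)) with (H * w) by (field; lra).
            apply Rle_trans with (H * cos u ^ 2 * c); [apply Rmult_le_compat_r; lra|].
            rewrite Rmult_assoc. apply Rmult_le_compat_l; [lra|].
            assert (cos u * (cos u * c) <= 1 * w) by (apply Rmult_le_compat; nra). nra. }
          nra. }
      rewrite Hv0 in H0. unfold N. assert (H / c * x <= H / c * 1.6) by (apply Rmult_le_compat_l; lra). lra. }
    (* Since w >= d and min (nu, 0) >= - N, the logarithmic derivative of r is at least - N / d, so
       r times exp (N u / d) cannot decrease to 0. *)
    assert (Hrx : 0 < r x).
    { assert (r 0 * exp (N / d * 0) <= r x * exp (N / d * x)).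
      { apply (nondecreasing_of_derive (fun u => r u * exp (N / d * u)) (fun u =>
          (a * Rmin (v u) 0 * r u * cos u ^ 2 / sqrt (W2 u (r u) (Rmin (v u) 0))) * exp (N / d * u)
          + r u * (N / d * exp (N / d * u)))); [lra| | |].
        - intros u Hu. apply (is_derive_Rmult r (fun u => exp (N / d * u))); [apply Hdesc; lra|].
          auto_derive; [trivial|ring].
        - intros u Hu. apply continuous_Rmult; [apply Hcr|]. cont_deriv.
        - intros u Hu. destruct (Hdesc u ltac:(lra)) as [D1 [D2 _]].
          destruct (HG u (Hy u ltac:(lra))) as [G1 [G2 G3]].
          assert (Hru := Hrle u ltac:(lra)). rewrite clamp_id in G3 by lra.
          assert (Hw : d <= sqrt (W2 u (r u) (Rmin (v u) 0))).
          { rewrite <- (sqrt_pow2 d) by lra. apply sqrt_le_1_alt. lra. }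
          set (w := sqrt (W2 u (r u) (Rmin (v u) 0))) in *. clearbody w.
          assert (Hmn : - N <= Rmin (v u) 0) by (apply Rmin_glb; lra).
          assert (Hmn0 : Rmin (v u) 0 <= 0) by apply Rmin_r.
          set (p := Rmin (v u) 0) in *. clearbody p.
          assert (Hcu : 0 <= cos u ^ 2 <= 1).
          { assert (Hb := COS_bound u). split; nra. }
          set (cc := cos u ^ 2) in *. clearbody cc.
          replace (a * p * r u * cc / w * exp (N / d * u) + r u * (N / d * exp (N / d * u)))
            with (r u * exp (N / d * u) * (N / d - a * - p * cc / w)) by (field; lra).
          apply Rmult_le_pos; [apply Rmult_le_pos; [lra|left; apply exp_pos]|].
          assert (a * - p * cc / w <= N / d); [|lra].
          assert (Hiw : 0 < / w <= / d).
          { split; [apply Rinv_0_lt_compat; lra|apply Rinv_le_contravar; lra]. }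
          assert (Hapc : 0 <= a * - p * cc <= N).
          { assert (0 <= a * - p <= N) by nra. nra. }
          apply Rmult_le_compat; lra. }
      rewrite Rmult_0_r, exp_0 in H0. assert (He' := exp_pos (N / d * x)). nra. }
    assert (Hrxm := Hrle x ltac:(lra)).
    unfold G. rewrite clamp_id by lra. apply Rmin_glb_lt; [lra|apply Rmin_glb_lt; [lra|]].
    assert (d ^ 2 < W2 x (r x) (Rmin (v x) 0)); [|lra].
    apply HWlow; [lra|lra|lra|].
    (* The descent is known only to the left of x; the angular momentum bound reaches x by
       continuity. *)
    assert (0 <= W2 x (clamp 0 rmax (r x)) (Rmin (v x) 0) - c ^ 2 * cos x ^ 2).
    { apply (nonneg_at_right_end (fun x => W2 x (clamp 0 rmax (r x)) (Rmin (v x) 0) - c ^ 2 * cos x ^ 2) 0 x); [lra| |].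
      - apply continuous_Rminus; [apply HcW|]. cont_deriv.
      - intros u Hu. destruct (Hdesc u Hu) as [D1 _]. rewrite clamp_id by lra.
        specialize (Hlow u Hu). lra. }
    rewrite clamp_id in H0 by lra. lra. }
intros u Hu. destruct (HG u (HGall u Hu)) as [G1 [G2 G3]]. assert (Hru := Hrle u Hu).
rewrite clamp_id in G3 by lra. lra.
Qed.

(* A lower bound, diverging as e1 -> 0, for the elapsed time int du / w when w <= e1 + C u. *)
Definition slow_clock (e1 C u : R) : R := ln (1 + C * u / e1) / C.

Lemma slow_clock_derive e1 C u : 0 < e1 -> 0 < C -> 0 <= u ->
  is_derive (slow_clock e1 C) u (/ (e1 + C * u)).
Proof.
intros He HC Hu. assert (0 <= C * u) by (apply Rmult_le_pos; lra).
assert (0 < 1 + C * u * / e1).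
{ assert (0 <= C * u * / e1); [|lra]. apply Rmult_le_pos; [lra|left; apply Rinv_0_lt_compat, He]. }
unfold slow_clock. auto_derive; [exact H0|]. field. lra.
Qed.

Lemma slow_clock_0 e1 C : slow_clock e1 C 0 = 0.
Proof. unfold slow_clock. replace (1 + C * 0 / e1) with 1 by (unfold Rdiv; ring). rewrite ln_1. unfold Rdiv; ring. Qed.

Lemma slow_clock_nonneg e1 C u : 0 < e1 -> 0 < C -> 0 <= u -> 0 <= slow_clock e1 C u.
Proof.
intros He HC Hu. unfold slow_clock.
apply Rmult_le_pos; [|left; apply Rinv_0_lt_compat, HC].
rewrite <- ln_1. apply ln_le; [lra|].
assert (0 <= C * u / e1); [|lra].
apply Rmult_le_pos; [apply Rmult_le_pos; lra|left; apply Rinv_0_lt_compat, He].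
Qed.

(** * The almost homothetic fall *)

Section FallEstimates.
Variables (r v : R -> R) (rho K C e1 x : R).
Hypothesis desc : descent (PI / 2) r v.
Hypothesis v0 : v 0 = 0.
Hypothesis rho_pos : 0 < rho.
Hypothesis K_pos : 0 < K.
Hypothesis HK : forall r th, rho <= r <= rmax -> 0 <= th <= a / 2 -> Uth r th <= K * th.
Hypothesis C_pos : 0 < C.
Hypothesis HC : C ^ 2 = rmax ^ 2 * K / rho.
Hypothesis e1_pos : 0 < e1.
Hypothesis He1 : 2 * rmax * Phi (r 0) / rho <= e1 ^ 2.
Hypothesis x_range : 0 <= x <= 1 / 2.
Hypothesis r_large : forall u, 0 <= u <= x -> rho <= r u.
Hypothesis w_small : (e1 + C * x) ^ 2 <= rho / 2.

Lemma x_lt : x < PI / 2.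
Proof. assert (H := PI2_3_2). lra. Qed.

(** The torque is at most linear in th <= a u, so the momentum exceeds its initial value r 0 Phi (r
    0) by a quadratic term in u. After division by r >= rho the two parts are at most e1^2 and (C
    u)^2. *)
Lemma fall_momentum u : 0 <= u <= x -> 2 * momentum r v u / r u <= (e1 + C * u) ^ 2.
Proof.
intros Hu. assert (Hx := x_lt). assert (Ha := a_bounds). assert (Ha' := a_lt). assert (Hrm := rmax_pos).
assert (HP := PI2_3_2).
assert (Hm : momentum r v u - momentum r v 0 <= rmax ^ 2 * K / 2 * u ^ 2 - rmax ^ 2 * K / 2 * 0 ^ 2).
{ apply (le_of_derive_le (momentum r v) (fun t => rmax ^ 2 * K / 2 * t ^ 2)
    (fun t => r t ^ 2 * Uth (r t) (a * sin t) * (a * cos t)) (fun t => rmax ^ 2 * K * t) 0 u); [lra| | |].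
  - intros t Ht. apply (momentum_derive (PI / 2)); [lra|exact desc|lra].
  - intros t Ht. auto_derive; [trivial|field].
  - intros t Ht. destruct (desc t ltac:(lra)) as [Hr _]. assert (Hrl := r_large t ltac:(lra)).
    assert (Hth := theta_range t ltac:(lra)).
    assert (Hs := sin_le_id t ltac:(lra)).
    assert (Hc : 0 <= cos t <= 1) by (split; [apply cos_ge_0; lra|apply COS_bound]).
    assert (Hat : a * sin t <= a / 2).
    { replace (a / 2) with (a * (1 / 2)) by field. apply Rmult_le_compat_l; lra. }
    assert (H1 := HK (r t) (a * sin t) ltac:(lra) ltac:(lra)).
    assert (H2 : 0 <= Uth (r t) (a * sin t)) by (apply Uth_nonneg; lra).
    assert (H3 : Uth (r t) (a * sin t) * (a * cos t) <= K * t * 1).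
    { apply Rmult_le_compat; [lra|apply Rmult_le_pos; lra| |nra].
      eapply Rle_trans; [exact H1|]. apply Rmult_le_compat_l; [lra|]. nra. }
    rewrite Rmult_assoc. rewrite (Rmult_assoc (rmax ^ 2)).
    apply Rmult_le_compat; [apply pow2_ge_0| |apply pow_incr; lra|lra].
    apply Rmult_le_pos; [lra|apply Rmult_le_pos; lra]. }
assert (E0 := momentum_0 (PI / 2) r v desc ltac:(lra) v0).
destruct (desc u ltac:(lra)) as [Hr _]. assert (Hrl := r_large u Hu).
destruct (desc 0 ltac:(lra)) as [Hr0 _].
fold (Phi (r 0)) in E0.
assert (Hphi : 0 <= Phi (r 0)).
{ destruct (desc 0 ltac:(lra)) as [_ [HW _]]. rewrite (W2_momentum (PI / 2)) in HW; [|lra|exact desc|lra].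
  rewrite E0, cos_0 in HW.
  replace (2 * 1 ^ 2 * (r 0 * Phi (r 0)) / r 0) with (2 * Phi (r 0)) in HW by (field; lra). lra. }
assert (Hmu : momentum r v u <= rmax * Phi (r 0) + rmax ^ 2 * K / 2 * u ^ 2).
{ assert (r 0 * Phi (r 0) <= rmax * Phi (r 0)) by (apply Rmult_le_compat_r; lra). lra. }
assert (Hbig : 0 <= rmax * Phi (r 0) + rmax ^ 2 * K / 2 * u ^ 2).
{ apply Rplus_le_le_0_compat; [apply Rmult_le_pos; lra|]. apply Rmult_le_pos; [|apply pow2_ge_0].
  apply Rmult_le_pos; [|lra]. apply Rmult_le_pos; [apply pow2_ge_0|lra]. }
apply Rle_trans with (2 * (rmax * Phi (r 0) + rmax ^ 2 * K / 2 * u ^ 2) / rho).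
{ unfold Rdiv. apply Rle_trans with (2 * (rmax * Phi (r 0) + rmax ^ 2 * K * / 2 * u ^ 2) * / r u).
  - apply Rmult_le_compat_r; [left; apply Rinv_0_lt_compat; lra|]. unfold Rdiv in Hmu. lra.
  - apply Rmult_le_compat_l; [unfold Rdiv in Hbig; lra|]. apply Rinv_le_contravar; lra. }
replace (2 * (rmax * Phi (r 0) + rmax ^ 2 * K / 2 * u ^ 2) / rho)
  with (2 * rmax * Phi (r 0) / rho + (rmax ^ 2 * K / rho) * u ^ 2) by (field; lra).
rewrite <- HC. assert (0 <= e1 * (C * u)) by (apply Rmult_le_pos; [lra|apply Rmult_le_pos; lra]).
nra.
Qed.

Lemma fall_w u : 0 <= u <= x -> 0 < sqrt (W2 u (r u) (Rmin (v u) 0)) <= e1 + C * u.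
Proof.
intros Hu. assert (Hx := x_lt). destruct (desc u ltac:(lra)) as [Hr [HW _]].
split; [apply sqrt_lt_R0, HW|].
assert (0 <= C * u) by (apply Rmult_le_pos; lra).
rewrite <- (sqrt_pow2 (e1 + C * u)) by lra. apply sqrt_le_1_alt.
rewrite (W2_momentum (PI / 2)) in * by (exact desc || lra).
assert (Hm := fall_momentum u Hu).
assert (Hcu : 0 <= cos u ^ 2 <= 1).
{ assert (Hb := COS_bound u). split; nra. }
assert (Hc0 : 0 < cos u ^ 2).
{ assert (0 < cos u) by (apply cos_gt_0; lra). nra. }
replace (2 * cos u ^ 2 * momentum r v u / r u) with (cos u ^ 2 * (2 * momentum r v u / r u)) in * by (field; lra).
assert (0 < 2 * momentum r v u / r u) by nra. nra.
Qed.

Lemma cos2_lower u : 0 <= u <= x -> 1 / 2 <= cos u ^ 2.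
Proof.
intros Hu. assert (Hc := cos_ge_quadratic u). assert (u ^ 2 <= 1 / 4) by nra. nra.
Qed.

(** While w^2 <= rho / 2 and Q >= rho / 2, one has w / 2 - Q / w <= - (rho / 4) / w, and 1 / w is at
    least the rate of the slow clock. *)
Lemma fall_v u : 0 <= u <= x -> v u <= - (a * rho / 4) * slow_clock e1 C u.
Proof.
intros Hu. assert (Hx := x_lt). assert (Ha := a_bounds).
assert (H : v u - v 0 <= - (a * rho / 4) * slow_clock e1 C u - - (a * rho / 4) * slow_clock e1 C 0).
{ apply (le_of_derive_le v (fun t => - (a * rho / 4) * slow_clock e1 C t)
   (fun t => a * (sqrt (W2 t (r t) (Rmin (v t) 0)) / 2 - Q t (r t) / sqrt (W2 t (r t) (Rmin (v t) 0))))
   (fun t => - (a * rho / 4) * / (e1 + C * t)) 0 u); [lra| | |].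
  - intros t Ht. apply desc. lra.
  - intros t Ht. apply is_derive_Rscal, slow_clock_derive; lra.
  - intros t Ht. destruct (desc t ltac:(lra)) as [Hr [HW _]].
    assert (Hw := fall_w t ltac:(lra)). assert (Hrl := r_large t ltac:(lra)).
    assert (HQ : r t * cos t ^ 2 <= Q t (r t)) by (apply Q_lower; lra). assert (Hc := cos2_lower t ltac:(lra)).
    set (w := sqrt (W2 t (r t) (Rmin (v t) 0))) in *. clearbody w.
    assert (Hct : C * t <= C * x) by (apply Rmult_le_compat_l; lra).
    assert (Hw2 : w ^ 2 <= rho / 2) by nra.
    assert (HQ' : rho / 2 <= Q t (r t)) by nra.
    assert (Hi : / (e1 + C * t) <= / w) by (apply Rinv_le_contravar; lra).
    assert (Hiw : 0 < / w) by (apply Rinv_0_lt_compat; lra).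
    assert (H1 : w / 2 - Q t (r t) / w <= - (rho / 4) * / w).
    { apply Rmult_le_reg_r with w; [lra|].
      replace ((w / 2 - Q t (r t) / w) * w) with (w ^ 2 / 2 - Q t (r t)) by (field; lra).
      replace (- (rho / 4) * / w * w) with (- (rho / 4)) by (field; lra). lra. }
    apply Rle_trans with (a * (- (rho / 4) * / w)); [apply Rmult_le_compat_l; lra|].
    assert (a * rho / 4 * / (e1 + C * t) <= a * rho / 4 * / w).
    { apply Rmult_le_compat_l; [nra|exact Hi]. }
    lra. }
rewrite v0, slow_clock_0 in H. lra.
Qed.

(** The logarithmic derivative of r is theta_* nu cos^2 u / w; inserting [fall_v] and cos^2 u >= 1 /
    2 makes it at most the derivative of a multiple of the squared clock. For a long enough clock, r
    must therefore leave [rho, rmax]. *)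
Lemma fall_r : ln (r x) <= ln (r 0) - a ^ 2 * rho / 16 * slow_clock e1 C x ^ 2.
Proof.
assert (Hx := x_lt). assert (Ha := a_bounds).
assert (H : ln (r x) - ln (r 0) <= - (a ^ 2 * rho / 16) * slow_clock e1 C x ^ 2
   - - (a ^ 2 * rho / 16) * slow_clock e1 C 0 ^ 2).
{ apply (le_of_derive_le (fun t => ln (r t)) (fun t => - (a ^ 2 * rho / 16) * slow_clock e1 C t ^ 2)
   (fun t => / r t * (a * Rmin (v t) 0 * r t * cos t ^ 2 / sqrt (W2 t (r t) (Rmin (v t) 0))))
   (fun t => - (a ^ 2 * rho / 16) * (2 * slow_clock e1 C t * / (e1 + C * t))) 0 x); [lra| | |].
  - intros t Ht. destruct (desc t ltac:(lra)) as [Hr [_ [Hd _]]].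
    apply (is_derive_comp_real ln r); [|exact Hd]. apply is_derive_Reals, derivable_pt_lim_ln. lra.
  - intros t Ht. apply is_derive_Rscal.
    apply (is_derive_comp_real (fun y => y ^ 2) (slow_clock e1 C)).
    + auto_derive; [trivial|ring].
    + apply slow_clock_derive; lra.
  - intros t Ht. destruct (desc t ltac:(lra)) as [Hr [HW _]].
    assert (Hw := fall_w t ltac:(lra)). assert (Hv := fall_v t ltac:(lra)).
    assert (Hc := cos2_lower t ltac:(lra)).
    assert (HL := slow_clock_nonneg e1 C t e1_pos C_pos ltac:(lra)).
    set (L := slow_clock e1 C t) in *. clearbody L.
    set (w := sqrt (W2 t (r t) (Rmin (v t) 0))) in *. clearbody w.
    assert (Hi : / (e1 + C * t) <= / w) by (apply Rinv_le_contravar; lra).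
    assert (Hi0 : 0 < / (e1 + C * t)) by (apply Rinv_0_lt_compat; lra).
    assert (Hp : Rmin (v t) 0 <= - (a * rho / 4) * L).
    { eapply Rle_trans; [apply Rmin_l|exact Hv]. }
    set (p := Rmin (v t) 0) in *. clearbody p.
    replace (/ r t * (a * p * r t * cos t ^ 2 / w)) with (- (a * - p * cos t ^ 2 * / w)) by (field; lra).
    set (qq := a * rho / 4 * L) in *.
    assert (Hqq : 0 <= qq) by (apply Rmult_le_pos; [nra|exact HL]).
    assert (H1 : a * qq * (1 / 2) * / (e1 + C * t) <= a * - p * cos t ^ 2 * / w).
    { apply Rmult_le_compat; [apply Rmult_le_pos; [apply Rmult_le_pos; lra|lra]|lra| |exact Hi].
      apply Rmult_le_compat; [apply Rmult_le_pos; lra|lra| |exact Hc].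
      apply Rmult_le_compat_l; [lra|]. unfold qq. lra. }
    replace (- (a ^ 2 * rho / 16) * (2 * L * / (e1 + C * t)))
      with (- (a * qq * (1 / 2) * / (e1 + C * t))) by (unfold qq; field; lra).
    lra. }
rewrite slow_clock_0 in H. lra.
Qed.

End FallEstimates.

(** With e = C eta exp (- C L) the clock at eta reads ln (1 + exp (C L)) / C >= L. *)
Lemma slow_clock_diverges C eta L : 0 < C -> 0 < eta -> 0 <= L ->
  exists e, 0 < e <= C * eta /\ L <= slow_clock e C eta.
Proof.
intros HC He HL.
assert (HCe : 0 < C * eta) by (apply Rmult_lt_0_compat; assumption).
assert (Hx := exp_pos (- (C * L))).
exists (C * eta * exp (- (C * L))). split; [split|].
- apply Rmult_lt_0_compat; assumption.
- rewrite <- (Rmult_1_r (C * eta)) at 2. apply Rmult_le_compat_l; [lra|].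
  rewrite <- exp_0. assert (0 <= C * L) by (apply Rmult_le_pos; lra).
  destruct (Rle_lt_or_eq_dec 0 (C * L) H) as [Hlt|<-]; [left; apply exp_increasing; lra|].
  rewrite Ropp_0. lra.
- unfold slow_clock. apply Rmult_le_reg_r with C; [exact HC|].
  replace (ln (1 + C * eta / (C * eta * exp (- (C * L)))) / C * C)
    with (ln (1 + C * eta / (C * eta * exp (- (C * L))))) by (field; lra).
  replace (C * eta / (C * eta * exp (- (C * L)))) with (exp (C * L)).
  + rewrite <- (ln_exp (L * C)). apply ln_le; [apply exp_pos|]. rewrite (Rmult_comm L C). lra.
  + rewrite exp_Ropp. field. assert (Hy := exp_pos (C * L)). lra.
Qed.

Lemma F_Euler_derive r : 0 <= r <= rmax -> is_derive (fun r => F r 0) r (D r 0).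
Proof.
intros Hr. evar_last.
- apply (is_derive_F (fun r => r) (fun _ => 0) r 1 0).
  + apply (is_derive_id (K := R_AbsRing)).
  + apply (is_derive_const (V := R_NormedModule)).
  + apply regular_small; [rewrite Rabs_R0; left; apply a_bounds|exact Hr].
- ring.
Qed.

Lemma Phi_decreasing x y : 0 <= x <= y -> y <= rmax -> Phi y - Phi x <= h * (y - x).
Proof.
intros Hx Hy.
assert (H := le_of_derive_le (fun r => F r 0) (fun _ => 0) (fun r => D r 0) (fun _ => 0) x y ltac:(lra)).
cbv beta in H. assert (F y 0 - F x 0 <= 0 - 0); [|unfold Phi; lra].
apply H.
- intros r Hr. apply F_Euler_derive. lra.
- intros r Hr. apply (is_derive_const (V := R_NormedModule)).
- intros r Hr. apply D_nonpos; [rewrite Rabs_R0; left; apply a_bounds|lra].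
Qed.

Lemma Phi_rmax : Phi rmax <= 0.
Proof.
assert (Hk := kap_pos). assert (Hr := rmax_pos). assert (Hh := h_le). assert (Hs := mass_sum).
assert (HF : F rmax 0 <= V0) by (apply F_le_V0; lra).
assert (HV : V0 <= rmax).
{ unfold V0, rmax. apply Rmult_le_reg_r with kap; [exact Hk|].
  replace ((n ^ 2 + 4 * (n * m)) / kap * kap) with (n ^ 2 + 4 * (n * m)) by (field; lra).
  replace (4 / (7 * kap) * kap) with (4 / 7) by (field; lra).
  (* Under the mass normalization n^2 + 4 n m = 4 n - 7 n^2 = 4 / 7 - (7 n - 2)^2 / 7. *)
  replace m with (1 - 2 * n) by lra. assert (Hq := pow2_ge_0 (7 * n - 2)). nra. }
unfold Phi. assert (rmax * h <= rmax * - 1) by (apply Rmult_le_compat_l; lra). lra.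
Qed.

Lemma Phi_continuous r : 0 <= r <= rmax -> continuous Phi r.
Proof.
intros Hr. unfold Phi. apply continuous_Rplus.
- eapply is_derive_continuous, F_Euler_derive, Hr.
- cont_deriv.
Qed.

Lemma Phi_0 : 0 < Phi 0.
Proof.
assert (Hr := rmax_pos). assert (HV := V0_pos).
assert (HF : (1 - (kap * 0) ^ 2 / 2) * V0 <= F 0 0) by (apply F_ge_V0; lra).
unfold Phi. rewrite Rmult_0_r in HF. lra.
Qed.

(* The zero-velocity radius on the Euler line. *)
Lemma zero_velocity_radius : exists rM, 0 < rM <= rmax /\ Phi rM = 0 /\
  forall r, 0 <= r < rM -> 0 < Phi r.
Proof.
assert (Hr := rmax_pos). assert (H0 := Phi_0). assert (H1 := Phi_rmax). assert (Hh := h_le).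
assert (Hcl : forall y, 0 <= clamp 0 rmax y <= rmax) by (intros y; apply clamp_bounds; lra).
destruct (IVT_cor (fun x => Phi (clamp 0 rmax x)) 0 rmax) as [rM [HM HE]].
- intros x. apply continuity_pt_filterlim.
  apply (continuous_comp_real Phi (clamp 0 rmax)).
  + apply (lipschitz_continuous _ 1); [lra|]. intros s t. rewrite Rmult_1_l. apply clamp_lipschitz.
  + apply Phi_continuous, Hcl.
- lra.
- rewrite !clamp_id by lra. nra.
- rewrite clamp_id in HE by lra. exists rM.
  assert (rM <> 0) by (intros E; rewrite E in HE; lra).
  split; [lra|split; [exact HE|]]. intros r Hrr.
  assert (Hd := Phi_decreasing r rM ltac:(lra) ltac:(lra)).
  assert (0 < - h * (rM - r)) by (apply Rmult_lt_0_compat; lra). lra.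
Qed.

(* Released with little angular momentum near the zero-velocity radius, the bodies almost collide
   homothetically before theta grows; nu is then about - sqrt (2 V0), which the rest of the
   passage cannot compensate since theta_* < pi / 4. *)
Lemma near_zero_velocity_ends_inward : exists rB, 0 < rB <= rmax /\ 0 < Phi rB /\
  forall r v, descent (PI / 2) r v -> (forall u, continuous r u) -> (forall u, continuous v u) ->
    r 0 = rB -> v 0 = 0 -> v (PI / 2) < 0.
Proof.
assert (Hrm := rmax_pos). assert (Hh := h_le). assert (HV := V0_pos). assert (Hk := kap_pos).
assert (Ha := a_bounds). assert (Ha' := a_lt). assert (HPu := PI_upper). assert (HPl := PI2_3_2).
destruct zero_velocity_radius as [rM [HrM [HPM HPpos]]].
(* The condition kap rho <= 1 / 4 costs at most V0 / 32, the energy term at most V0 / 20, and 31 /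
   32 - 1 / 20 > 9 / 10. *)
assert (Hrho : exists rho, 0 < rho < rM /\ 9 / 10 * V0 <= Phi rho).
{ exists (Rmin (rM / 2) (Rmin (V0 / (- 20 * h)) (1 / (4 * kap)))).
  assert (M1 := Rmin_l (rM / 2) (Rmin (V0 / (- 20 * h)) (1 / (4 * kap)))).
  assert (M2 := Rmin_r (rM / 2) (Rmin (V0 / (- 20 * h)) (1 / (4 * kap)))).
  assert (M3 := Rmin_l (V0 / (- 20 * h)) (1 / (4 * kap))).
  assert (M4 := Rmin_r (V0 / (- 20 * h)) (1 / (4 * kap))).
  assert (Hpos : 0 < Rmin (rM / 2) (Rmin (V0 / (- 20 * h)) (1 / (4 * kap)))).
  { apply Rmin_glb_lt; [lra|apply Rmin_glb_lt; apply Rdiv_lt_0_compat; lra]. }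
  set (rho := Rmin (rM / 2) (Rmin (V0 / (- 20 * h)) (1 / (4 * kap)))) in *.
  split; [lra|].
  assert (HF : (1 - (kap * rho) ^ 2 / 2) * V0 <= F rho 0) by (apply F_ge_V0; lra).
  assert (kap * rho <= 1 / 4).
  { apply Rle_trans with (kap * (1 / (4 * kap))); [apply Rmult_le_compat_l; lra|]. right; field; lra. }
  assert (0 < kap * rho) by (apply Rmult_lt_0_compat; lra).
  assert (rho * - h <= V0 / 20).
  { apply Rle_trans with (V0 / (- 20 * h) * - h); [apply Rmult_le_compat_r; lra|]. right; field; lra. }
  unfold Phi. assert ((kap * rho) ^ 2 <= 1 / 16) by nra.
  assert (31 / 32 * V0 <= (1 - (kap * rho) ^ 2 / 2) * V0) by (apply Rmult_le_compat_r; lra). lra. }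
destruct Hrho as [rho [Hrho HPrho]].
destruct (Uth_linear rho (proj1 Hrho)) as [K [HK HU]].
set (C := rmax * sqrt (K / rho)).
assert (HKr : 0 < K / rho) by (apply Rdiv_lt_0_compat; lra).
assert (HC : 0 < C) by (apply Rmult_lt_0_compat; [lra|apply sqrt_lt_R0, HKr]).
assert (HC2 : C ^ 2 = rmax ^ 2 * K / rho).
{ unfold C. rewrite Rpow_mult_distr, pow2_sqrt by lra. unfold Rdiv. ring. }
clearbody C.
set (sg := Rmin (rho / 2) (V0 / 10)).
assert (Hsg : 0 < sg) by (apply Rmin_glb_lt; lra).
assert (Hsg1 : sg <= rho / 2) by apply Rmin_l.
assert (Hsg2 : sg <= V0 / 10) by apply Rmin_r.
clearbody sg.
assert (Hss := sqrt_lt_R0 _ Hsg). assert (Hss2 := pow2_sqrt sg (Rlt_le _ _ Hsg)).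
(* As e1 <= C eta will hold, e1 + C u <= 2 C eta <= sqrt sg throughout [0, eta]. *)
set (eta := Rmin (1 / 2) (sqrt sg / (2 * C))).
assert (Heta : 0 < eta) by (apply Rmin_glb_lt; [lra|apply Rdiv_lt_0_compat; lra]).
assert (Heta1 : eta <= 1 / 2) by apply Rmin_l.
assert (Heta2 : (2 * (C * eta)) ^ 2 <= sg).
{ rewrite <- Hss2. apply pow_incr. split; [assert (0 < C * eta) by (apply Rmult_lt_0_compat; lra); lra|].
  apply Rle_trans with (2 * (C * (sqrt sg / (2 * C)))).
  - apply Rmult_le_compat_l; [lra|]. apply Rmult_le_compat_l; [lra|]. apply Rmin_r.
  - right. field. lra. }
clearbody eta.
assert (Hln : 0 <= ln rmax - ln rho).
{ assert (ln rho <= ln rmax) by (apply ln_le; lra). lra. }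
assert (Har : 0 < a ^ 2 * rho) by (apply Rmult_lt_0_compat; [nra|lra]).
(* A clock reading for which [fall_r] brings r from at most [rmax] to below rho; Ls >= 1 allows Ls
   to be replaced by its square. *)
set (Ls := 1 + (ln rmax - ln rho) * 16 / (a ^ 2 * rho)).
assert (HLs : 1 <= Ls).
{ assert (0 <= (ln rmax - ln rho) * 16 / (a ^ 2 * rho)); [|unfold Ls; lra].
  apply Rmult_le_pos; [lra|left; apply Rinv_0_lt_compat, Har]. }
assert (HLs2 : ln rmax - ln rho < a ^ 2 * rho / 16 * Ls ^ 2).
{ apply Rlt_le_trans with (a ^ 2 * rho / 16 * Ls).
  - unfold Ls. replace (a ^ 2 * rho / 16 * (1 + (ln rmax - ln rho) * 16 / (a ^ 2 * rho)))
      with (a ^ 2 * rho / 16 + (ln rmax - ln rho)) by (field; nra). lra.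
  - apply Rmult_le_compat_l; [lra|]. nra. }
clearbody Ls.
destruct (slow_clock_diverges C eta Ls HC Heta ltac:(lra)) as [e1 [He1 HLe]].
assert (Hgoal : 0 < rho * e1 ^ 2 / (2 * rmax)).
{ apply Rdiv_lt_0_compat; [apply Rmult_lt_0_compat; [lra|nra]|lra]. }
(* The release radius is chosen last: Phi vanishes at rM, so the energy excess can be made small
   relative to e1, which depends on all the earlier choices. *)
assert (HrB : exists rB, rho < rB < rM /\ Phi rB <= rho * e1 ^ 2 / (2 * rmax)).
{ assert (HPc : continuous Phi rM) by (apply Phi_continuous; lra).
  destruct (proj1 (filterlim_locally Phi (Phi rM)) HPc (mkposreal _ Hgoal)) as [dl Hdl].
  assert (Hdp := cond_pos dl).
  exists (Rmax ((rho + rM) / 2) (rM - dl / 2)).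
  assert (M1 := Rmax_l ((rho + rM) / 2) (rM - dl / 2)).
  assert (M2 := Rmax_r ((rho + rM) / 2) (rM - dl / 2)).
  assert (M3 : Rmax ((rho + rM) / 2) (rM - dl / 2) < rM) by (apply Rmax_lub_lt; lra).
  set (rB := Rmax ((rho + rM) / 2) (rM - dl / 2)) in *.
  split; [lra|].
  assert (Hb : Rabs (Phi rB - Phi rM) < rho * e1 ^ 2 / (2 * rmax)).
  { apply Hdl. change (Rabs (rB - rM) < dl). rewrite Rabs_left; lra. }
  apply Rabs_def2 in Hb. lra. }
destruct HrB as [rB [HrB HPB]].
exists rB. split; [lra|split; [apply HPpos; lra|]].
intros r v Hd Hcr Hcv Hr0 Hv0.
assert (Hen : 2 * rmax * Phi (r 0) / rho <= e1 ^ 2).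
{ rewrite Hr0. apply Rle_trans with (2 * rmax * (rho * e1 ^ 2 / (2 * rmax)) / rho).
  - unfold Rdiv at 1 3. apply Rmult_le_compat_r; [left; apply Rinv_0_lt_compat; lra|].
    apply Rmult_le_compat_l; lra.
  - right. field. lra. }
assert (Hmono := descent_r_nonincreasing (PI / 2) r v Hd).
assert (Hsmall : forall u, 0 <= u <= eta -> (e1 + C * u) ^ 2 <= sg).
{ intros u Hu. eapply Rle_trans; [|exact Heta2]. apply pow_incr.
  assert (0 <= C * u <= C * eta).
  { split; [apply Rmult_le_pos; lra|apply Rmult_le_compat_l; lra]. }
  lra. }
assert (Hfall : r eta < rho).
{ destruct (Rlt_dec (r eta) rho) as [|Hn]; [assumption|exfalso].
  assert (Hlow : forall u, 0 <= u <= eta -> rho <= r u).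
  { intros u Hu. specialize (Hmono u eta ltac:(lra) ltac:(lra)). lra. }
  assert (Hse := Hsmall eta ltac:(lra)).
  assert (H := fall_r r v rho K C e1 eta Hd Hv0 (proj1 Hrho) HK HU HC HC2 (proj1 He1) Hen
    ltac:(lra) Hlow ltac:(lra)).
  assert (ln rho <= ln (r eta)) by (apply ln_le; lra).
  assert (ln (r 0) <= ln rmax) by (apply ln_le; lra).
  assert (Ls ^ 2 <= slow_clock e1 C eta ^ 2) by (apply pow_incr; lra).
  assert (a ^ 2 * rho / 16 * Ls ^ 2 <= a ^ 2 * rho / 16 * slow_clock e1 C eta ^ 2).
  { apply Rmult_le_compat_l; lra. }
  lra. }
destruct (IVT_cor (fun u => r u - rho) 0 eta) as [u1 [Hu1 Hru1]].
{ intros x. apply continuity_pt_filterlim.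
  apply (continuous_Rminus r (fun _ => rho)); [apply Hcr|apply continuous_const]. }
{ lra. }
{ cbv beta. nra. }
assert (Hlow : forall u, 0 <= u <= u1 -> rho <= r u).
{ intros u Hu. specialize (Hmono u u1 ltac:(lra) ltac:(lra)). lra. }
assert (Hse := Hsmall u1 Hu1).
assert (Hv1 := fall_v r v rho K C e1 u1 Hd Hv0 (proj1 Hrho) HK HU HC HC2 (proj1 He1) Hen
    ltac:(lra) Hlow ltac:(lra) u1 ltac:(lra)).
assert (Hm1 := fall_momentum r v rho K C e1 u1 Hd Hv0 (proj1 Hrho) HK HU HC HC2 (proj1 He1) Hen
    ltac:(lra) Hlow u1 ltac:(lra)).
assert (Hcl := slow_clock_nonneg e1 C u1 (proj1 He1) HC (proj1 Hu1)).
assert (Hv1neg : v u1 <= 0).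
{ assert (0 <= a * rho / 4 * slow_clock e1 C u1); [|lra].
  apply Rmult_le_pos; [|exact Hcl]. nra. }
assert (Hru : r u1 = rho) by lra.
assert (Hth := theta_range u1 ltac:(lra)).
assert (HUp : Upot rho 0 <= Upot rho (a * sin u1)) by (apply Upot_monotone_th; lra).
assert (HF0 : F rho 0 = rho * Upot rho 0).
{ rewrite F_Upot, q_0; [ring| |lra|].
  - rewrite Rabs_R0. lra.
  - apply small_lt_PI; [rewrite Rabs_R0; lra|lra]. }
(* At radius rho, nu^2 = 2 rho (U + h) - 2 momentum / rho. Since U is least on the Euler line, this
   is at least 2 (9 / 10) V0 - V0 / 10. *)
assert (Hvsq : 17 / 10 * V0 <= v u1 ^ 2).
{ unfold momentum in Hm1. rewrite Rmin_left, Hru in Hm1 by lra.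
  replace (2 * (rho ^ 2 * (Upot rho (a * sin u1) + h) - rho * v u1 ^ 2 / 2) / rho)
    with (2 * (rho * (Upot rho (a * sin u1) + h)) - v u1 ^ 2) in Hm1 by (field; lra).
  unfold Phi in HPrho. rewrite HF0 in HPrho.
  assert (rho * Upot rho 0 <= rho * Upot rho (a * sin u1)) by (apply Rmult_le_compat_l; lra). lra. }
set (s := sqrt V0). assert (Hs : 0 < s) by (apply sqrt_lt_R0, HV).
assert (Hs2 : s ^ 2 = V0) by (apply pow2_sqrt; lra).
(* From F <= 2 V0 follows w <= 2 s; together with Q >= 0 the u-derivative of nu is at most a s. *)
assert (Hfin : v (PI / 2) - a * s * (PI / 2) <= v u1 - a * s * u1).
{ apply Ropp_le_cancel.
  apply (nondecreasing_of_derive (fun u => - (v u - a * s * u)) (fun u => -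
   (a * (sqrt (W2 u (r u) (Rmin (v u) 0)) / 2 - Q u (r u) / sqrt (W2 u (r u) (Rmin (v u) 0))) - a * s)));
   [lra| | |].
  - intros u Hu. apply (is_derive_opp (fun u => v u - a * s * u)).
    apply is_derive_Rminus; [apply Hd; lra|]. auto_derive; [trivial|ring].
  - intros u Hu. apply (continuous_opp (fun u => v u - a * s * u)).
    apply continuous_Rminus; [apply Hcv|]. cont_deriv.
  - intros u Hu. destruct (Hd u ltac:(lra)) as [Hr [HW _]].
    assert (HQ : r u * cos u ^ 2 <= Q u (r u)) by (apply Q_lower; lra).
    assert (Hcc := pow2_ge_0 (cos u)).
    assert (HQ0 : 0 <= Q u (r u)) by nra.
    assert (HF : F (r u) (a * sin u) <= 2 * V0) by (apply F_le; [apply Rabs_theta|lra]).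
    assert (Hw : sqrt (W2 u (r u) (Rmin (v u) 0)) <= 2 * s).
    { rewrite <- (sqrt_pow2 (2 * s)) by lra. apply sqrt_le_1_alt.
      unfold W2. assert (Hpp := pow2_ge_0 (Rmin (v u) 0)).
      assert (0 <= Rmin (v u) 0 ^ 2 * cos u ^ 2) by (apply Rmult_le_pos; lra).
      assert (0 <= r u * (- h * cos u ^ 2)).
      { apply Rmult_le_pos; [lra|apply Rmult_le_pos; lra]. }
      replace ((2 * s) ^ 2) with (4 * s ^ 2) by ring. rewrite Hs2. lra. }
    apply sqrt_lt_R0 in HW.
    set (w := sqrt (W2 u (r u) (Rmin (v u) 0))) in *. clearbody w.
    assert (0 <= Q u (r u) / w) by (apply Rmult_le_pos; [lra|left; apply Rinv_0_lt_compat, HW]).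
    assert (a * (w / 2 - Q u (r u) / w) <= a * s) by (apply Rmult_le_compat_l; lra). lra. }
(* Here 1.28 = (4 / 5) 1.6, and 1.28^2 = 1.6384 is below 17 / 10. *)
assert (Has : a * s * (PI / 2) <= 128 / 100 * s).
{ replace (a * s * (PI / 2)) with ((a * (PI / 2)) * s) by ring. apply Rmult_le_compat_r; [lra|]. nra. }
assert (0 <= a * s * u1) by (apply Rmult_le_pos; [apply Rmult_le_pos; lra|lra]).
assert (v u1 < - (128 / 100 * s)); [|lra].
destruct (Rlt_dec (v u1) (- (128 / 100 * s))) as [|Hn]; [assumption|exfalso].
assert (v u1 ^ 2 <= (128 / 100) ^ 2 * s ^ 2) by nra.
rewrite <- Hs2 in Hvsq. nra.
Qed.

(** For small r0 the derivative of nu at u = 0 is positive, so nu becomes positive at once and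
    [descent_v_stays_positive] carries this to pi / 2. *)
Lemma small_radius_ends_outward rB : 0 < rB <= rmax -> exists rA, 0 < rA < rB /\
  forall r v, descent (PI / 2) r v -> (forall u, continuous v u) ->
    r 0 = rA -> v 0 = 0 -> 0 < v (PI / 2).
Proof.
intros HrB. assert (HP := PI2_3_2). assert (Ha := a_bounds). assert (Hrm := rmax_pos).
(* The continuous extension of r times [Gam] on the Euler line to r = 0, where it takes the value F
   0 0 > 0. *)
set (M := fun r => F r 0 + 2 * r * h + r * D r 0).
assert (HM0 : 0 < M 0).
{ unfold M. assert (H := Phi_0). unfold Phi in H. lra. }
assert (HMc : continuous M 0).
{ assert (Hreg : regular 0 0).
  { apply regular_small; [rewrite Rabs_R0; lra|lra]. }
  unfold M. apply continuous_Rplus; [apply continuous_Rplus|].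
  - apply (continuous_path_F (fun r => r) (fun _ => 0)); [apply continuous_id|apply continuous_const|exact Hreg].
  - cont_deriv.
  - apply continuous_Rmult; [apply continuous_id|].
    apply (continuous_path_D (fun r => r) (fun _ => 0)); [apply continuous_id|apply continuous_const|exact Hreg]. }
destruct (proj1 (filterlim_locally M (M 0)) HMc (mkposreal _ HM0)) as [dl Hdl].
assert (Hdp := cond_pos dl).
exists (Rmin (rB / 2) (dl / 2)).
assert (M1 := Rmin_l (rB / 2) (dl / 2)). assert (M2 := Rmin_r (rB / 2) (dl / 2)).
assert (M3 : 0 < Rmin (rB / 2) (dl / 2)) by (apply Rmin_glb_lt; lra).
set (rA := Rmin (rB / 2) (dl / 2)) in *. clearbody rA.
split; [lra|].
intros r v Hd Hcv Hr0 Hv0.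
assert (HMA : 0 < M rA).
{ assert (Hb : Rabs (M rA - M 0) < M 0).
  { apply Hdl. change (Rabs (rA - 0) < dl). rewrite Rabs_pos_eq; lra. }
  apply Rabs_def2 in Hb. lra. }
destruct (Hd 0 ltac:(lra)) as [_ [HW [_ Hdv]]].
rewrite Hv0, Hr0, Rmin_left in Hdv, HW by lra.
assert (Hsw := sqrt_lt_R0 _ HW). assert (Hsq := pow2_sqrt _ (Rlt_le _ _ HW)).
set (w := sqrt (W2 0 rA 0)) in *.
set (l := a * (w / 2 - Q 0 rA / w)) in *.
assert (Hl : 0 < l).
{ unfold l. apply Rmult_lt_0_compat; [lra|].
  apply Rmult_lt_reg_r with w; [exact Hsw|].
  replace ((w / 2 - Q 0 rA / w) * w) with (w ^ 2 / 2 - Q 0 rA) by (field; lra).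
  rewrite Hsq. unfold W2, Q. rewrite sin_0, cos_0, Rmult_0_r. unfold M in HMA. lra. }
apply is_derive_Reals in Hdv. destruct (Hdv (l / 2) ltac:(lra)) as [d2 Hd2].
assert (Hd2p := cond_pos d2).
set (u1 := Rmin (d2 / 2) 1).
assert (Hu1 : 0 < u1 <= 1 /\ u1 <= d2 / 2).
{ unfold u1. split; [split; [apply Rmin_glb_lt; lra|apply Rmin_r]|apply Rmin_l]. }
clearbody u1.
specialize (Hd2 u1 ltac:(lra) ltac:(rewrite Rabs_pos_eq; lra)).
rewrite Rplus_0_l, Hv0, Rminus_0_r in Hd2. apply Rabs_def2 in Hd2.
assert (Hvu : 0 < v u1).
{ assert (Hq : l / 2 < v u1 / u1) by lra.
  apply Rmult_lt_compat_r with (r := u1) in Hq; [|lra].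
  replace (v u1 / u1 * u1) with (v u1) in Hq by (field; lra). nra. }
assert (H := descent_v_stays_positive r v u1 Hd Hv0 (fun u _ => Hcv u) ltac:(lra) Hvu (PI / 2) ltac:(lra)).
lra.
Qed.

Lemma shooting : exists d N r v, 0 < d /\ 0 < N /\
  clamped_solution d (- N) 0 r v /\ v 0 = 0 /\ v (PI / 2) = 0 /\
  forall u, 0 <= u <= PI / 2 ->
    0 < r u <= rmax /\ - N <= v u <= 0 /\ d ^ 2 <= W2 u (r u) (v u).
Proof.
assert (HP := PI2_3_2).
destruct near_zero_velocity_ends_inward as [rB [HrB [HPB HB]]].
destruct (small_radius_ends_outward rB HrB) as [rA [HrA HA]].
(* Phi decreases, so the excess at rB is the least over [rA, rB]; hence one pair d, N, and one
   truncated field, serves all these shots. *)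
destruct (descent_a_priori (Phi rB) HPB) as [d [N [Hd [HN Hap]]]].
destruct (clamped_flow d (- N) 0 Hd ltac:(lra)) as [L [HL [Hex Hdep]]].
assert (Hch : forall r0, exists p : (R -> R) * (R -> R),
  fst p 0 = r0 /\ snd p 0 = 0 /\ clamped_solution d (- N) 0 (fst p) (snd p)).
{ intros r0. destruct (Hex r0 0) as [r [v H]]. exists (r, v). exact H. }
set (sol := fun r0 => proj1_sig (constructive_indefinite_description _ (Hch r0))).
assert (Hsol : forall r0, fst (sol r0) 0 = r0 /\ snd (sol r0) 0 = 0 /\
  clamped_solution d (- N) 0 (fst (sol r0)) (snd (sol r0))).
{ intros r0. unfold sol. destruct (constructive_indefinite_description _ (Hch r0)). assumption. }
clearbody sol.
assert (Hcr : forall r0 u, continuous (fst (sol r0)) u).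
{ intros r0 u. eapply is_derive_continuous, (Hsol r0). }
assert (Hcv : forall r0 u, continuous (snd (sol r0)) u).
{ intros r0 u. eapply is_derive_continuous, (Hsol r0). }
assert (Hbd : forall r0, rA <= r0 <= rB -> forall u, 0 <= u <= PI / 2 ->
   0 < fst (sol r0) u <= r0 /\ - N <= snd (sol r0) u /\
   d ^ 2 <= W2 u (fst (sol r0) u) (Rmin (snd (sol r0) u) 0)).
{ intros r0 Hr0 u Hu. destruct (Hsol r0) as [S1 [S2 S3]].
  assert (Hdec : Phi rB - Phi r0 <= h * (rB - r0)) by (apply Phi_decreasing; lra).
  assert (Hh := h_le).
  assert (Hdec' : Phi rB <= Phi (fst (sol r0) 0)) by (rewrite S1; nra).
  assert (H := Hap _ _ S3 ltac:(rewrite S1; lra) S2 Hdec' u Hu). rewrite S1 in H. exact H. }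
assert (Hdesc : forall r0, rA <= r0 <= rB -> descent (PI / 2) (fst (sol r0)) (snd (sol r0))).
{ intros r0 Hr0 u Hu. destruct (Hbd r0 Hr0 u ltac:(lra)) as [B1 [B2 B3]].
  destruct (Hsol r0) as [S1 [S2 S3]]. destruct (S3 u) as [D1 D2].
  assert (Hd2 : 0 < d ^ 2) by nra.
  assert (Br : 0 < fst (sol r0) u <= rmax) by lra.
  destruct (field_unclamped d N u (fst (sol r0) u) (snd (sol r0) u) Br B2 HN B3) as [U1 U2].
  rewrite U1 in D1. rewrite U2 in D2. split; [lra|split; [lra|split; assumption]]. }
(* The truncated flow is defined for every real r0, so continuity holds on all of R, in the form
   that the intermediate value theorem asks for. *)
assert (HSc : continuity (fun r0 => snd (sol r0) (PI / 2))).
{ intros x. apply continuity_pt_filterlim.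
  set (lip := sqrt (exp (4 * L * Rabs (PI / 2 - 0)))).
  assert (Hlip : 0 < lip) by (apply sqrt_lt_R0, exp_pos).
  apply (lipschitz_continuous (fun r0 => snd (sol r0) (PI / 2)) lip Hlip). intros s t.
  destruct (Hsol s) as [S1 [S2 S3]]. destruct (Hsol t) as [T1 [T2 T3]].
  assert (H := Hdep _ _ _ _ 0 (PI / 2) (fun t _ => conj (S3 t) (T3 t))).
  rewrite S1, S2, T1, T2 in H.
  assert (Hlip2 : lip ^ 2 = exp (4 * L * Rabs (PI / 2 - 0))) by (apply pow2_sqrt; left; apply exp_pos).
  rewrite <- Hlip2 in H.
  set (x1 := fst (sol s) (PI / 2) - fst (sol t) (PI / 2)) in *.
  set (x2 := snd (sol s) (PI / 2) - snd (sol t) (PI / 2)) in *.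
  assert (Hx1 := pow2_ge_0 x1).
  assert (Hx2 : x2 ^ 2 <= (lip * Rabs (s - t)) ^ 2).
  { rewrite Rpow_mult_distr, pow2_abs. replace ((0 - 0) ^ 2) with 0 in H by ring. lra. }
  rewrite <- (Rabs_pos_eq (lip * Rabs (s - t))) by (apply Rmult_le_pos; [lra|apply Rabs_pos]).
  apply Rsqr_le_abs_0. unfold Rsqr. lra. }
destruct (IVT_cor (fun r0 => snd (sol r0) (PI / 2)) rA rB HSc) as [r0 [Hr0 HS0]]; [lra| |].
{ destruct (Hsol rA) as [A1 [A2 A3]]. destruct (Hsol rB) as [B1 [B2 B3]].
  assert (HvA := HA _ _ (Hdesc rA ltac:(lra)) (Hcv rA) A1 A2).
  assert (HvB := HB _ _ (Hdesc rB ltac:(lra)) (Hcr rB) (Hcv rB) B1 B2). nra. }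
destruct (Hsol r0) as [S1 [S2 S3]].
exists d, N, (fst (sol r0)), (snd (sol r0)).
(* A positive value before pi / 2 would persist and contradict the vanishing at pi / 2. *)
assert (Hneg : forall u, 0 <= u <= PI / 2 -> snd (sol r0) u <= 0).
{ intros u Hu. destruct (Rle_dec (snd (sol r0) u) 0) as [|Hn]; [assumption|exfalso].
  destruct (Req_dec u (PI / 2)) as [E|E]; [rewrite E in Hn; lra|].
  assert (H := descent_v_stays_positive _ _ u (Hdesc r0 Hr0) S2 (fun u _ => Hcv r0 u)
    ltac:(lra) ltac:(lra) (PI / 2) ltac:(lra)). lra. }
split; [exact Hd|split; [exact HN|split; [exact S3|split; [exact S2|split; [exact HS0|]]]]].
intros u Hu. destruct (Hbd r0 Hr0 u Hu) as [B1 [B2 B3]]. specialize (Hneg u Hu).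
rewrite Rmin_left in B3 by exact Hneg. lra.
Qed.

(** * The periodic orbit *)

Lemma F_even r th : F r (- th) = F r th.
Proof.
unfold F. assert (E12 : c12 (- th) = c12 th) by (unfold c12; rewrite cos_neg; reflexivity).
assert (E13 : c13 (- th) = c23 th) by reflexivity.
assert (E23 : c23 (- th) = c13 th) by (unfold c23, c13, Rminus; rewrite Ropp_involutive; reflexivity).
assert (Eq : q (- th) = q th) by (unfold q, Rdiv; ring).
assert (A1 : A12 (- th) = A12 th) by (unfold A12; rewrite Eq, cos_neg; reflexivity).
assert (A2 : A13 (- th) = A23 th) by (unfold A13, A23, Rminus; rewrite Ropp_involutive; reflexivity).
assert (A3 : A23 (- th) = A13 th) by (unfold A13, A23, Rminus; rewrite Ropp_involutive; reflexivity).
rewrite E12, E13, E23, A1, A2, A3. ring.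
Qed.

Lemma D_even r th : D r (- th) = D r th.
Proof.
unfold D. assert (E12 : c12 (- th) = c12 th) by (unfold c12; rewrite cos_neg; reflexivity).
assert (E13 : c13 (- th) = c23 th) by reflexivity.
assert (E23 : c23 (- th) = c13 th) by (unfold c23, c13, Rminus; rewrite Ropp_involutive; reflexivity).
assert (Eq : q (- th) = q th) by (unfold q, Rdiv; ring).
rewrite E12, E13, E23, Eq. ring.
Qed.

Lemma W2_reflect u r v : W2 (- u) r (- v) = W2 u r v.
Proof.
unfold W2. rewrite sin_neg, cos_neg, Ropp_mult_distr_r_reverse, F_even. ring.
Qed.

Lemma W2_supplement u r v : W2 (PI - u) r (- v) = W2 u r v.
Proof. unfold W2. rewrite sin_PI_x, Rtrigo_facts.cos_pi_minus. ring. Qed.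

Lemma Q_reflect u r : Q (- u) r = Q u r.
Proof. unfold Q. rewrite sin_neg, cos_neg, Ropp_mult_distr_r_reverse, D_even. ring. Qed.

Lemma Q_supplement u r : Q (PI - u) r = Q u r.
Proof. unfold Q. rewrite sin_PI_x, Rtrigo_facts.cos_pi_minus. ring. Qed.

Lemma clamp_odd N v : 0 <= N -> clamp (- N) N (- v) = - clamp (- N) N v.
Proof.
intros HN. unfold clamp, Rmax, Rmin.
destruct (Rle_dec N (- v)), (Rle_dec N v);
repeat match goal with |- context [Rle_dec ?x ?y] => destruct (Rle_dec x y) end; lra.
Qed.

Lemma clamped_reflect d N r v : 0 < N -> clamped_solution d (- N) N r v ->
  clamped_solution d (- N) N (fun u => r (- u)) (fun u => - v (- u)).
Proof.
intros HN H u. destruct (H (- u)) as [H1 H2].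
assert (EW : Wc d (- N) N u (r (- u)) (- v (- u)) = Wc d (- N) N (- u) (r (- u)) (v (- u))).
{ unfold Wc. rewrite clamp_odd by lra. rewrite <- (W2_reflect u), Ropp_involutive. reflexivity. }
split.
- evar_last; [apply is_derive_reflect, H1|]. unfold field_r. rewrite EW, clamp_odd, cos_neg by lra. ring.
- evar_last.
  + apply (is_derive_opp (fun u => v (- u))). apply is_derive_reflect, H2.
  + unfold field_v. rewrite EW, Q_reflect. unfold opp; simpl. ring.
Qed.

Lemma clamped_supplement d N r v : 0 < N -> clamped_solution d (- N) N r v ->
  clamped_solution d (- N) N (fun u => r (PI - u)) (fun u => - v (PI - u)).
Proof.
intros HN H u. destruct (H (PI - u)) as [H1 H2].
assert (EW : Wc d (- N) N u (r (PI - u)) (- v (PI - u)) = Wc d (- N) N (PI - u) (r (PI - u)) (v (PI - u))).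
{ unfold Wc. rewrite clamp_odd by lra. rewrite <- (W2_supplement u), Ropp_involutive. reflexivity. }
split.
- evar_last; [apply is_derive_supplement, H1|].
  unfold field_r. rewrite EW, clamp_odd, Rtrigo_facts.cos_pi_minus by lra. ring.
- evar_last.
  + apply (is_derive_opp (fun u => v (PI - u))). apply is_derive_supplement, H2.
  + unfold field_v. rewrite EW, Q_supplement. unfold opp; simpl. ring.
Qed.

Definition w_of (r v : R -> R) (u : R) : R := sqrt (W2 u (r u) (v u)).

(* A regularized orbit parametrized by u, with the symmetries of the theorem. *)
Definition symmetric_orbit (r v : R -> R) : Prop :=
  forall u,
    0 < r u <= rmax /\ 0 < W2 u (r u) (v u) /\
    is_derive r u (a * v u * r u * cos u ^ 2 / w_of r v u) /\
    is_derive v u (a * (w_of r v u / 2 - Q u (r u) / w_of r v u)) /\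
    r (- u) = r u /\ v (- u) = - v u /\ r (PI - u) = r u /\ v (PI - u) = - v u.

(** Uniqueness gives the symmetries: nu = 0 at u = 0 makes the orbit agree with its reflection
    there, and nu = 0 at pi / 2 does so for u -> pi - u. The bounds of the quarter then spread to
    the whole line, so no clamp acts anywhere. *)
Lemma symmetric_orbit_exists : exists r v, symmetric_orbit r v.
Proof.
destruct shooting as [d [N [r [v [Hd [HN [Hsol [Hv0 [Hvp Hb]]]]]]]]].
assert (HP := PI2_3_2). assert (Hrm := rmax_pos).
destruct (clamped_flow d (- N) N Hd ltac:(lra)) as [L [HL [Hex Hdep]]].
destruct (Hex (r 0) 0) as [r' [v' [Hr0' [Hv0' Hsol']]]].
assert (Huniq : forall r1 v1 r2 v2 u0 u,
  (forall t, Rmin u0 u <= t <= Rmax u0 u -> clamped_at d (- N) N r1 v1 t /\ clamped_at d (- N) N r2 v2 t) ->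
  r1 u0 = r2 u0 -> v1 u0 = v2 u0 -> r1 u = r2 u /\ v1 u = v2 u).
{ intros r1 v1 r2 v2 u0 u Hc E1 E2. assert (H := Hdep _ _ _ _ u0 u Hc).
  rewrite E1, E2, !Rminus_diag in H.
  assert (Q1 := pow2_ge_0 (r1 u - r2 u)). assert (Q2 := pow2_ge_0 (v1 u - v2 u)).
  assert (Hz : ((0 ^ 2 + 0 ^ 2) * exp (4 * L * Rabs (u - u0))) = 0) by ring.
  rewrite Hz in H. split; nra. }
(* On the quarter - N <= nu <= 0, where the two truncations coincide. *)
assert (Hon : forall u, 0 <= u <= PI / 2 -> clamped_at d (- N) N r v u).
{ intros u Hu. destruct (Hb u Hu) as [B1 [B2 B3]]. destruct (Hsol u) as [S1 S2].
  assert (Ec : clamp (- N) N (v u) = clamp (- N) 0 (v u)).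
  { rewrite !clamp_id by lra. reflexivity. }
  split.
  - evar_last; [exact S1|]. unfold field_r, Wc. rewrite Ec. reflexivity.
  - evar_last; [exact S2|]. unfold field_v, Wc. rewrite Ec. reflexivity. }
assert (Heq : forall u, 0 <= u <= PI / 2 -> r' u = r u /\ v' u = v u).
{ intros u Hu. apply (Huniq r' v' r v 0 u); [|exact Hr0'|rewrite Hv0, Hv0'; reflexivity].
  rewrite Rmin_left, Rmax_right by lra. intros t Ht. split; [apply Hsol'|apply Hon; lra]. }
assert (Hrefl : forall u, r' (- u) = r' u /\ v' (- u) = - v' u).
{ intros u.
  destruct (Huniq (fun u => r' (- u)) (fun u => - v' (- u)) r' v' 0 u) as [E1 E2].
  - intros t _. split; [apply (clamped_reflect d N r' v' HN Hsol')|apply Hsol'].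
  - rewrite Ropp_0. reflexivity.
  - rewrite Ropp_0, Hv0'. apply Ropp_0.
  - split; [exact E1|]. cbv beta in E2. lra. }
assert (Hsupp : forall u, r' (PI - u) = r' u /\ v' (PI - u) = - v' u).
{ intros u.
  destruct (Huniq (fun u => r' (PI - u)) (fun u => - v' (PI - u)) r' v' (PI / 2) u) as [E1 E2].
  - intros t _. split; [apply (clamped_supplement d N r' v' HN Hsol')|apply Hsol'].
  - f_equal. field.
  - replace (PI - PI / 2) with (PI / 2) by field.
    destruct (Heq (PI / 2) ltac:(lra)) as [_ E]. rewrite E, Hvp. ring.
  - split; [exact E1|]. cbv beta in E2. lra. }
assert (Hall : forall u, 0 < r' u <= rmax /\ - N <= v' u <= N /\ d ^ 2 <= W2 u (r' u) (v' u)).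
{ apply reflection_induction.
  - intros u Hu. destruct (Heq u Hu) as [E1 E2]. rewrite E1, E2.
    destruct (Hb u Hu) as [B1 [B2 B3]]. lra.
  - intros u [B1 [B2 B3]]. destruct (Hrefl u) as [E1 E2]. rewrite E1, E2, W2_reflect. lra.
  - intros u [B1 [B2 B3]]. destruct (Hsupp u) as [E1 E2]. rewrite E1, E2, W2_supplement. lra. }
exists r', v'. intros u. destruct (Hall u) as [B1 [B2 B3]]. destruct (Hsol' u) as [S1 S2].
assert (Hd2 : 0 < d ^ 2) by nra.
assert (EW : Wc d (- N) N u (r' u) (v' u) = w_of r' v' u).
{ unfold Wc, w_of. rewrite !clamp_id by lra. rewrite Rmax_right by exact B3. reflexivity. }
unfold field_r in S1. unfold field_v in S2. rewrite EW in S1, S2.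
rewrite !clamp_id in S1 by lra. rewrite clamp_id in S2 by lra.
destruct (Hrefl u) as [E1 E2]. destruct (Hsupp u) as [E3 E4].
split; [exact B1|split; [lra|]].
split; [exact S1|split; [exact S2|]]. tauto.
Qed.

(** * Agreement with the extended equations of motion *)

Lemma extended_value_intro (f G : state -> R) (X : state) (l : R) :
  continuous G X -> G X = l ->
  locally X (fun Y : state => let '(r, nu, u, w) := Y in cos u <> 0 -> f Y = G Y) ->
  extended_value f X l.
Proof.
intros Hc <- Hloc. unfold extended_value.
apply (filterlim_ext_loc G).
- unfold within. revert Hloc. apply filter_imp. intros [[[r nu] u] w] H Hu. symmetry. apply H, Hu.
- eapply filterlim_filter_le_1; [apply filter_le_within|exact Hc].
Qed.

Definition st_r (Y : state) : R := fst (fst (fst Y)).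
Definition st_nu (Y : state) : R := snd (fst (fst Y)).
Definition st_u (Y : state) : R := snd (fst Y).
Definition st_w (Y : state) : R := snd Y.

Lemma continuous_state (X : state) :
  continuous st_r X /\ continuous st_nu X /\ continuous st_u X /\ continuous st_w X.
Proof.
destruct X as [[[r nu] u] w]. unfold st_r, st_nu, st_u, st_w.
assert (C1 : continuous (fun Y : state => fst Y) (r, nu, u, w)) by apply continuous_fst.
assert (C2 : continuous (fun Y : state => fst (fst Y)) (r, nu, u, w)).
{ apply (continuous_comp (fun Y : state => fst Y) (fun Z : R * R * R => fst Z)); [exact C1|apply continuous_fst]. }
repeat split.
- apply (continuous_comp (fun Y : state => fst (fst Y)) (fun Z : R * R => fst Z)); [exact C2|apply continuous_fst].
- apply (continuous_comp (fun Y : state => fst (fst Y)) (fun Z : R * R => snd Z)); [exact C2|apply continuous_snd].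
- apply (continuous_comp (fun Y : state => fst Y) (fun Z : R * R * R => snd Z)); [exact C1|apply continuous_snd].
- apply continuous_snd.
Qed.

Lemma x1_polar_arc r th : x1_polar n r th = r * c12 th.
Proof. unfold x1_polar, c12, kap. unfold Rdiv. ring. Qed.

(** The choice of theta_* enters here: mu2 = 4 m mu1 and tan theta_* = sqrt m give sqrt mu2 = 2 tan
    theta_* sqrt mu1. *)
Lemma x2_polar_arc r th : x2_polar n m r th = (r * c13 th - r * c23 th) / 2.
Proof.
assert (Hn := n_pos). assert (Hm := m_pos). assert (Hs := sin_a_pos).
assert (Hmu : 0 < mu1 n) by (unfold mu1; lra).
assert (Hsm : 0 < sqrt m) by (apply sqrt_lt_R0; lra).
assert (Hsk : 0 < sqrt (mu1 n)) by (apply sqrt_lt_R0; lra).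
assert (Ha := a_bounds). assert (Hca : 0 < cos a) by (apply cos_gt_0; lra).
assert (E : sqrt (mu2 n m) = 2 * (sin a / cos a) * sqrt (mu1 n)).
{ change (sin a / cos a) with (tan a). rewrite tan_a.
  replace (mu2 n m) with ((2 * 2) * m * mu1 n) by (unfold mu2, mu1; field).
  rewrite (sqrt_mult (2 * 2 * m)), (sqrt_mult (2 * 2) m), sqrt_square by lra. reflexivity. }
unfold x2_polar. rewrite E. unfold c13, c23, lam, kap.
rewrite sin_plus, sin_minus. field. lra.
Qed.

Lemma dist_S1_lt_PI x y : Rabs (x - y) < PI -> dist_S1 x y = Rabs (x - y).
Proof. intros H. unfold dist_S1. apply Rmin_left. lra. Qed.

Lemma U_Upot r th : Rabs th < a -> 0 < r -> r * c12 th < PI -> U n m r th = Upot r th.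
Proof.
intros H1 H2 H3. destruct (arcs_pos r th H1 H2 H3) as [D1 [D2 D3]].
assert (Hs := c12_split th). apply (f_equal (Rmult r)) in Hs. rewrite Rmult_plus_distr_l in Hs.
unfold U, potential, phi1_of, phi2_of, phi3_of. rewrite x1_polar_arc, x2_polar_arc.
set (x := r * c12 th) in *. set (y := r * c13 th) in *. set (z := r * c23 th) in *.
assert (E1 : - (x / 2) - m * ((y - z) / 2) - (x / 2 - m * ((y - z) / 2)) = - x) by field.
assert (E2 : - (x / 2) - m * ((y - z) / 2) - (1 - m) * ((y - z) / 2) = - y) by (rewrite Hs; field).
assert (E3 : x / 2 - m * ((y - z) / 2) - (1 - m) * ((y - z) / 2) = z) by (rewrite Hs; field).
rewrite !dist_S1_lt_PI; rewrite ?E1, ?E2, ?E3, ?Rabs_Ropp, ?Rabs_pos_eq by lra; try lra.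
unfold Upot. fold x y z. ring.
Qed.

Lemma theta_lt_a u : cos u <> 0 -> Rabs (a * sin u) < a.
Proof.
intros Hc. assert (Ha := a_bounds). assert (E := sin2_cos2 u). unfold Rsqr in E.
assert (0 < cos u * cos u) by nra. assert (- 1 < sin u < 1) by (split; nra).
apply Rabs_lt_between. split; nra.
Qed.

Lemma rhs_nu_smooth r nu u w : cos u <> 0 -> 0 < r -> r * c12 (a * sin u) < PI ->
  rhs_nu n m h (r, nu, u, w) =
  a * (- (1 / 2) * (nu ^ 2 * cos u ^ 2) + 2 * (r * h * cos u ^ 2)
       + (F r (a * sin u) + r * D r (a * sin u))).
Proof.
intros Hc Hr Hlt. assert (Ht := theta_lt_a u Hc).
assert (Hc12 := c12_pos _ (Rlt_le _ _ Ht)).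
unfold rhs_nu, theta_of. change (theta_star m) with a.
rewrite U_Upot by assumption.
assert (HD : Derive (fun r' => U n m r' (a * sin u)) r = Ur r (a * sin u)).
{ apply is_derive_unique.
  apply (is_derive_ext_loc (fun r' => Upot r' (a * sin u))).
  - apply (locally_interval _ r 0 (PI / c12 (a * sin u))); simpl; [lra| |].
    + apply Rmult_lt_reg_r with (c12 (a * sin u)); [exact Hc12|].
      unfold Rdiv. rewrite Rmult_assoc, Rinv_l by lra. lra.
    + intros y Hy1 Hy2. simpl in Hy1, Hy2. symmetry. apply U_Upot; [exact Ht|exact Hy1|].
      apply Rmult_lt_compat_r with (r := c12 (a * sin u)) in Hy2; [|exact Hc12].
      unfold Rdiv in Hy2. rewrite Rmult_assoc, Rinv_l in Hy2 by lra. lra.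
  - evar_last.
    + apply (is_derive_Upot (fun r => r) (fun _ => a * sin u) r 1 0); try assumption.
      * apply (is_derive_id (K := R_AbsRing)).
      * apply (is_derive_const (V := R_NormedModule)).
    + ring. }
rewrite HD, <- r_Ur, F_Upot, q_theta by assumption. ring.
Qed.

(** Near such u the differentiated function is F r (a sin u), so the derivative is a chain rule
    through [Fth], regular at cos u = 0. *)
Lemma rhs_w_smooth r nu u w : cos u <> 0 -> 0 < r -> r * c12 (a * sin u) < PI ->
  rhs_w n m h (r, nu, u, w) =
  - (1 / 2) * (a * nu * w * cos u ^ 2) + Fth r (a * sin u) * (a * cos u)
  + sin u * cos u * (nu ^ 2 - 2 * (r * h)).
Proof.
intros Hc Hr Hlt.
unfold rhs_w, theta_of. change (theta_star m) with a.
assert (HD : Derive (fun u' => r * U n m r (a * sin u') * cos u' ^ 2) u = Fth r (a * sin u) * (a * cos u)).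
{ apply is_derive_unique.
  apply (is_derive_ext_loc (fun u' => F r (a * sin u'))).
  - assert (C1 : continuous cos u) by (cont_deriv).
    assert (C2 : continuous (fun u => r * c12 (a * sin u)) u).
    { unfold c12. cont_deriv. }
    assert (L1 : locally u (fun y => cos y <> 0)) by (apply (C1 (fun z => z <> 0)), open_neq, Hc).
    assert (L2 : locally u (fun y => r * c12 (a * sin y) < PI)) by (apply (C2 (fun z => z < PI)), open_lt, Hlt).
    generalize (filter_and _ _ L1 L2). apply filter_imp. intros y [Y1 Y2].
    rewrite U_Upot, F_Upot, q_theta; [reflexivity| | | | | |]; try assumption; apply theta_lt_a, Y1.
  - evar_last.
    + apply (is_derive_F (fun _ => r) (fun u => a * sin u) u 0 (a * cos u)).
      * apply (is_derive_const (V := R_NormedModule)).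
      * auto_derive; [trivial|ring].
      * split; [apply Rabs_theta|split; lra].
    + ring. }
rewrite HD. field.
Qed.

Lemma energy_lhs_smooth r nu u w : cos u <> 0 -> 0 < r -> r * c12 (a * sin u) < PI ->
  energy_lhs n m (r, nu, u, w) = 1 / 2 * (nu ^ 2 * cos u ^ 2 + w ^ 2) - F r (a * sin u).
Proof.
intros Hc Hr Hlt. assert (Ht := theta_lt_a u Hc).
unfold energy_lhs, theta_of. change (theta_star m) with a.
rewrite U_Upot, F_Upot, q_theta by assumption. ring.
Qed.

Lemma locally_regular (X : state) : 0 < st_r X <= rmax ->
  locally X (fun Y => 0 < st_r Y /\ st_r Y * c12 (a * sin (st_u Y)) < PI).
Proof.
intros Hr. destruct (continuous_state X) as [C1 [C2 [C3 C4]]].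
assert (C5 : continuous (fun Y => st_r Y * c12 (a * sin (st_u Y))) X).
{ apply continuous_Rmult; [exact C1|].
  apply (continuous_comp_real (fun u => c12 (a * sin u)) st_u); [exact C3|].
  unfold c12. cont_deriv. }
assert (Hlt : st_r X * c12 (a * sin (st_u X)) < PI).
{ apply small_lt_PI; [apply Rabs_theta|lra]. }
apply filter_and.
- apply (C1 (fun z => 0 < z)), open_gt, Hr.
- apply (C5 (fun z => z < PI)), open_lt, Hlt.
Qed.

Lemma continuous_comp_smooth {T : UniformSpace} (f : R -> R) (g : T -> R) (x : T) :
  continuous g x -> (forall t, ex_derive f t) -> continuous (fun x => f (g x)) x.
Proof. intros Hg Hf. apply (continuous_comp_real f g); [exact Hg|apply ex_derive_cont, Hf]. Qed.

Section ExtendedValues.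
Variable X : state.
Hypothesis X_r : 0 < st_r X <= rmax.

Lemma extended_from_formula (f : state -> R) (G : state -> R) :
  continuous G X ->
  (forall r nu u w, cos u <> 0 -> 0 < r -> r * c12 (a * sin u) < PI ->
     f (r, nu, u, w) = G (r, nu, u, w)) ->
  extended_value f X (G X).
Proof.
intros Hc Hf. apply (extended_value_intro f G); [exact Hc|reflexivity|].
generalize (locally_regular X X_r). apply filter_imp.
intros [[[r nu] u] w] [H1 H2] Hu. apply Hf; assumption.
Qed.

Lemma continuous_pieces :
  continuous (fun Y => cos (st_u Y)) X /\ continuous (fun Y => sin (st_u Y)) X /\
  continuous (fun Y => cos (st_u Y) ^ 2) X /\ continuous (fun Y => st_nu Y ^ 2) X /\
  continuous (fun Y => F (st_r Y) (a * sin (st_u Y))) X /\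
  continuous (fun Y => D (st_r Y) (a * sin (st_u Y))) X /\
  continuous (fun Y => Fth (st_r Y) (a * sin (st_u Y))) X.
Proof.
destruct (continuous_state X) as [C1 [C2 [C3 C4]]].
assert (Hreg : regular (st_r X) (a * sin (st_u X))).
{ apply regular_small; [apply Rabs_theta|lra]. }
assert (Cth : continuous (fun Y => a * sin (st_u Y)) X).
{ apply (continuous_comp_smooth (fun u => a * sin u) st_u); [exact C3|]. intros t. auto_derive. trivial. }
repeat split.
- apply (continuous_comp_smooth cos st_u); [exact C3|]. intros t. auto_derive. trivial.
- apply (continuous_comp_smooth sin st_u); [exact C3|]. intros t. auto_derive. trivial.
- apply (continuous_comp_smooth (fun u => cos u ^ 2) st_u); [exact C3|]. intros t. auto_derive. trivial.
- apply (continuous_comp_smooth (fun u => u ^ 2) st_nu); [exact C2|]. intros t. auto_derive. trivial.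
- apply (continuous_path_F st_r (fun Y => a * sin (st_u Y))); assumption.
- apply (continuous_path_D st_r (fun Y => a * sin (st_u Y))); assumption.
- apply (continuous_path_Fth st_r (fun Y => a * sin (st_u Y))); assumption.
Qed.

Lemma extended_rhs_nu : extended_value (rhs_nu n m h) X
  (a * (- (1 / 2) * (st_nu X ^ 2 * cos (st_u X) ^ 2) + 2 * (st_r X * h * cos (st_u X) ^ 2)
       + (F (st_r X) (a * sin (st_u X)) + st_r X * D (st_r X) (a * sin (st_u X))))).
Proof.
destruct (continuous_state X) as [C1 [C2 [C3 C4]]].
destruct continuous_pieces as [K1 [K2 [K3 [K4 [K5 [K6 K7]]]]]].
apply (extended_from_formula (rhs_nu n m h) (fun Y =>
  a * (- (1 / 2) * (st_nu Y ^ 2 * cos (st_u Y) ^ 2) + 2 * (st_r Y * h * cos (st_u Y) ^ 2)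
       + (F (st_r Y) (a * sin (st_u Y)) + st_r Y * D (st_r Y) (a * sin (st_u Y)))))).
- apply continuous_Rmult; [apply continuous_const|].
  apply continuous_Rplus; apply continuous_Rplus.
  + apply continuous_Rmult; [apply continuous_const|]. apply continuous_Rmult; assumption.
  + apply continuous_Rmult; [apply continuous_const|]. apply continuous_Rmult; [|exact K3].
    apply continuous_Rmult; [exact C1|apply continuous_const].
  + exact K5.
  + apply continuous_Rmult; assumption.
- intros r nu u w. apply rhs_nu_smooth.
Qed.

Lemma extended_rhs_w : extended_value (rhs_w n m h) X
  (- (1 / 2) * (a * st_nu X * st_w X * cos (st_u X) ^ 2)
   + Fth (st_r X) (a * sin (st_u X)) * (a * cos (st_u X))
   + sin (st_u X) * cos (st_u X) * (st_nu X ^ 2 - 2 * (st_r X * h))).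
Proof.
destruct (continuous_state X) as [C1 [C2 [C3 C4]]].
destruct continuous_pieces as [K1 [K2 [K3 [K4 [K5 [K6 K7]]]]]].
apply (extended_from_formula (rhs_w n m h) (fun Y =>
  - (1 / 2) * (a * st_nu Y * st_w Y * cos (st_u Y) ^ 2)
   + Fth (st_r Y) (a * sin (st_u Y)) * (a * cos (st_u Y))
   + sin (st_u Y) * cos (st_u Y) * (st_nu Y ^ 2 - 2 * (st_r Y * h)))).
- apply continuous_Rplus; [apply continuous_Rplus|].
  + apply continuous_Rmult; [apply continuous_const|]. apply continuous_Rmult; [|exact K3].
    apply continuous_Rmult; [|exact C4]. apply continuous_Rmult; [apply continuous_const|exact C2].
  + apply continuous_Rmult; [exact K7|]. apply continuous_Rmult; [apply continuous_const|exact K1].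
  + apply continuous_Rmult; [apply continuous_Rmult; assumption|].
    apply continuous_Rminus; [exact K4|]. apply continuous_Rmult; [apply continuous_const|].
    apply continuous_Rmult; [exact C1|apply continuous_const].
- intros r nu u w. apply rhs_w_smooth.
Qed.

Lemma extended_energy : extended_value (energy_lhs n m) X
  (1 / 2 * (st_nu X ^ 2 * cos (st_u X) ^ 2 + st_w X ^ 2) - F (st_r X) (a * sin (st_u X))).
Proof.
destruct (continuous_state X) as [C1 [C2 [C3 C4]]].
destruct continuous_pieces as [K1 [K2 [K3 [K4 [K5 [K6 K7]]]]]].
apply (extended_from_formula (energy_lhs n m) (fun Y =>
  1 / 2 * (st_nu Y ^ 2 * cos (st_u Y) ^ 2 + st_w Y ^ 2) - F (st_r Y) (a * sin (st_u Y)))).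
- apply continuous_Rminus; [|exact K5]. apply continuous_Rmult; [apply continuous_const|].
  apply continuous_Rplus; [apply continuous_Rmult; assumption|].
  apply (continuous_comp_smooth (fun u => u ^ 2) st_w); [exact C4|]. intros t. auto_derive. trivial.
- intros r nu u w. apply energy_lhs_smooth.
Qed.

End ExtendedValues.

Section OrbitInS.
Variables r v : R -> R.
Hypothesis orbit : symmetric_orbit r v.

Lemma w_of_pos u : 0 < w_of r v u.
Proof. apply sqrt_lt_R0, orbit. Qed.

Lemma w_of_sq u : w_of r v u ^ 2 = W2 u (r u) (v u).
Proof. apply pow2_sqrt. left. apply orbit. Qed.

(** Differentiating the energy relation w^2 = W2 recovers the equation for w; division by w passes
    from s to u. *)
Lemma w_of_derive (u : R) : is_derive (w_of r v) u
  ((- (1 / 2) * (a * v u * w_of r v u * cos u ^ 2) + Fth (r u) (a * sin u) * (a * cos u)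
    + sin u * cos u * (v u ^ 2 - 2 * (r u * h))) / w_of r v u).
Proof.
destruct (orbit u) as [Hr [HW [Hdr [Hdv _]]]].
assert (Hw := w_of_pos u). assert (Hw2 := w_of_sq u).
assert (Hth : is_derive (fun u => a * sin u) u (a * cos u)) by (auto_derive; [trivial|ring]).
assert (Hreg : regular (r u) (a * sin u)).
{ apply regular_small; [apply Rabs_theta|lra]. }
assert (HF := is_derive_F r (fun u => a * sin u) u _ _ Hdr Hth Hreg).
assert (Hc2 : is_derive (fun u => cos u ^ 2) u (- 2 * sin u * cos u)) by (auto_derive; [trivial|ring]).
assert (Hsq : is_derive (fun x : R => x ^ 2) (v u) (2 * v u)).
{ auto_derive; [trivial|ring]. }
assert (Hv2 := is_derive_comp_real (fun x => x ^ 2) v u _ _ Hsq Hdv).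
assert (G1 := is_derive_Rmult _ _ _ _ _ Hdr Hc2).
assert (G2 := is_derive_Rmult _ _ _ _ _ Hv2 Hc2).
assert (G3 := is_derive_Rplus _ _ _ _ _ (is_derive_Rplus _ _ _ _ _ (is_derive_Rscal 2 _ _ _ HF)
   (is_derive_Rscal (2 * h) _ _ _ G1)) (is_derive_Rscal (- 1) _ _ _ G2)).
assert (Hs : is_derive sqrt (W2 u (r u) (v u)) (/ (2 * w_of r v u))).
{ apply is_derive_Reals. apply derivable_pt_lim_sqrt, HW. }
evar_last.
- apply (is_derive_comp_real sqrt (fun u => W2 u (r u) (v u))); [exact Hs|].
  eapply is_derive_ext; [|exact G3]. intros t. unfold W2. simpl. ring.
- cbv beta. unfold Q. set (w := w_of r v u) in *. clearbody w. field. lra.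
Qed.

End OrbitInS.

(** * Physical time and the configuration along the orbit *)

Section TimeChange.
Variables r v : R -> R.
Hypothesis orbit : symmetric_orbit r v.

Lemma orbit_continuous u : continuous r u /\ continuous v u /\ continuous (w_of r v) u.
Proof.
destruct (orbit u) as [_ [_ [H1 [H2 _]]]].
split; [|split]; eapply is_derive_continuous; [exact H1|exact H2|apply (w_of_derive r v orbit)].
Qed.

Lemma w_of_symmetric u : w_of r v (- u) = w_of r v u /\ w_of r v (PI - u) = w_of r v u.
Proof.
destruct (orbit u) as [_ [_ [_ [_ [E1 [E2 [E3 E4]]]]]]].
unfold w_of. rewrite E1, E2, E3, E4, W2_reflect, W2_supplement. split; reflexivity.
Qed.

Lemma r_shift u : r (u + PI) = r u.
Proof.
replace (u + PI) with (PI - - u) by ring.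
destruct (orbit (- u)) as [_ [_ [_ [_ [_ [_ [E _]]]]]]]. rewrite E. apply (orbit u).
Qed.

Definition rho (u : R) : R := Rpower (r u) (3 / 2).
(** This is dt / du, the speed dt / ds divided by du / ds = w. *)
Definition dtau (u : R) : R := a * rho u * cos u ^ 2 / w_of r v u.

Lemma rho_pos u : 0 < rho u.
Proof. apply exp_pos. Qed.

Lemma rho_continuous u : continuous rho u.
Proof.
unfold rho. apply (continuous_comp_real (fun x => Rpower x (3 / 2)) r); [apply orbit_continuous|].
assert (Hr := proj1 (orbit u)).
apply ex_derive_cont. unfold Rpower. auto_derive. lra.
Qed.

Lemma dtau_continuous u : continuous dtau u.
Proof.
unfold dtau. assert (Hw := w_of_pos r v orbit u).
apply continuous_Rmult.
- apply continuous_Rmult; [apply continuous_Rmult; [apply continuous_const|apply rho_continuous]|].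
  cont_deriv.
- apply (continuous_comp_real Rinv (w_of r v)); [apply orbit_continuous|].
  apply ex_derive_cont. auto_derive. lra.
Qed.

Lemma dtau_symmetric u : dtau (- u) = dtau u /\ dtau (PI - u) = dtau u.
Proof.
destruct (orbit u) as [_ [_ [_ [_ [E1 [_ [E3 _]]]]]]]. destruct (w_of_symmetric u) as [W1 W2'].
unfold dtau, rho. rewrite E1, E3, W1, W2', cos_neg, Rtrigo_facts.cos_pi_minus.
split; [reflexivity|]. unfold Rdiv. ring.
Qed.

(** By symmetry it is enough to bound the factors on [0, pi / 2]. The bound for 1 / w = ds / du has
    the same weak form, so that one inversion lemma serves both time changes. *)
Lemma speed_bounds : exists c, 0 < c /\ forall u,
  c * cos u ^ 2 <= dtau u /\ c * cos u ^ 2 <= / w_of r v u.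
Proof.
assert (HP := PI2_3_2). assert (Ha := a_bounds).
assert (Hci : forall u, continuous (fun u => w_of r v u / (a * rho u)) u).
{ intros u. assert (Hr := rho_pos u). apply continuous_Rmult; [apply orbit_continuous|].
  apply (continuous_comp_real Rinv (fun u => a * rho u)).
  - apply continuous_Rmult; [apply continuous_const|apply rho_continuous].
  - apply ex_derive_cont. auto_derive. nra. }
destruct (bounded_on_segment (fun u => w_of r v u / (a * rho u)) 0 (PI / 2) ltac:(lra) (fun u _ => Hci u))
  as [C1 [HC1 H1]].
destruct (bounded_on_segment (w_of r v) 0 (PI / 2) ltac:(lra) (fun u _ => proj2 (proj2 (orbit_continuous u))))
  as [C2 [HC2 H2]].
exists (Rmin (/ C1) (/ C2)). split; [apply Rmin_glb_lt; apply Rinv_0_lt_compat; assumption|].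
apply reflection_induction.
- intros u Hu. specialize (H1 u Hu). specialize (H2 u Hu). cbv beta in H1.
  assert (Hw := w_of_pos r v orbit u). assert (Hr := rho_pos u).
  assert (Har : 0 < a * rho u) by (apply Rmult_lt_0_compat; lra).
  assert (Hcu : 0 <= cos u ^ 2 <= 1).
  { assert (Hb := COS_bound u). split; nra. }
  assert (Hpos : 0 < Rmin (/ C1) (/ C2)) by (apply Rmin_glb_lt; apply Rinv_0_lt_compat; assumption).
  rewrite Rabs_pos_eq in H1 by (apply Rmult_le_pos; [lra|left; apply Rinv_0_lt_compat, Har]).
  rewrite Rabs_pos_eq in H2 by lra.
  split.
  + apply Rle_trans with (/ C1 * cos u ^ 2); [apply Rmult_le_compat_r; [lra|apply Rmin_l]|].
    replace (dtau u) with (/ (w_of r v u / (a * rho u)) * cos u ^ 2) by (unfold dtau; field; lra).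
    apply Rmult_le_compat_r; [lra|]. apply Rinv_le_contravar; [|exact H1].
    apply Rdiv_lt_0_compat; assumption.
  + apply Rle_trans with (/ C2).
    * assert (Hm := Rmin_r (/ C1) (/ C2)). nra.
    * apply Rinv_le_contravar; assumption.
- intros u [I1 I2]. destruct (dtau_symmetric u) as [E1 _]. destruct (w_of_symmetric u) as [E2 _].
  rewrite E1, E2, cos_neg. split; assumption.
- intros u [I1 I2]. destruct (dtau_symmetric u) as [_ E1]. destruct (w_of_symmetric u) as [_ E2].
  rewrite E1, E2, Rtrigo_facts.cos_pi_minus.
  replace ((- cos u) ^ 2) with (cos u ^ 2) by ring. split; assumption.
Qed.

Definition tau_u (u : R) : R := 0 + RInt dtau 0 u.
Definition s_u (u : R) : R := 0 + RInt (fun u => / w_of r v u) 0 u.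

Lemma tau_u_derive u : is_derive tau_u u (dtau u).
Proof. apply is_derive_integral. apply dtau_continuous. Qed.

Lemma s_u_derive u : is_derive s_u u (/ w_of r v u).
Proof.
apply (is_derive_integral (fun u => / w_of r v u)). intros x.
apply (continuous_comp_real Rinv (w_of r v)); [apply orbit_continuous|].
assert (Hw := w_of_pos r v orbit x). apply ex_derive_cont. auto_derive. lra.
Qed.

Lemma tau_u_0 : tau_u 0 = 0.
Proof. unfold tau_u. rewrite RInt_point. unfold zero; simpl. ring. Qed.

Lemma tau_u_opp u : tau_u (- u) = - tau_u u.
Proof.
assert (H := eq_increment_of_derive (fun u => - tau_u (- u)) tau_u dtau).
assert (E : - tau_u (- u) - - tau_u (- 0) = tau_u u - tau_u 0).
{ apply H.
  - intros x. evar_last.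
    + apply (is_derive_opp (fun u => tau_u (- u))). apply is_derive_reflect, tau_u_derive.
    + rewrite (proj1 (dtau_symmetric x)). unfold opp; simpl. ring.
  - intros x. apply tau_u_derive. }
rewrite Ropp_0, tau_u_0 in E. lra.
Qed.

Lemma tau_u_supplement u : tau_u (PI - u) = 2 * tau_u (PI / 2) - tau_u u.
Proof.
assert (H := eq_increment_of_derive (fun u => - tau_u (PI - u)) tau_u dtau).
assert (E : - tau_u (PI - u) - - tau_u (PI - PI / 2) = tau_u u - tau_u (PI / 2)).
{ apply H.
  - intros x. evar_last.
    + apply (is_derive_opp (fun u => tau_u (PI - u))). apply is_derive_supplement, tau_u_derive.
    + rewrite (proj2 (dtau_symmetric x)). unfold opp; simpl. ring.
  - intros x. apply tau_u_derive. }
replace (PI - PI / 2) with (PI / 2) in E by field. lra.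
Qed.

Lemma tau_u_shift u : tau_u (u + PI) = tau_u u + 2 * tau_u (PI / 2).
Proof.
replace (u + PI) with (PI - - u) by ring. rewrite tau_u_supplement, tau_u_opp. ring.
Qed.

Definition x1_u (u : R) : R := x1_polar n (r u) (theta_of m u).
Definition x2_u (u : R) : R := x2_polar n m (r u) (theta_of m u).

Lemma x1_u_arc u : x1_u u = r u * c12 (a * sin u).
Proof. apply x1_polar_arc. Qed.
Lemma x2_u_arc u : x2_u u = (r u * c13 (a * sin u) - r u * c23 (a * sin u)) / 2.
Proof. apply x2_polar_arc. Qed.

Lemma x_u_shift u : x1_u (u + PI) = x1_u u /\ x2_u (u + PI) = - x2_u u.
Proof.
unfold x1_u, x2_u, x1_polar, x2_polar, theta_of. rewrite r_shift, neg_sin.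
rewrite Ropp_mult_distr_r_reverse, cos_neg, sin_neg. unfold Rdiv. split; ring.
Qed.

Lemma x_u_supplement u : x1_u (PI - u) = x1_u u /\ x2_u (PI - u) = x2_u u.
Proof.
unfold x1_u, x2_u, theta_of. rewrite sin_PI_x.
destruct (orbit u) as [_ [_ [_ [_ [_ [_ [E _]]]]]]]. rewrite E. split; reflexivity.
Qed.

Lemma region_u u : region_I_with_sides (phi1_of m (x1_u u) (x2_u u)) (phi2_of m (x1_u u) (x2_u u))
   (phi3_of m (x1_u u) (x2_u u)) /\
  (0 < c13 (a * sin u) -> 0 < c23 (a * sin u) ->
   region_I (phi1_of m (x1_u u) (x2_u u)) (phi2_of m (x1_u u) (x2_u u)) (phi3_of m (x1_u u) (x2_u u))) /\
  (c23 (a * sin u) = 0 ->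
   collision_23 (phi1_of m (x1_u u) (x2_u u)) (phi2_of m (x1_u u) (x2_u u)) (phi3_of m (x1_u u) (x2_u u))).
Proof.
assert (Hr := proj1 (orbit u)).
assert (Hc := c12_pos _ (Rabs_theta u)). assert (Hc13 := c13_nonneg _ (Rabs_theta u)).
assert (Hc23 := c23_nonneg _ (Rabs_theta u)). assert (Hs := c12_split (a * sin u)).
assert (HPI : r u * c12 (a * sin u) < PI) by (apply small_lt_PI; [apply Rabs_theta|lra]).
assert (H12 : 0 < r u * c12 (a * sin u)) by (apply Rmult_lt_0_compat; lra).
unfold region_I_with_sides, region_I, collision_23, collision_13.
assert (E1 : x1_of (phi1_of m (x1_u u) (x2_u u)) (phi2_of m (x1_u u) (x2_u u)) (phi3_of m (x1_u u) (x2_u u))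
   = r u * c12 (a * sin u)).
{ unfold x1_of, phi1_of, phi2_of. rewrite x1_u_arc. field. }
assert (E2 : x2_of (phi1_of m (x1_u u) (x2_u u)) (phi2_of m (x1_u u) (x2_u u)) (phi3_of m (x1_u u) (x2_u u))
   = (r u * c13 (a * sin u) - r u * c23 (a * sin u)) / 2).
{ unfold x2_of, phi1_of, phi2_of, phi3_of. rewrite x2_u_arc. field. }
rewrite E1, E2.
assert (Hpos : forall c, 0 < c -> 0 < r u * c) by (intros c Hcc; apply Rmult_lt_0_compat; lra).
assert (Hin : 0 < c13 (a * sin u) -> 0 < c23 (a * sin u) ->
  (0 < r u * c12 (a * sin u) < PI) /\
  Rabs ((r u * c13 (a * sin u) - r u * c23 (a * sin u)) / 2) < r u * c12 (a * sin u) / 2).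
{ intros P13 P23. apply Hpos in P13. apply Hpos in P23. split; [lra|].
  rewrite Hs, Rmult_plus_distr_l. apply Rabs_lt_between. lra. }
split; [|split; [exact Hin|]].
- destruct (Rle_lt_or_eq_dec _ _ Hc13) as [P13|P13].
  + destruct (Rle_lt_or_eq_dec _ _ Hc23) as [P23|P23].
    * left. apply Hin; assumption.
    * right; left. split; [lra|]. rewrite Hs, <- P23. field.
  + right; right. split; [lra|]. rewrite Hs, <- P13. field.
- intros P23. split; [lra|]. rewrite Hs, P23. field.
Qed.

Definition phi1_u (u : R) : R := phi1_of m (x1_u u) (x2_u u).

(** With m = tan^2 a, the two terms of phi_1 merge by the addition formula cos a cos th + sin a sin
    th = cos (a - th). *)
Lemma phi1_u_formula u : phi1_u u = - (kap / (2 * cos a)) * (r u * cos (a - a * sin u)).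
Proof.
assert (Ha := a_bounds). assert (Hs := sin_a_pos). assert (Hca : 0 < cos a) by (apply cos_gt_0; lra).
assert (Hm : m = (sin a / cos a) ^ 2).
{ change (sin a / cos a) with (tan a). rewrite tan_a, pow2_sqrt; [reflexivity|left; apply m_pos]. }
unfold phi1_u, phi1_of. rewrite x1_u_arc, x2_u_arc. rewrite Hm.
unfold c12, c13, c23, lam. rewrite sin_plus, !sin_minus, cos_minus. field. lra.
Qed.

(* The velocity of the first body as a function of u, with the factor
   sin (a - theta) / cos u rewritten so that it is regular at u = pi / 2. *)
Definition velocity1 (u : R) : R :=
  - (kap / (2 * cos a)) * (r u / rho u)
  * (v u * cos (a - a * sin u) + w_of r v u * (a * cos u / ((1 + sin u) * xcsc (a - a * sin u)))).

Lemma phi1_u_derive u : cos u <> 0 -> is_derive phi1_u u (velocity1 u * dtau u).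
Proof.
intros Hcu. destruct (orbit u) as [Hr [_ [Hdr _]]].
assert (Hw := w_of_pos r v orbit u). assert (Hrho := rho_pos u).
assert (Ha := a_bounds). assert (Hca : 0 < cos a) by (apply cos_gt_0; lra).
assert (Hsu := SIN_bound u). assert (Htrig := sin2_cos2 u). unfold Rsqr in Htrig.
assert (Hs1 : 0 < 1 + sin u) by nra.
assert (Hang : Rabs (a - a * sin u) < PI) by (apply angles_lt_PI, Rabs_theta).
assert (HJ := xcsc_pos _ Hang). assert (HsJ := sin_xcsc _ Hang).
assert (Hdc : is_derive (fun u => cos (a - a * sin u)) u (sin (a - a * sin u) * (a * cos u))).
{ auto_derive; [trivial|]. unfold Rminus. ring. }
eapply is_derive_ext; [intros t; symmetry; apply phi1_u_formula|].
evar_last; [apply is_derive_Rscal, (is_derive_Rmult r (fun u => cos (a - a * sin u)) u _ _ Hdr Hdc)|].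
(* From 1 - sin u = cos^2 u / (1 + sin u); this factor cos^2 u cancels the one in dt / du. *)
assert (Hsin : sin (a - a * sin u) = a * cos u ^ 2 / ((1 + sin u) * xcsc (a - a * sin u))).
{ apply Rmult_eq_reg_r with (xcsc (a - a * sin u)); [|lra]. rewrite HsJ.
  replace (cos u ^ 2) with ((1 - sin u) * (1 + sin u)) by nra. field. lra. }
unfold velocity1, dtau. rewrite Hsin.
set (Jv := xcsc (a - a * sin u)) in *. set (w := w_of r v u) in *. set (p := rho u) in *.
clearbody Jv w p. field. repeat split; lra.
Qed.

(** The angular part vanishes with cos u, the radial part with nu: the shooting condition nu = 0 at
    pi / 2 is the condition that m1 be at rest at the collision. *)
Lemma velocity1_continuous : continuous velocity1 (PI / 2) /\ velocity1 (PI / 2) = 0.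
Proof.
assert (Ha := a_bounds). assert (Hrho := rho_pos (PI / 2)).
destruct (orbit_continuous (PI / 2)) as [C1 [C2 C3]].
assert (Hang : Rabs (a - a * sin (PI / 2)) < PI) by (apply angles_lt_PI, Rabs_theta).
assert (HJ := xcsc_pos _ Hang).
split.
- unfold velocity1. apply continuous_Rmult.
  + apply continuous_Rmult; [apply continuous_const|]. apply continuous_Rmult; [exact C1|].
    apply (continuous_comp_real Rinv rho); [apply rho_continuous|]. apply ex_derive_cont. auto_derive. lra.
  + apply continuous_Rplus; apply continuous_Rmult; try assumption.
    * cont_deriv.
    * apply continuous_Rmult; [cont_deriv|].
      apply (continuous_comp_real Rinv (fun u => (1 + sin u) * xcsc (a - a * sin u))).
      -- apply continuous_Rmult; [cont_deriv|].
         apply (continuous_comp_real xcsc (fun u => a - a * sin u)); [cont_deriv|].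
         apply continuous_xcsc, Hang.
      -- apply ex_derive_cont. auto_derive. rewrite sin_PI2 in *. nra.
- unfold velocity1. rewrite cos_PI2.
  assert (Hv : v (PI / 2) = 0).
  { destruct (orbit (PI / 2)) as [_ [_ [_ [_ [_ [_ [_ E]]]]]]].
    replace (PI - PI / 2) with (PI / 2) in E by field. lra. }
  rewrite Hv. unfold Rdiv. ring.
Qed.

End TimeChange.

(** The time from u = 0 to u = pi / 2 is a quarter period. Shifting u by pi reflects the
    configuration, and u -> pi - u preserves it; through [tau_u] these become the shift by T / 2 and
    t -> T / 2 - t. *)
Lemma symmetric_periodic_orbit :
  exists (phi1 phi2 phi3 : R -> R) (T : R),
    0 < T /\
    regularized_solution n m h phi1 phi2 phi3 /\
    (forall t, phi1 (t + T) = phi1 t /\ phi2 (t + T) = phi2 t /\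
               phi3 (t + T) = phi3 t) /\
    (forall t, n * phi1 t + n * phi2 t + m * phi3 t = 0) /\
    (forall t, region_I_with_sides (phi1 t) (phi2 t) (phi3 t)) /\
    (eulerian (phi1 0) (phi2 0) (phi3 0) /\
     (forall t, 0 <= t < T / 4 -> region_I (phi1 t) (phi2 t) (phi3 t)) /\
     collision_23 (phi1 (T / 4)) (phi2 (T / 4)) (phi3 (T / 4)) /\
     limit_velocity phi1 (T / 4) 0) /\
    (forall t, 0 <= t <= T / 4 ->
       phi1 (T / 2 - t) = phi1 t /\ phi2 (T / 2 - t) = phi2 t /\
       phi3 (T / 2 - t) = phi3 t) /\
    (forall t, 0 <= t <= T / 2 ->
       phi1 (t + T / 2) = - phi2 t /\ phi2 (t + T / 2) = - phi1 t /\
       phi3 (t + T / 2) = - phi3 t).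
Proof.
destruct symmetric_orbit_exists as [r [v orbit]].
assert (HPl := PI2_3_2). assert (Ha := a_bounds).
destruct (speed_bounds r v orbit) as [c [Hc Hsp]].
destruct (time_change_inverse (tau_u r v) (dtau r v) c Hc (tau_u_derive r v orbit) (fun u => proj1 (Hsp u)))
  as [V [HV1 [HV2 [HV3 HV4]]]].
destruct (time_change_inverse (s_u r v) (fun u => / w_of r v u) c Hc (s_u_derive r v orbit) (fun u => proj2 (Hsp u)))
  as [us [HS1 [HS2 [HS3 HS4]]]].
set (A := tau_u r v (PI / 2)).
assert (Hmono : forall x y, x < y -> tau_u r v x < tau_u r v y).
{ intros x y Hxy.
  assert (H := le_of_derive_le (fun u => c * cos2_primitive u) (tau_u r v) (fun u => c * cos u ^ 2) (dtau r v) x y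
    ltac:(lra) (fun u _ => is_derive_Rscal c _ _ _ (cos2_primitive_derive u))
    (fun u _ => tau_u_derive r v orbit u) (fun u _ => proj1 (Hsp u))).
  cbv beta in H. assert (H2 := cos2_primitive_increasing x y Hxy).
  assert (0 < c * (cos2_primitive y - cos2_primitive x)) by (apply Rmult_lt_0_compat; lra). lra. }
assert (HA : 0 < A).
{ rewrite <- (tau_u_0 r v). apply Hmono. lra. }
assert (HVmono : forall x y, x < y -> V x < V y).
{ intros x y Hxy. destruct (Rtotal_order (V x) (V y)) as [|[E|E]]; [assumption| |].
  - apply (f_equal (tau_u r v)) in E. rewrite !HV2 in E. lra.
  - apply Hmono in E. rewrite !HV2 in E. lra. }
assert (HV0 : V 0 = 0) by (rewrite <- (tau_u_0 r v) at 1; apply HV1).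
assert (HVA : V A = PI / 2) by apply HV1.
assert (HVshift : forall t, V (t + 2 * A) = V t + PI).
{ intros t. rewrite <- (HV1 (V t + PI)). f_equal. rewrite (tau_u_shift r v orbit), HV2. reflexivity. }
assert (HVsupp : forall t, V (2 * A - t) = PI - V t).
{ intros t. rewrite <- (HV1 (PI - V t)). f_equal. rewrite (tau_u_supplement r v orbit), HV2. reflexivity. }
set (P1 := fun t => phi1_of m (x1_u r (V t)) (x2_u r (V t))).
set (P2 := fun t => phi2_of m (x1_u r (V t)) (x2_u r (V t))).
set (P3 := fun t => phi3_of m (x1_u r (V t)) (x2_u r (V t))).
assert (Hhalf : forall t, P1 (t + 2 * A) = - P2 t /\ P2 (t + 2 * A) = - P1 t /\ P3 (t + 2 * A) = - P3 t).
{ intros t. unfold P1, P2, P3. rewrite HVshift.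
  destruct (x_u_shift r v orbit (V t)) as [E1 E2]. rewrite E1, E2.
  unfold phi1_of, phi2_of, phi3_of. repeat split; field. }
exists P1, P2, P3, (4 * A).
replace (4 * A / 4) with A by field. replace (4 * A / 2) with (2 * A) by field.
split; [lra|split; [|split; [|split; [|split; [|split; [|split]]]]]].
- exists (fun s => r (us s)), (fun s => v (us s)), us, (fun s => w_of r v (us s)), (fun s => tau_u r v (us s)).
  assert (HSd : forall s, is_derive us s (w_of r v (us s))).
  { intros s. assert (Hw := w_of_pos r v orbit (us s)).
    rewrite <- (HS2 s) at 1. rewrite <- (Rinv_inv (w_of r v (us s))).
    apply HS4; [apply s_u_derive, orbit|]. apply Rinv_neq_0_compat. lra. }
  split; [|split; [|split]].
  + intros s. destruct (orbit (us s)) as [Hr [HW [Hdr [Hdv _]]]].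
    assert (Hw := w_of_pos r v orbit (us s)). assert (Hw2 := w_of_sq r v orbit (us s)).
    set (X := (r (us s), v (us s), us s, w_of r v (us s)) : state).
    assert (HX : 0 < st_r X <= rmax) by exact Hr.
    split; [|split; [|split; [|split; [|split]]]].
    * split; [lra|].
      assert (Hlt : r (us s) * c12 (a * sin (us s)) < PI) by (apply small_lt_PI; [apply Rabs_theta|lra]).
      assert (Hcos := cos_pos_th _ (Rabs_theta (us s))).
      unfold c12, kap in Hlt. fold (mu1 n). unfold theta_of. change (theta_star m) with a.
      assert (Hn := n_pos). assert (Hmu : 0 < sqrt (mu1 n)) by (apply sqrt_lt_R0; unfold mu1; lra).
      apply Rmult_lt_reg_r with (/ sqrt (mu1 n) * cos (a * sin (us s))).
      { apply Rmult_lt_0_compat; [apply Rinv_0_lt_compat, Hmu|exact Hcos]. }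
      replace (sqrt (mu1 n) * PI / cos (a * sin (us s)) * (/ sqrt (mu1 n) * cos (a * sin (us s)))) with PI
        by (field; lra). exact Hlt.
    * evar_last; [apply (is_derive_comp_real r us); [exact Hdr|apply HSd]|].
      change (theta_star m) with a. field. lra.
    * exists (a * (w_of r v (us s) ^ 2 / 2 - Q (us s) (r (us s)))). split.
      -- assert (E := extended_rhs_nu X HX).
         replace (a * (w_of r v (us s) ^ 2 / 2 - Q (us s) (r (us s)))) with
          (a * (- (1 / 2) * (st_nu X ^ 2 * cos (st_u X) ^ 2) + 2 * (st_r X * h * cos (st_u X) ^ 2)
           + (F (st_r X) (a * sin (st_u X)) + st_r X * D (st_r X) (a * sin (st_u X))))); [exact E|].
         rewrite Hw2. unfold W2, Q, X, st_r, st_nu, st_u. simpl fst. simpl snd. field.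
      -- evar_last; [apply (is_derive_comp_real v us); [exact Hdv|apply HSd]|]. field. lra.
    * apply HSd.
    * eexists. split; [apply (extended_rhs_w X HX)|].
      evar_last; [apply (is_derive_comp_real (w_of r v) us); [apply w_of_derive, orbit|apply HSd]|].
      unfold X, st_r, st_nu, st_u, st_w. simpl fst. simpl snd. field. lra.
    * assert (E := extended_energy X HX).
      replace (r (us s) * h * cos (us s) ^ 2) with
        (1 / 2 * (st_nu X ^ 2 * cos (st_u X) ^ 2 + st_w X ^ 2) - F (st_r X) (a * sin (st_u X))); [exact E|].
      unfold X, st_r, st_nu, st_u, st_w. simpl fst. simpl snd. rewrite Hw2. unfold W2. field.
  + intros s. assert (Hw := w_of_pos r v orbit (us s)).
    evar_last; [apply (is_derive_comp_real (tau_u r v) us); [apply tau_u_derive, orbit|apply HSd]|].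
    unfold dtau, rho. change (theta_star m) with a. field. lra.
  + intros t. exists (s_u r v (V t)). rewrite HS1. apply HV2.
  + intros s. unfold P1, P2, P3. rewrite HV1. repeat split; reflexivity.
- intros t. replace (t + 4 * A) with (t + 2 * A + 2 * A) by ring.
  destruct (Hhalf (t + 2 * A)) as [E1 [E2 E3]]. destruct (Hhalf t) as [E4 [E5 E6]].
  rewrite E1, E2, E3, E4, E5, E6. repeat split; ring.
- intros t. unfold P1, P2, P3, phi1_of, phi2_of, phi3_of.
  assert (Hm : m = 1 - 2 * n) by (assert (H := mass_sum); lra).
  set (x1 := x1_u r (V t)). set (x2 := x2_u r (V t)). clearbody x1 x2.
  replace (n * (- (x1 / 2) - m * x2) + n * (x1 / 2 - m * x2) + m * ((1 - m) * x2))
    with (m * x2 * (1 - m - 2 * n)) by field.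
  rewrite Hm. ring.
- intros t. apply (region_u r v orbit).
- split; [|split; [|split]].
  + unfold eulerian, x2_of, P1, P2, P3, phi1_of, phi2_of, phi3_of. rewrite HV0, x2_u_arc.
    rewrite sin_0, Rmult_0_r. unfold c13, c23. rewrite Rplus_0_r, Rminus_0_r. field.
  + intros t Ht. assert (HVt : 0 <= V t < PI / 2).
    { split; [|rewrite <- HVA; apply HVmono; lra].
      destruct (Req_dec t 0) as [->|Hne]; [lra|]. left. rewrite <- HV0. apply HVmono. lra. }
    assert (Hth := theta_range (V t) HVt).
    apply (region_u r v orbit); [apply c13_pos|apply c23_pos]; apply Rabs_lt_a; exact Hth.
  + apply (region_u r v orbit). rewrite HVA, sin_PI2. unfold c23.
    rewrite Rmult_1_r, Rminus_diag, sin_0. ring.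
  + destruct (velocity1_continuous r v orbit) as [Hvc Hv0].
    (* In this range pi / 2 is the only zero of cos, so no other collision interferes near the
       quarter period. *)
    assert (Hnear : locally A (fun t => - (PI / 2) < V t < 3 * (PI / 2))).
    { apply (filter_and (fun t => - (PI / 2) < V t) (fun t => V t < 3 * (PI / 2))).
      - apply (HV3 A (fun z => - (PI / 2) < z)), open_gt. rewrite HVA. lra.
      - apply (HV3 A (fun z => z < 3 * (PI / 2))), open_lt. rewrite HVA. lra. }
    assert (Hder : locally' A (fun t => is_derive P1 t (velocity1 r v (V t)))).
    { unfold locally', within. revert Hnear. apply filter_imp. intros t Ht Hne.
      assert (HVne : V t <> PI / 2).
      { rewrite <- HVA. intros E. apply (f_equal (tau_u r v)) in E. rewrite !HV2 in E. apply Hne, E. }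
      assert (Hcos : cos (V t) <> 0).
      { destruct (Rtotal_order (V t) (PI / 2)) as [Hl|[Hl|Hl]]; [|contradiction|].
        - apply Rgt_not_eq, cos_gt_0; lra.
        - apply Rlt_not_eq, cos_lt_0; lra. }
      assert (Hw := w_of_pos r v orbit (V t)). assert (Hrho := rho_pos r (V t)).
      assert (Hdt : dtau r v (V t) <> 0).
      { assert (Hcs := proj1 (Hsp (V t))). assert (0 < cos (V t) ^ 2) by nra.
        assert (0 < c * cos (V t) ^ 2) by (apply Rmult_lt_0_compat; lra). lra. }
      assert (HdV := HV4 (V t) _ (tau_u_derive r v orbit (V t)) Hdt). rewrite HV2 in HdV.
      evar_last; [apply (is_derive_comp_real (phi1_u r) V); [apply (phi1_u_derive r v orbit), Hcos|exact HdV]|].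
      field. exact Hdt. }
    split.
    * revert Hder. apply filter_imp. intros t Ht. eexists. exact Ht.
    * unfold is_lim. simpl Rbar_locally. simpl Rbar_locally'.
      apply (filterlim_ext_loc (fun t => velocity1 r v (V t))).
      -- revert Hder. apply filter_imp. intros t Ht. symmetry. apply is_derive_unique, Ht.
      -- rewrite <- Hv0. eapply filterlim_filter_le_1; [apply filter_le_within|].
         rewrite <- HVA. apply (continuous_comp_real (velocity1 r v) V A); [apply HV3|].
         rewrite HVA. exact Hvc.
- intros t _. unfold P1, P2, P3. rewrite HVsupp.
  destruct (x_u_supplement r v orbit (V t)) as [E1 E2]. rewrite E1, E2. repeat split; reflexivity.
- intros t _. apply Hhalf.
Qed.

End ThreeBody.

Theorem theorem2 (m n h : R) (hn : 0 < n) (hm : 0 < m) (hmass : 2 * n + m = 1)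
    (hh : h <= -1) :
  exists (phi1 phi2 phi3 : R -> R) (T : R),
    0 < T /\
    regularized_solution n m h phi1 phi2 phi3 /\
    (forall t, phi1 (t + T) = phi1 t /\ phi2 (t + T) = phi2 t /\
               phi3 (t + T) = phi3 t) /\
    (forall t, n * phi1 t + n * phi2 t + m * phi3 t = 0) /\
    (* (i) *)
    (forall t, region_I_with_sides (phi1 t) (phi2 t) (phi3 t)) /\
    (* (ii) *)
    (eulerian (phi1 0) (phi2 0) (phi3 0) /\
     (forall t, 0 <= t < T / 4 -> region_I (phi1 t) (phi2 t) (phi3 t)) /\
     collision_23 (phi1 (T / 4)) (phi2 (T / 4)) (phi3 (T / 4)) /\
     limit_velocity phi1 (T / 4) 0) /\
    (* (iii) *)
    (forall t, 0 <= t <= T / 4 ->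
       phi1 (T / 2 - t) = phi1 t /\ phi2 (T / 2 - t) = phi2 t /\
       phi3 (T / 2 - t) = phi3 t) /\
    (forall t, 0 <= t <= T / 2 ->
       phi1 (t + T / 2) = - phi2 t /\ phi2 (t + T / 2) = - phi1 t /\
       phi3 (t + T / 2) = - phi3 t).
Proof.
exact (@symmetric_periodic_orbit (Build_three_body n m h hn hm hmass hh)).
Qed.
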